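(* Let $\mathcal{M}$ be a smooth connected $N$-dimensional compact Riemannian manifold without boundary, let $F:\mathbb{R}\to\mathbb{R}$ be of class $C^2$, and let $\mathcal{E}:H^1(\mathcal{M})\to\mathbb{R}$ be the functional $$\mathcal{E}(u)=\int_{\mathcal{M}}\Big\{\frac{|\nabla u|^2}{2}-F(u)\Big\}\,d\mu .$$ Suppose that the Ricci curvature of $\mathcal{M}$ is non-negative. Then any local minimizer of $\mathcal{E}$ is a constant function.
   Context: $d\mu$ is the Riemannian measure and $H^1(\mathcal{M})$ the usual Sobolev space; $F$ is such that $\mathcal{E}$ is a well-defined real-valued functional on $H^1(\mathcal{M})$. A function $u_0\in C^\infty(\mathcal{M})$ is a local minimizer of $\mathcal{E}$ if there is $\delta>0$ such that $\mathcal{E}(u_0)\le\mathcal{E}(u)$ whenever $\|u-u_0\|_{H^1(\mathcal{M})}\le\delta$. Non-negative Ricci curvature means $\mathrm{Ric}(X,X)\ge 0$ for every tangent vector $X$ (with the sign convention that round spheres have positive Ricci curvature). *)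

(* Defs.v *)
From HB Require Import structures.
From mathcomp Require Import all_boot all_order all_algebra.
From mathcomp Require Import all_classical all_reals all_analysis.

Set Implicit Arguments.
Unset Strict Implicit.
Unset Printing Implicit Defensive.

Import Order.TTheory GRing.Theory Num.Theory.
Import numFieldNormedType.Exports.

Local Open Scope classical_set_scope.
Local Open Scope ring_scope.

Section euclidean.
Context {R : realType}.

Definition partial {n} (i : 'I_n) (f : 'rV[R]_n -> R) : 'rV[R]_n -> R :=
  fun x => 'D_(delta_mx 0 i) f x.

(* f is C^oo on the open set U: the iterated partial derivatives of all orders
   (in any sequence s of directions) exist and are continuous on U. *)
Definition smooth_on {n} (U : set 'rV[R]_n) (f : 'rV[R]_n -> R) : Prop :=
  forall s : seq 'I_n, forall x, U x ->
    {for x, continuous (foldr partial f s)} /\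
    forall i, derivable (foldr partial f s) x (delta_mx 0 i).

Definition C2 (F : R -> R) : Prop :=
  [/\ forall x, derivable F x 1, forall x, derivable (derive1 F) x 1
    & continuous (derive1n 2 F)].

(* Lebesgue integral over R^n of a nonnegative Borel function, as an iterated
   one-dimensional integral (Tonelli). *)
Fixpoint lebesgue_int n : ('rV[R]_n -> \bar R) -> \bar R :=
  match n with
  | 0 => fun f => f 0
  | m.+1 => fun f =>
      (\int[lebesgue_measure]_(x in [set: R])
         lebesgue_int (fun v : 'rV[R]_m =>
           f (row_mx (x%:M : 'M[R]_1) v : 'rV_(1 + m))))%E
  end.

(* Curvature of a metric given by its matrix g x in coordinates x. *)
Section curvature.
Context {n : nat} (g : 'rV[R]_n -> 'M[R]_n).

(* Gamma^k_{ij} *)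
Definition christoffel (k i j : 'I_n) (x : 'rV[R]_n) : R :=
  2^-1 * \sum_l invmx (g x) k l *
    (partial i (fun y => g y j l) x + partial j (fun y => g y i l) x
     - partial l (fun y => g y i j) x).

(* The d_l-component of R(d_i, d_j) d_k, where
   R(X, Y) Z = nabla_X nabla_Y Z - nabla_Y nabla_X Z - nabla_[X, Y] Z. *)
Definition riemann (l k i j : 'I_n) (x : 'rV[R]_n) : R :=
  partial i (christoffel l j k) x - partial j (christoffel l i k) x
  + \sum_m (christoffel m j k x * christoffel l i m x
            - christoffel m i k x * christoffel l j m x).

(* Ric(Y, Z) is the trace of X |-> R(X, Y) Z, so round spheres have positive
   Ricci curvature. *)
Definition ricci (x : 'rV[R]_n) : 'M[R]_n :=
  \matrix_(j, k) \sum_i riemann i k i j x.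

End curvature.

End euclidean.

Section manifolds.
Context (R : realType) (N : nat).

Record chart (M : topologicalType) := Chart {
  dom : set M ;
  coord :> M -> 'rV[R]_N ;
  icoord : 'rV[R]_N -> M ;
  open_dom : open dom ;
  open_cod : open (coord @` dom) ;
  coordK : forall p, dom p -> icoord (coord p) = p ;
  continuous_coord : {within dom, continuous coord} ;
  continuous_icoord : {within coord @` dom, continuous icoord} }.

Definition cod (M : topologicalType) (c : chart M) : set 'rV[R]_N :=
  c @` dom c.

Definition transition (M : topologicalType) (c c' : chart M) :
  'rV[R]_N -> 'rV[R]_N := c' \o icoord c.

(* All charts have open image in R^N, so there is no boundary. The atlas need
   not be maximal. *)
Record smoothManifold := SmoothManifold {
  carrier :> ptopologicalType ;
  hausdorff_carrier : hausdorff_space carrier ;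
  second_countable_carrier : @second_countable carrier ;
  atlas : set (chart carrier) ;
  chart_at : carrier -> chart carrier ;
  chart_at_atlas : forall p, atlas (chart_at p) ;
  chart_at_dom : forall p, dom (chart_at p) p ;
  transition_smooth : forall c c', atlas c -> atlas c' -> forall i,
    smooth_on (c @` (dom c `&` dom c')) (fun x => transition c c' x 0 i) }.

(* metric c x is the matrix of the metric in the chart c at the point of
   coordinates x. Tangent vectors are row vectors of components, on which
   the Jacobian matrix of a change of chart acts from the right. *)
Record riemannianManifold := RiemannianManifold {
  manifold :> smoothManifold ;
  metric : chart manifold -> 'rV[R]_N -> 'M[R]_N ;
  metric_smooth : forall c, atlas c -> forall i j,
    smooth_on (cod c) (fun x => metric c x i j) ;
  metric_sym : forall c x, atlas c -> cod c x -> (metric c x)^T = metric c x ;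
  metric_pos : forall c x, atlas c -> cod c x -> forall v : 'rV[R]_N, v != 0 ->
    0 < (v *m metric c x *m v^T) 0 0 ;
  metric_transition : forall c c' x, atlas c -> atlas c' ->
    (c @` (dom c `&` dom c')) x ->
    metric c x = 'J (transition c c') x *m metric c' (transition c c' x)
                 *m ('J (transition c c') x)^T }.

Definition nonneg_ricci (M : riemannianManifold) : Prop :=
  forall (c : chart M) x, atlas c -> cod c x -> forall v : 'rV[R]_N,
    0 <= (v *m ricci (metric c) x *m v^T) 0 0.

Definition smooth_fun (M : smoothManifold) (u : M -> R) : Prop :=
  forall c : chart M, atlas c -> smooth_on (cod c) (u \o icoord c).

(* A vector field, given by its components vcomp c p in each chart c. *)
Record vfield (M : smoothManifold) := VField {
  vcomp :> chart M -> M -> 'rV[R]_N ;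
  vcomp_transition : forall c c' p, atlas c -> atlas c' ->
    dom c p -> dom c' p ->
    vcomp c' p = vcomp c p *m 'J (transition c c') (c p) }.

Definition smooth_vfield (M : smoothManifold) (X : vfield M) : Prop :=
  forall c : chart M, atlas c -> forall i,
    smooth_on (cod c) (fun x => X c (icoord c x) 0 i).

Section riemannian.
Variable M : riemannianManifold.

(* Inner product on T_p M, with tangent vectors at p written in the
   distinguished chart at p. *)
Definition inner_at (p : M) (v w : 'rV[R]_N) : R :=
  (v *m metric (chart_at p) (chart_at p p) *m w^T) 0 0.

Definition inner (X Y : vfield M) (p : M) : R :=
  inner_at p (X (chart_at p) p) (Y (chart_at p) p).

Definition sqrt_det (c : chart M) (x : 'rV[R]_N) : R :=
  Num.sqrt (\det (metric c x)).

Definition divergence (X : vfield M) (p : M) : R :=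
  let c := chart_at p in
  (sqrt_det c (c p))^-1 *
    \sum_i partial i (fun x => sqrt_det c x * X c (icoord c x) 0 i) (c p).

End riemannian.

End manifolds.

Notation borel M := (g_sigma_algebraType (@open M)).

Section analysis.
Context {R : realType} {N : nat} {M : riemannianManifold R N}.

(* mu is the Riemannian measure: d mu = sqrt (det g) dx in every chart. This
   determines mu, since countably many charts cover M. *)
Definition is_riemannian_measure (mu : {measure set (borel M) -> \bar R}) :
    Prop :=
  forall c : chart R N M, atlas c ->
  forall A : set (borel M), measurable A -> A `<=` dom c ->
    mu A = lebesgue_int (fun x => (\1_(c @` A) x * sqrt_det c x)%:E).

Definition measurable_vfield (X : vfield M) : Prop :=
  forall c : chart R N M, atlas c -> forall i,
    measurable_fun (dom c : set (borel M)) (fun p : borel M => X c p 0 i).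

(* An element of H^1(M) = W^{1,2}(M): a function in L^2 together with its weak
   gradient, which is unique up to a null set and required to be in L^2. As
   usual, two elements that agree almost everywhere are not distinguished by
   any of the notions below. *)
Record H1 (mu : {measure set (borel M) -> \bar R}) := MkH1 {
  H1fun :> M -> R ;
  grad : vfield M ;
  H1fun_measurable : measurable_fun [set: borel M] (H1fun : borel M -> R) ;
  H1fun_L2 : mu.-integrable [set: borel M] (fun p => (H1fun p ^+ 2)%:E) ;
  grad_measurable : measurable_vfield grad ;
  grad_L2 : mu.-integrable [set: borel M] (fun p => (inner grad grad p)%:E) ;
  grad_weak : forall X : vfield M, smooth_vfield X ->
    (\int[mu]_(p in [set: borel M]) (H1fun p * divergence X p)
     = - \int[mu]_(p in [set: borel M]) inner grad X p)%R }.

Section functional.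
Context {mu : {measure set (borel M) -> \bar R}}.

(* The H^1 norm of u - v. *)
Definition H1dist (u v : H1 mu) : R :=
  Num.sqrt (\int[mu]_(p in [set: borel M])
    ((u p - v p) ^+ 2
     + let w := grad u (chart_at p) p - grad v (chart_at p) p in
       inner_at p w w))%R.

Definition energy_density (F : R -> R) (u : H1 mu) (p : M) : R :=
  inner (grad u) (grad u) p / 2 - F (u p).

Definition energy (F : R -> R) (u : H1 mu) : R :=
  (\int[mu]_(p in [set: borel M]) energy_density F u p)%R.

Definition energy_well_defined (F : R -> R) : Prop :=
  forall u : H1 mu,
    mu.-integrable [set: borel M] (fun p => (energy_density F u p)%:E).

Definition local_minimizer (F : R -> R) (u0 : H1 mu) : Prop :=
  smooth_fun u0 /\
  exists2 delta : R, 0 < delta &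
    forall u : H1 mu, H1dist u u0 <= delta -> energy F u0 <= energy F u.

End functional.

End analysis.

(* Main.v *)
(* Let u be the minimizer, w = |grad u|^2 and L = Delta u. The first variation
   gives L = - F'(u), the second one gives that the integral of
   |grad phi|^2 - F''(u) phi^2 is nonnegative for every smooth phi. Put
   B = Delta w / 2 - <grad u, grad L> = Delta w / 2 + F''(u) w and
   z = |grad w|^2 / 4. Since Ric >= 0, Bochner's formula gives B >= |Hess u|^2,
   whence B w - z >= 0 (Kato), L^2 <= N B and the refinement
   (L w - <grad w, grad u> / 2)^2 <= N w (B w - z).
   Taking phi = sqrt (w + e) bounds the integral of (B w - z + e B) / (w + e) by
   C e. Hence B w = z, so that L w = <grad w, grad u> / 2, and the integral of
   B / (w + e) stays bounded as e tends to 0. Integrating the divergence of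
   u / sqrt (w + e) * grad u then gives
   int w / sqrt (w + e) = - e int u L / (w + e)^(3/2),
   and by L^2 <= N B and the monotonicity in e of int B / (w + e), the right-hand
   side tends to 0 along a sequence of values of e. So w = 0. *)

Require Import Defs.
From HB Require Import structures.
From mathcomp Require Import all_boot all_order all_algebra.
From mathcomp Require Import all_classical all_reals all_analysis.
From mathcomp Require Import finmap measurable_realfun ring lra.
Set Implicit Arguments.
Unset Strict Implicit.
Unset Printing Implicit Defensive.
Import Order.TTheory GRing.Theory Num.Theory.
Import numFieldNormedType.Exports.
Local Open Scope classical_set_scope.
Local Open Scope ring_scope.

(** * Calculus on R^n *)

(** With q = <grad w, grad u> / 2, the unit field grad u / |grad u| has divergence (L w - q) /
    w^(3/2) away from the critical points of u. In the equality case this is 0, so that multiplying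
    by u and integrating by parts would formally give that the integral of |grad u| vanishes. The
    obstacle is the critical set, about which nothing is known: sqrt w is not smooth there. Hence
    every division is by w + e, and the identity acquires the error e u L / (w + e)^(3/2), which is
    of order e^(-1/2) at a critical point where u L is nonzero. The bound on the integral of B / (w
    + e), a by-product of the same second variation, is what controls this error. The test function
    sqrt (w + e) is a smooth substitute for |grad u|: differentiating L = - F'(u) along grad u
    produces the term F''(u) w, the very one that the second variation contains for |grad u|. Only e
    F''(u) is left over, whence the constant C, the absolute value of the integral of F''(u). *)

Section directional.
Context {R : realType} {V : normedModType R}.
Implicit Types (f : V -> R) (a v : V).

Lemma is_derive_line f a v (t : R) : derivable f (a + t *: v) v ->
  is_derive t 1 (fun t => f (a + t *: v)) ('D_v f (a + t *: v)).
Proof.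
move=> d.
have E : (fun h : R => h^-1 *: ((f \o shift (a + t *: v)) (h *: v) - f (a + t *: v)))
   = (fun h => h^-1 *: (((fun t => f (a + t *: v)) \o shift t) (h *: 1)
        - f (a + t *: v))).
  apply/funext => h /=; congr (_ *: (f _ - _)).
  by rewrite [h *: 1]mulr1 scalerDl addrCA.
by split; [rewrite /derivable -E | rewrite /derive -E].
Qed.

(** The increment [s] may have either sign, whence the absolute values: the coordinates of an
    arbitrary displacement can then be substituted for it. *)
Lemma MVT_line f a v (s : R) :
  (forall t, `|t| <= `|s| -> derivable f (a + t *: v) v) ->
  exists2 c, `|c| <= `|s| & f (a + s *: v) - f a = s * 'D_v f (a + c *: v).
Proof.
move=> d.
have [s0|s0] := leP 0 s.
- have [||c cI E] := @MVT_segment R (fun t => f (a + t *: v))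
     (fun t => 'D_v f (a + t *: v)) 0 s s0.
  + move=> x; rewrite in_itv/= => /andP[x0 xs]; apply: is_derive_line; apply: d.
    by rewrite !ger0_norm// ltW.
  + apply: derivable_within_continuous => x; rewrite in_itv/= => /andP[x0 xs].
    have xs' : `|x| <= `|s| by rewrite !ger0_norm.
    exact: (@ex_derive _ _ _ _ _ _ _ (is_derive_line (d _ xs'))).
  + move: cI; rewrite in_itv/= => /andP[c0 cs].
    exists c; first by rewrite !ger0_norm.
    by move: E; rewrite scale0r addr0 subr0 mulrC.
- have [||c cI E] := @MVT_segment R (fun t => f (a + t *: v))
     (fun t => 'D_v f (a + t *: v)) s 0 (ltW s0).
  + move=> x; rewrite in_itv/= => /andP[x0 xs]; apply: is_derive_line; apply: d.
    by rewrite !ler0_norm ?lerN2// ltW.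
  + apply: derivable_within_continuous => x; rewrite in_itv/= => /andP[x0 xs].
    have xs' : `|x| <= `|s| by rewrite !ler0_norm ?lerN2// ltW.
    exact: (@ex_derive _ _ _ _ _ _ _ (is_derive_line (d _ xs'))).
  + move: cI; rewrite in_itv/= => /andP[c0 cs].
    exists c; first by rewrite !ler0_norm ?lerN2// ltW.
    move: E; rewrite scale0r addr0 sub0r => E.
    by rewrite -[LHS]opprB E mulrN opprK mulrC.
Qed.

(** The inner map is only known to have a derivative along [v]. Restricted to the line through [a]
    it depends on one real variable, where derivability is differentiability, and the chain rule for
    differentials applies. *)
Lemma derive_diff_comp {W : normedModType R} (h : W -> R) (g : V -> W) a v :
  derivable g a v -> differentiable h (g a) ->
  is_derive a v (h \o g) ('d h (g a) ('D_v g a)).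
Proof.
move=> dg dh; pose gl (t : R) := g (t *: v + a).
have gl0 : gl 0 = g a by rewrite /gl scale0r add0r.
have E1 (U : normedModType R) (k : V -> U) :
   (fun h => h^-1 *: ((k \o shift a) (h *: v) - k a)) =
   (fun h => h^-1 *: (((fun t : R => k (t *: v + a)) \o shift 0) (h *: 1) - k (0 *: v + a))).
  apply/funext => t /=; congr (_ *: (k _ - k _)).
    by rewrite [t *: 1]mulr1 addr0.
  by rewrite scale0r add0r.
have dgl : derivable gl 0 1 by rewrite /derivable -E1.
have /derivable1_diffP dgl' := dgl.
have dhgl : differentiable (h \o gl) 0.
  by apply: differentiable_comp => //; rewrite gl0.
have D : 'D_v g a = 'd gl 0 1 by rewrite -deriveE// /derive (E1 _ g).
split.
  by move/derivable1_diffP: dhgl; rewrite /derivable (E1 _ (h \o g)).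
transitivity ('D_1 (h \o gl) 0); first by rewrite /derive (E1 _ (h \o g)).
rewrite deriveE// diff_comp//; last by rewrite gl0.
by rewrite /= gl0 D.
Qed.

Lemma derive1_comp_dir (h : R -> R) f a v : derivable f a v ->
  derivable h (f a) 1 -> is_derive a v (h \o f) (derive1 h (f a) * 'D_v f a).
Proof.
move=> df dh; have /derivable1_diffP dh' := dh.
have [? E] := derive_diff_comp df dh'.
by split; [|rewrite E (deriv1E dh); exact: mulrC].
Qed.

End directional.

Section rV.
Context {R : realType}.

Lemma coord_norm n (x : 'rV[R]_n) i : `|x 0 i| <= `|x|.
Proof.
rewrite [leRHS]/Num.Def.normr/= mx_normrE; exact: (le_bigmax _ _ (0, i)).
Qed.

Lemma norm_coord n (x : 'rV[R]_n) e : 0 <= e -> (forall i, `|x 0 i| <= e) -> `|x| <= e.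
Proof.
move=> e0 h; rewrite [leLHS]/Num.Def.normr/= mx_normrE.
by apply: bigmax_le => // -[i j] _ /=; rewrite ord1.
Qed.

Lemma continuous_row n (T : topologicalType) (g : 'I_n -> T -> R) x :
  (forall i, {for x, continuous (g i)}) ->
  {for x, continuous (fun y => \row_i g i y : 'rV[R]_n)}.
Proof.
move=> gc; apply/cvgrPdist_le => e e0.
have H i : \forall y \near x, `|g i x - g i y| <= e.
  by move/cvgrPdist_le : (gc i); exact.
move/filter_forall : H; apply: filterS => y yH; apply: norm_coord; first exact: ltW.
by move=> i; rewrite !mxE.
Qed.

Lemma continuous_sum (T : topologicalType) (I : Type) (r : seq I) (P : pred I)
    (F : I -> T -> R) x : (forall i, P i -> {for x, continuous (F i)}) ->
  {for x, continuous (fun y => \sum_(i <- r | P i) F i y)}.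
Proof.
move=> Fc; elim: r => [|i r IH].
  rewrite (_ : (fun _ => _) = cst 0); first exact: cvg_cst.
  by apply/funext => y; rewrite big_nil.
case: (boolP (P i)) => Pi; last first.
  suff -> : (fun y => \sum_(i <- i :: r | P i) F i y) =
    (fun y => \sum_(i <- r | P i) F i y) by [].
  by apply/funext => y; rewrite big_cons (negbTE Pi).
have -> : (fun y => \sum_(i <- i :: r | P i) F i y) =
    (fun y => F i y + \sum_(i <- r | P i) F i y).
  by apply/funext => y; rewrite big_cons Pi.
by apply: cvgD => //; exact: Fc.
Qed.

Local Notation e_ i := (delta_mx 0 i).

Definition trunc n k (h : 'rV[R]_n) : 'rV[R]_n := \row_i (if (i < k)%N then h 0 i else 0).

(** The displacement [h] is split into moves along the axes through the points [x + trunc k h]. Each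
    move is a one-dimensional mean value, and continuity of the partial derivatives compares it with
    the one at [x]. *)
Lemma C1_differentiable n (f : 'rV[R]_n -> R) x :
  (\forall y \near x, forall i, derivable f y (e_ i)) ->
  (forall i, {for x, continuous (partial i f)}) -> differentiable f x.
Proof.
move=> fd fc.
pose df (v : 'rV[R]_n) := \sum_i v 0 i * partial i f x.
have lin : linear df.
  move=> k u v; rewrite /df scaler_sumr -big_split/=; apply: eq_bigr => i _.
  by rewrite !mxE mulrDl -mulrA.
pose L := GRing.isLinear.Build _ _ _ _ _ lin.
pose dfL : {linear 'rV[R]_n -> R} := HB.pack df L.
have cdf : continuous dfL.
  move=> v; apply: continuous_sum => i _.
  exact: (continuousM (@coord_continuous _ _ _ 0 i v) (@cst_continuous _ _ _ _)).
suff E : f \o shift x = cst (f x) + dfL +o_ 0 id.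
  by apply/diff_locallyP; rewrite (diff_unique cdf E).
(* Each of the [n] moves costs at most [e' * |h|]; dividing by [n.+1] also covers dimension 0. *)
apply/eqaddoP => e e0; pose e' := e / n.+1%:R.
have e'0 : 0 < e' by rewrite divr_gt0.
have N : \forall y \near x, forall i, derivable f y (e_ i) /\ `|partial i f x - partial i f y| <= e'.
  have H i : \forall y \near x, `|partial i f x - partial i f y| <= e'.
    by move/cvgrPdist_le : (fc i); exact.
  move/filter_forall : H fd; apply: filterS2 => y h1 h2 i; split; [exact: h2|exact: h1].
move/nbhs_ballP : N => [d /= d0 dN].
apply/nbhs_ballP; exists d => //= h; rewrite -ball_normE /= sub0r normrN => hd.
rewrite /= [X in `|X|](_ : _ = f (h + x) - (f x + df h))//.
have P k (kn : (k < n)%N) c : `|c| <= `|h 0 (Ordinal kn)| ->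
    ball x d (x + trunc k h + c *: e_ (Ordinal kn)).
  move=> ck; rewrite -ball_normE /= -addrA opprD addNKr normrN.
  apply: le_lt_trans hd; apply: norm_coord => // i.
  rewrite !mxE eqxx/=; case: ifPn => ik.
    by rewrite (_ : i == _ = false) ?mulr0 ?addr0 ?coord_norm//; apply/eqP => E; rewrite E /= ltnn in ik.
  rewrite add0r; case: eqVneq => _; rewrite ?mulr1 ?mulr0 ?normr0//.
  exact: le_trans ck (coord_norm _ _).
have S k (kn : (k < n)%N) : trunc k.+1 h = trunc k h + h 0 (Ordinal kn) *: e_ (Ordinal kn).
  apply/rowP => i; rewrite !mxE eqxx/= ltnS leq_eqVlt.
  case: (eqVneq i (Ordinal kn)) => [->|ne] /=; first by rewrite eqxx ltnn mulr1 add0r.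
  rewrite (_ : (i == k :> nat) = false) /= ?mulr0 ?addr0//.
  by apply/eqP => E; move/eqP: ne; apply; apply: val_inj.
have T : f (h + x) - f x = \sum_(0 <= k < n) (f (x + trunc k.+1 h) - f (x + trunc k h)).
  rewrite telescope_sumr//; congr (f _ - f _).
    by rewrite addrC; congr (_ + _); apply/rowP => i; rewrite !mxE ltn_ord.
  by rewrite (_ : trunc 0 h = 0) ?addr0//; apply/rowP => i; rewrite !mxE.
rewrite opprD addrA T big_mkord /df -sumrB (le_trans (ler_norm_sum _ _ _))//.
apply: (@le_trans _ _ (\sum_(i < n) e' * `|h|)).
  apply: ler_sum => -[k kn] _ /=; rewrite (S k kn) (addrA x).
  have [t tk|c ck ->] := @MVT_line R _ f (x + trunc k h) (e_ (Ordinal kn)) (h 0 (Ordinal kn)).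
    exact: (dN _ (P k kn t tk) (Ordinal kn)).1.
  rewrite -mulrBr normrM mulrC ler_pM// ?coord_norm//.
  by rewrite distrC; exact: (dN _ (P k kn c ck) (Ordinal kn)).2.
rewrite sumr_const card_ord -[X in X <= _]mulr_natr /e'.
rewrite mulrAC ler_wpM2r//. 
rewrite -mulrA; apply: ler_piMr; first exact: ltW.
by rewrite mulrC ler_pdivrMr// mul1r ler_nat.
Qed.

End rV.

(** * Flat functions, from which bumps are built *)

Section flat.
Context {R : realType}.
Implicit Types (x : R).

(** The classical exp(-1/x), extended by 0, is the case [k = 0]. The powers of [x^-1] make the
    family closed under derivation up to linear combinations, so one derivative formula is
    enough. *)
Definition flat (k : nat) x : R := if 0 < x then x^-1 ^+ k * expR (- x^-1) else 0.

(** Comes from the term of degree [k.+1] in the exponential series at [x^-1]. The spare factor [x]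
    gives the limit 0 at 0 for all [k]; as the difference quotient of [flat k] at 0 is [flat k.+1],
    this also settles derivability there. *)
Lemma flat_bound k x : `|flat k x| <= (k.+1)`!%:R * `|x|.
Proof.
rewrite /flat; case: ifPn => x0; last by rewrite normr0 mulr_ge0.
have y0 : 0 < x^-1 by rewrite invr_gt0.
have e0 : 0 < expR x^-1 by rewrite expR_gt0.
rewrite !gtr0_norm ?mulr_gt0 ?exprn_gt0 ?expR_gt0// expRN ler_pdivrMr//.
have F : (0 : R) < k.+1`!%:R by rewrite ltr0n fact_gt0.
have H : x^-1 ^+ k.+1 / (k.+1)`!%:R <= expR x^-1.
  by apply: le_trans (expR_ge1Dxn k (ltW y0)); rewrite lerDr.
rewrite ler_pdivrMr// mulrC in H.
have -> : x^-1 ^+ k = x * x^-1 ^+ k.+1 by rewrite exprS mulrA mulfV ?mul1r// gt_eqF.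
by rewrite [_ * x]mulrC -mulrA ler_wpM2l ?(ltW x0).
Qed.

Lemma flat_is_derive k x : is_derive x 1 (flat k) (flat k.+2 x - k%:R * flat k.+1 x).
Proof.
have [x0|x0|<-] := ltgtP 0 x.
- apply: (@near_eq_is_derive _ _ _ (fun x => x^-1 ^+ k * expR (- x^-1))).
    near=> y; have y0 : 0 < y by near: y; exact: lt_nbhsr.
    by rewrite /flat y0.
  have dV : is_derive x 1 (fun x => x^-1) (- x ^- 2).
    have xn0 : id x != 0 by rewrite /= gt_eqF.
    split; first exact: derivableV.
    by rewrite deriveV// derive_id [LHS]mulr1.
  have dN : is_derive x 1 (fun x => - x^-1) (x ^- 2).
    by have := is_deriveN dV; rewrite opprK.
  have dE : is_derive x 1 (fun x => expR (- x^-1)) (expR (- x^-1) * x ^- 2).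
    have := @derive1_comp_dir R R expR (fun x => - x^-1) x 1 _ _.
    rewrite derive1E (derive_val (is_derive := is_derive_expR _)) (derive_val (is_derive := dN)).
    by apply.
  have dX := is_deriveX k dV.
  have dM := is_deriveM dX dE.
  rewrite (_ : (fun x => _) = ((fun x => x^-1) ^+ k * (fun x => expR (- x^-1)))); last first.
    by apply/funext => y; rewrite mulrfctE exprfctE.
  apply: (is_derive_eq dM).
  rewrite /flat x0 exprfctE -exprVn.
  case: k {dX dM} => [|k] /=; last by rewrite !exprS /GRing.scale/=; ring.
  by rewrite /GRing.scale/=; ring.

- apply: (@near_eq_is_derive _ _ _ (cst 0)).
    near=> y; have y0 : y < 0 by near: y; exact: lt_nbhsl.
    by rewrite /flat ltNge (ltW y0).
  apply: is_derive_eq; rewrite /flat ltNge (ltW x0) /= mulr0 subrr//.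
- have f0 j : flat j 0 = 0 by rewrite /flat ltxx.
  rewrite !f0 mulr0 subrr.
  have H : (fun h => h^-1 *: ((flat k \o shift 0) (h *: 1) - flat k 0)) @ 0^' --> (0 : R).
    apply/cvgrPdist_le => e e0; near=> h.
    have hn0 : h != 0 by near: h; exact: nbhs_dnbhs_neq.
    rewrite sub0r normrN /= f0 subr0 addr0 [h *: 1]mulr1.
    have -> : h^-1 *: flat k h = flat k.+1 h.
      by rewrite /flat; case: ifP => _; rewrite ?scaler0// exprS -mulrA.
    apply: le_trans (flat_bound _ _) _.
    rewrite mulrC -ler_pdivlMr ?ltr0n ?fact_gt0//.
    near: h; apply: dnbhs0_le; by rewrite divr_gt0// ltr0n fact_gt0.
  by split; [apply/cvg_ex; exists 0 | apply: cvg_lim].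
Unshelve. all: by end_near. Qed.

Lemma flat_continuous k : continuous (flat k).
Proof.
move=> x; apply/differentiable_continuous/derivable1_diffP.
by have [] := flat_is_derive k x.
Qed.

Lemma flat_ge0 k x : 0 <= flat k x.
Proof.
rewrite /flat; case: ifPn => // x0.
by rewrite mulr_ge0 ?expR_ge0// exprn_ge0// invr_ge0 ltW.
Qed.

Lemma flat_gt0 k x : 0 < x -> 0 < flat k x.
Proof.
by move=> x0; rewrite /flat x0 mulr_gt0 ?expR_gt0// exprn_gt0// invr_gt0.
Qed.

Lemma flat0 k x : x <= 0 -> flat k x = 0.
Proof. by move=> x0; rewrite /flat ltNge x0. Qed.

End flat.

(** * Closure properties of smooth functions *)

Section smooth.
Context {R : realType}.
Local Notation e_ i := (delta_mx 0 i).

Lemma foldr_rcons_partial n (f : 'rV[R]_n -> R) i s :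
  foldr partial f (rcons s i) = foldr partial (partial i f) s.
Proof. by rewrite foldr_rcons. Qed.

Lemma smooth_on_partial n (U : set 'rV[R]_n) f i :
  smooth_on U f -> smooth_on U (partial i f).
Proof. by move=> sf s x Ux; rewrite -foldr_rcons_partial; exact: sf. Qed.

Lemma smooth_on_continuous n (U : set 'rV[R]_n) f x :
  smooth_on U f -> U x -> {for x, continuous f}.
Proof. by move=> sf Ux; have [] := sf [::] x Ux. Qed.

Lemma smooth_on_derivable n (U : set 'rV[R]_n) f x i :
  smooth_on U f -> U x -> derivable f x (e_ i).
Proof. by move=> sf Ux; have [] := sf [::] x Ux. Qed.

Lemma open_near n (U : set 'rV[R]_n) x : open U -> U x -> \forall y \near x, U y.
Proof. by move=> oU Ux; apply: open_nbhs_nbhs. Qed.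

Lemma smooth_on_differentiable n (U : set 'rV[R]_n) f x :
  open U -> smooth_on U f -> U x -> differentiable f x.
Proof.
move=> oU sf Ux; apply: C1_differentiable.
  by move: (open_near oU Ux); apply: filterS => y Uy i; exact: smooth_on_derivable sf Uy.
by move=> i; apply: smooth_on_continuous Ux; exact: smooth_on_partial.
Qed.

Lemma partial_near n (f g : 'rV[R]_n -> R) i x :
  (\forall y \near x, f y = g y) -> partial i f x = partial i g x.
Proof. exact: near_eq_derive. Qed.

Lemma partial_eq_on n (U : set 'rV[R]_n) (f g : 'rV[R]_n -> R) i x : open U ->
  (forall y, U y -> f y = g y) -> U x -> partial i f x = partial i g x.
Proof.
move=> oU fg Ux; apply: partial_near.
by move: (open_near oU Ux); apply: filterS => y /fg.
Qed.

(** Iterating the step shows that each [foldr partial f s] agrees on the open set [U] with a member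
    of [P]. Smoothness is thereby proved by coinduction, without formulas for higher derivatives. *)
Lemma smooth_on_coind n (U : set 'rV[R]_n) (P : ('rV[R]_n -> R) -> Prop) :
  open U ->
  (forall f, P f -> (forall x, U x -> {for x, continuous f} /\
      forall i, derivable f x (e_ i)) /\
    forall i, exists2 g, P g & forall x, U x -> partial i f x = g x) ->
  forall f, P f -> smooth_on U f.
Proof.
move=> oU step f Pf s.
have [g Pg fg] : exists2 g, P g & forall x, U x -> foldr partial f s x = g x.
  elim: s => [|i s [g Pg fg]]; first by exists f.
  have [_ /(_ i)[h Ph gh]] := step _ Pg.
  by exists h => // x Ux; rewrite -gh//=; exact: (partial_eq_on i oU fg).
have [gs _] := step _ Pg.
move=> x Ux; have [gc gd] := gs x Ux.
have N : \forall y \near x, g y = foldr partial f s y.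
  by move: (open_near oU Ux); apply: filterS => y /fg.
split.
  suff : foldr partial f s @ x --> foldr partial f s x by [].
  by rewrite (fg x Ux); exact: (cvg_trans (near_eq_cvg N) gc).
by move=> i; apply: near_eq_derivable (gd i).
Qed.

(* The class generated by these operations is stable under partial derivatives,
   which yields all the closure properties of [smooth_on] at once. *)
Inductive sgen n (U : set 'rV[R]_n) : ('rV[R]_n -> R) -> Prop :=
| sgen_base f : smooth_on U f -> sgen U f
| sgen_cst a : sgen U (fun=> a)
| sgen_coord i : sgen U (fun x => x 0 i)
| sgen_add f g : sgen U f -> sgen U g -> sgen U (fun x => f x + g x)
| sgen_mul f g : sgen U f -> sgen U g -> sgen U (fun x => f x * g x)
| sgen_inv f : sgen U f -> (forall x, U x -> f x != 0) ->
    sgen U (fun x => (f x)^-1)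
| sgen_sqrt f : sgen U f -> (forall x, U x -> 0 < f x) ->
    sgen U (fun x => Num.sqrt (f x))
| sgen_flat k f : sgen U f -> sgen U (fun x => flat k (f x))
| sgen_comp m (V : set 'rV[R]_m) h (g : 'I_m -> 'rV[R]_n -> R) :
    open V -> smooth_on V h -> (forall j, sgen U (g j)) ->
    (forall x, U x -> V (\row_j g j x)) -> sgen U (fun x => h (\row_j g j x)).

Lemma sgen_sum n (U : set 'rV[R]_n) m (F : 'I_m -> 'rV[R]_n -> R) :
  (forall i, sgen U (F i)) -> sgen U (fun x => \sum_i F i x).
Proof.
elim: m F => [|m IH] F sF.
  rewrite (_ : (fun _ => _) = (fun=> 0)); first exact: sgen_cst.
  by apply/funext => x; rewrite big_ord0.
rewrite (_ : (fun _ => _) = (fun x => F ord0 x + \sum_i F (lift ord0 i) x)).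
  by apply: sgen_add => //; exact: IH.
by apply/funext => x; rewrite big_ord_recl.
Qed.

Lemma derive_row n m (g : 'I_m -> 'rV[R]_n -> R) x v :
  (forall j, derivable (g j) x v) ->
  is_derive x v (fun y => \row_j g j y : 'rV[R]_m) (\row_j 'D_v (g j) x).
Proof.
move=> dg; have d : derivable (fun y => \row_j g j y : 'rV[R]_m) x v.
  apply/derivable_mxP => i j.
  rewrite (_ : (fun _ => _) = g j)//; by apply/funext => y; rewrite mxE.
split=> //; rewrite derive_mx//; apply/matrixP => i j; rewrite !mxE.
by congr ('D_v _ x); apply/funext => y; rewrite mxE.
Qed.

Lemma diff_partial n (h : 'rV[R]_n -> R) y v : differentiable h y ->
  'd h y v = \sum_j v 0 j * partial j h y.
Proof.
move=> dh; rewrite [X in 'd h y X]row_sum_delta linear_sum/=.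
by apply: eq_bigr => j _; rewrite linearZ /partial deriveE.
Qed.

Lemma partial_comp n m (h : 'rV[R]_m -> R) (g : 'I_m -> 'rV[R]_n -> R) x i :
  differentiable h (\row_j g j x) -> (forall j, derivable (g j) x (e_ i)) ->
  is_derive x (e_ i) (fun x => h (\row_j g j x))
    (\sum_j partial i (g j) x * partial j h (\row_j g j x)).
Proof.
move=> dh dg; have [d1 d2] := derive_row dg.
apply: is_derive_eq (derive_diff_comp d1 dh) _.
rewrite d2 diff_partial//; apply: eq_bigr => j _; by rewrite mxE.
Qed.

Lemma sgen_step n (U : set 'rV[R]_n) : open U ->
  forall f, sgen U f -> (forall x, U x -> {for x, continuous f} /\
      forall i, derivable f x (e_ i)) /\
    forall i, exists2 g, sgen U g & forall x, U x -> partial i f x = g x.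
Proof.
move=> oU f; elim => {f}.
- move=> f sf; split.
    by move=> x Ux; split=> [|i]; [exact: smooth_on_continuous sf Ux|exact: smooth_on_derivable sf Ux].
  by move=> i; exists (partial i f) => //; apply/sgen_base/smooth_on_partial.
- move=> a; split; first by move=> x _; split=> [|i]; [exact: (@cst_continuous _ _ a x)|exact: derivable_cst].
  by move=> i; exists (fun=> 0) => [|x _]; [exact: sgen_cst|rewrite /partial derive_cst].
- move=> j; have D (x : 'rV[R]_n) i : is_derive x (e_ i) (fun x : 'rV[R]_n => x 0 j) ((i == j)%:R).
    have H : is_derive x (e_ i) (fun x : 'rV[R]_n => x) (e_ i) by exact: is_derive_id.
    have [/derivable_mxP/(_ 0 j) ? E] := H; split=> //.
    by move/matrixP/(_ 0 j) : E; rewrite derive_mx ?mxE ?eqxx/= 1?eq_sym//.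
  split; first by move=> x _; split=> [|i]; [exact: coord_continuous|have [] := D x i].
  by move=> i; exists (fun=> (i == j)%:R) => [|x _]; [exact: sgen_cst|have [] := D x i].
- move=> f g sf [fs fp] sg [gs gp]; split.
    move=> x Ux; have [[fc fd] [gc gd]] := (fs x Ux, gs x Ux).
    by split=> [|i]; [exact: (cvgD fc gc)|exact: derivableD].
  move=> i; have [[f' sf' Ef] [g' sg' Eg]] := (fp i, gp i).
  exists (fun x => f' x + g' x) => [|x Ux]; first exact: sgen_add.
  have [[_ fd] [_ gd]] := (fs x Ux, gs x Ux).
  by rewrite -Ef// -Eg// /partial deriveD.
- move=> f g sf [fs fp] sg [gs gp]; split.
    move=> x Ux; have [[fc fd] [gc gd]] := (fs x Ux, gs x Ux).
    by split=> [|i]; [exact: (cvgM fc gc)|exact: derivableM].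
  move=> i; have [[f' sf' Ef] [g' sg' Eg]] := (fp i, gp i).
  exists (fun x => f x * g' x + g x * f' x) => [|x Ux].
    by apply: sgen_add; exact: sgen_mul.
  have [[_ fd] [_ gd]] := (fs x Ux, gs x Ux).
  by rewrite -Ef// -Eg// /partial deriveM.
- move=> f sf [fs fp] f0; split.
    move=> x Ux; have [fc fd] := fs x Ux.
    by split=> [|i]; [exact: (cvgV (f0 x Ux) fc)|apply: derivableV => //; exact: f0].
  move=> i; have [f' sf' Ef] := fp i.
  exists (fun x => -1 * ((f x)^-1 * (f x)^-1) * f' x) => [|x Ux].
    apply: sgen_mul => //; apply: sgen_mul; first exact: sgen_cst.
    by apply: sgen_mul; exact: sgen_inv.
  have [_ fd] := fs x Ux.
  by rewrite -Ef// /partial deriveV ?f0// expr2 invfM mulN1r.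
- move=> f sf [fs fp] f0.
  have D x i : U x -> is_derive x (e_ i) (fun x => Num.sqrt (f x)) ((2 * Num.sqrt (f x))^-1 * partial i f x).
    move=> Ux; have [_ fd] := fs x Ux; have [d E] := is_derive1_sqrt (f0 x Ux).
    by have := derive1_comp_dir (fd i) d; rewrite derive1E E.
  split.
    move=> x Ux; have [fc fd] := fs x Ux.
    split=> [|i]; last by have [] := D x i Ux.
    exact: (continuous_comp fc (@sqrt_continuous R (f x))).
  move=> i; have [f' sf' Ef] := fp i.
  exists (fun x => (2 * Num.sqrt (f x))^-1 * f' x) => [|x Ux].
    apply: sgen_mul => //; apply: sgen_inv => [|x Ux].
      by apply: sgen_mul; [exact: sgen_cst|exact: sgen_sqrt].
    by rewrite mulf_neq0// gt_eqF// sqrtr_gt0 f0.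
  by rewrite -Ef//; have [_ <-] := D x i Ux.
- move=> k f sf [fs fp].
  have D x i : U x -> is_derive x (e_ i) (fun x => flat k (f x)) ((flat k.+2 (f x) - k%:R * flat k.+1 (f x)) * partial i f x).
    move=> Ux; have [_ fd] := fs x Ux; have [d E] := flat_is_derive k (f x).
    by have := derive1_comp_dir (fd i) d; rewrite derive1E E.
  split.
    move=> x Ux; have [fc fd] := fs x Ux.
    split=> [|i]; last by have [] := D x i Ux.
    exact: (continuous_comp fc (@flat_continuous R k (f x))).
  move=> i; have [f' sf' Ef] := fp i.
  exists (fun x => (flat k.+2 (f x) + (- k%:R) * flat k.+1 (f x)) * f' x) => [|x Ux].
    apply: sgen_mul => //; apply: sgen_add; first exact: sgen_flat.
    by apply: sgen_mul; [exact: sgen_cst|exact: sgen_flat].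
  by rewrite -Ef// mulNr; have [_ <-] := D x i Ux.
- move=> m V h g oV sh sg IH gV; split.
    move=> x Ux; split.
      have H : {for x, continuous (fun y => \row_j g j y : 'rV[R]_m)}.
        by apply: continuous_row => j; have [+ _] := IH j => /(_ x Ux)[].
      exact: (continuous_comp H (smooth_on_continuous sh (gV x Ux))).
    move=> i; apply: ex_derive; apply: partial_comp.
      exact: smooth_on_differentiable (gV x Ux).
    by move=> j; have [+ _] := IH j => /(_ x Ux)[].
  move=> i.
  have /choice[g' g'P] : forall j, exists g', sgen U g' /\ forall x, U x -> partial i (g j) x = g' x.
    by move=> j; have [_ /(_ i)[g' ? ?]] := IH j; exists g'.
  exists (fun x => \sum_j g' j x * partial j h (\row_j g j x)) => [|x Ux].
    apply: sgen_sum => j; apply: sgen_mul; first by have [] := g'P j.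
    by apply: (@sgen_comp n U m V (partial j h) g); [exact: oV|exact: smooth_on_partial|exact: sg|exact: gV].
  have dg j : derivable (g j) x (e_ i) by have [+ _] := IH j => /(_ x Ux)[].
  have [_] := partial_comp (smooth_on_differentiable oV sh (gV x Ux)) dg.
  rewrite /partial => ->; apply: eq_bigr => j _; congr (_ * _).
  by have [_] := g'P j; apply.
Qed.

Lemma smooth_on_sgen n (U : set 'rV[R]_n) f : open U -> sgen U f -> smooth_on U f.
Proof.
by move=> oU; apply: (@smooth_on_coind n U (sgen U)) => //; exact: sgen_step.
Qed.

Lemma smooth_on_ext n (U : set 'rV[R]_n) f g : open U ->
  (forall x, U x -> f x = g x) -> smooth_on U f -> smooth_on U g.
Proof.
move=> oU fg sf.
pose P h := exists2 f, smooth_on U f & forall x, U x -> f x = h x.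
apply: (@smooth_on_coind n U P) => //; last by exists f.
move=> {sf fg}h [k sk kh]; split.
  move=> x Ux; have N : \forall y \near x, k y = h y.
    by move: (open_near oU Ux); apply: filterS => y /kh.
  split.
    suff : h @ x --> h x by [].
    by rewrite -kh//; exact: (cvg_trans (near_eq_cvg N) (smooth_on_continuous sk Ux)).
  by move=> i; apply: near_eq_derivable N _; exact: smooth_on_derivable sk Ux.
move=> i; exists (partial i k); first by exists (partial i k); [exact: smooth_on_partial|].
by move=> x Ux; apply: (partial_eq_on _ oU) Ux => y /kh.
Qed.

Lemma smooth_on_sub n (U V : set 'rV[R]_n) f : U `<=` V -> smooth_on V f -> smooth_on U f.
Proof. by move=> UV sf s x /UV; exact: sf. Qed.

(** [smooth_on] is a condition at each point separately on the iterated derivatives of [f], so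
    nothing has to be glued. *)
Lemma smooth_on_local n (U : set 'rV[R]_n) f :
  (forall x, U x -> exists V, [/\ V x & smooth_on V f]) -> smooth_on U f.
Proof. by move=> h s x /h[V [Vx sf]]; exact: sf. Qed.

Section closure.
Variables (n : nat) (U : set 'rV[R]_n).
Hypothesis oU : open U.
Implicit Types f g : 'rV[R]_n -> R.

Lemma smooth_on_cst a : smooth_on U (fun=> a).
Proof. exact/smooth_on_sgen/sgen_cst. Qed.

Lemma smooth_on_coord i : smooth_on U (fun x => x 0 i).
Proof. exact/smooth_on_sgen/sgen_coord. Qed.

Lemma smooth_onD f g : smooth_on U f -> smooth_on U g -> smooth_on U (fun x => f x + g x).
Proof. by move=> ? ?; apply/smooth_on_sgen/sgen_add; try exact/sgen_base. Qed.

Lemma smooth_onM f g : smooth_on U f -> smooth_on U g -> smooth_on U (fun x => f x * g x).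
Proof. by move=> ? ?; apply/smooth_on_sgen/sgen_mul; try exact/sgen_base. Qed.

Lemma smooth_onV f : smooth_on U f -> (forall x, U x -> f x != 0) ->
  smooth_on U (fun x => (f x)^-1).
Proof. by move=> ? ?; apply/smooth_on_sgen/sgen_inv => //; exact/sgen_base. Qed.

Lemma smooth_on_sqrt f : smooth_on U f -> (forall x, U x -> 0 < f x) ->
  smooth_on U (fun x => Num.sqrt (f x)).
Proof. by move=> ? ?; apply/smooth_on_sgen/sgen_sqrt => //; exact/sgen_base. Qed.

Lemma smooth_on_flat k f : smooth_on U f -> smooth_on U (fun x => flat k (f x)).
Proof. by move=> ?; apply/smooth_on_sgen/sgen_flat => //; exact/sgen_base. Qed.

Lemma smooth_on_comp m (V : set 'rV[R]_m) h (g : 'I_m -> 'rV[R]_n -> R) :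
  open V -> smooth_on V h -> (forall j, smooth_on U (g j)) ->
  (forall x, U x -> V (\row_j g j x)) -> smooth_on U (fun x => h (\row_j g j x)).
Proof.
move=> oV sh sg gV; apply/smooth_on_sgen => //.
by apply: (@sgen_comp n U m V h g) => // j; exact/sgen_base.
Qed.

Lemma smooth_on_sum (I : Type) (r : seq I) (P : pred I) F :
  (forall i, P i -> smooth_on U (F i)) ->
  smooth_on U (fun x => \sum_(i <- r | P i) F i x).
Proof.
move=> sF; elim: r => [|i r IH].
  rewrite (_ : (fun _ => _) = (fun=> 0)); first exact: smooth_on_cst.
  by apply/funext => x; rewrite big_nil.
case: (boolP (P i)) => Pi; last first.
  rewrite (_ : (fun _ => _) = (fun x => \sum_(i <- r | P i) F i x))//.
  by apply/funext => x; rewrite big_cons (negbTE Pi).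
rewrite (_ : (fun _ => _) = (fun x => F i x + \sum_(i <- r | P i) F i x)).
  by apply: smooth_onD; [exact: sF|exact: IH].
by apply/funext => x; rewrite big_cons Pi.
Qed.

Lemma smooth_on_prod (I : Type) (r : seq I) (P : pred I) F :
  (forall i, P i -> smooth_on U (F i)) ->
  smooth_on U (fun x => \prod_(i <- r | P i) F i x).
Proof.
move=> sF; elim: r => [|i r IH].
  rewrite (_ : (fun _ => _) = (fun=> 1)); first exact: smooth_on_cst.
  by apply/funext => x; rewrite big_nil.
case: (boolP (P i)) => Pi; last first.
  rewrite (_ : (fun _ => _) = (fun x => \prod_(i <- r | P i) F i x))//.
  by apply/funext => x; rewrite big_cons (negbTE Pi).
rewrite (_ : (fun _ => _) = (fun x => F i x * \prod_(i <- r | P i) F i x)).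
  by apply: smooth_onM; [exact: sF|exact: IH].
by apply/funext => x; rewrite big_cons Pi.
Qed.

Lemma smooth_onN f : smooth_on U f -> smooth_on U (fun x => - f x).
Proof.
move=> sf; rewrite (_ : (fun _ => _) = (fun x => -1 * f x)).
  by apply: smooth_onM; [exact: smooth_on_cst|exact: sf].
by apply/funext => x; rewrite mulN1r.
Qed.

Lemma smooth_on_det m (A : 'rV[R]_n -> 'M[R]_m) :
  (forall i j, smooth_on U (fun x => A x i j)) -> smooth_on U (fun x => \det (A x)).
Proof.
move=> sA; rewrite /determinant.
apply: smooth_on_sum => s _; apply: smooth_onM; first exact: smooth_on_cst.
by apply: smooth_on_prod => i _; exact: sA.
Qed.

Lemma smooth_on_invmx m (A : 'rV[R]_n -> 'M[R]_m) :
  (forall i j, smooth_on U (fun x => A x i j)) ->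
  (forall x, U x -> A x \in unitmx) ->
  forall i j, smooth_on U (fun x => invmx (A x) i j).
Proof.
move=> sA uA i j.
apply: (@smooth_on_ext _ _ (fun x => (\det (A x))^-1 * ((-1) ^+ (j + i) * \det (row' j (col' i (A x)))))) => //.
  by move=> x Ux; rewrite /invmx uA// !mxE /cofactor.
apply: smooth_onM.
  apply: smooth_onV; first exact: smooth_on_det.
  by move=> x /uA; rewrite unitmxE unitfE.
apply: smooth_onM; first exact: smooth_on_cst.
apply: smooth_on_det => k l.
by rewrite (_ : (fun _ => _) = (fun x => A x (lift j k) (lift i l)))//; apply/funext => x; rewrite !mxE.
Qed.

End closure.
End smooth.

(** * Lebesgue integration on R^n *)

Notation brV R n := (g_sigma_algebraType (@open 'rV[R]_n)).

Section consr.
Context {R : realType}.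

Definition consr n (y : R) (v : 'rV[R]_n) : 'rV[R]_n.+1 := row_mx (y%:M : 'M[R]_1) v.

Lemma consr0 n y (v : 'rV[R]_n) : consr y v 0 0 = y.
Proof.
transitivity (row_mx (y%:M : 'M[R]_1) v 0 (lshift n 0)).
  by congr (row_mx _ _ _ _); exact: val_inj.
by rewrite row_mxEl mxE eqxx mulr1n.
Qed.

Lemma consrS n y (v : 'rV[R]_n) i : consr y v 0 (lift ord0 i) = v 0 i.
Proof.
transitivity (row_mx (y%:M : 'M[R]_1) v 0 (rshift 1 i)).
  by congr (row_mx _ _ _ _); exact: val_inj.
by rewrite row_mxEr.
Qed.

Lemma consr_delta0 n y (v : 'rV[R]_n) t :
  consr y v + t *: delta_mx 0 ord0 = consr (y + t) v.
Proof.
apply/rowP => i; rewrite [LHS]mxE [X in _ + X]mxE [X in _ + _ * X]mxE/=.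
case: (unliftP ord0 i) => [j ->|->]; rewrite ?consr0 ?consrS.
  by rewrite mulr0 addr0.
by rewrite mulr1.
Qed.

Lemma consr_deltaS n y (v : 'rV[R]_n) t j :
  consr y v + t *: delta_mx 0 (lift ord0 j) = consr y (v + t *: delta_mx 0 j).
Proof.
apply/rowP => i; rewrite [LHS]mxE [X in _ + X]mxE [X in _ + _ * X]mxE/=.
case: (unliftP ord0 i) => [k ->|->]; rewrite ?consr0 ?consrS.
  by rewrite !mxE/= (inj_eq lift_inj).
by rewrite mulr0 addr0.
Qed.

Definition cube n (a : 'rV[R]_n) (r : R) : set 'rV[R]_n :=
  [set v | forall i, `|v 0 i - a 0 i| < r].

Lemma open_cube n a r : open (@cube n a r).
Proof.
rewrite openE => v vI.
have H i : nbhs v [set w : 'rV[R]_n | `|w 0 i - a 0 i| < r].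
  have := @coord_continuous R 1 n 0 i v; move/cvgrPdist_lt => /(_ (r - `|v 0 i - a 0 i|)).
  rewrite subr_gt0 => /(_ (vI i)); apply: filterS => w.
  rewrite ltrBrDr; apply: le_lt_trans; rewrite -[X in `|X - a 0 i|](subrK (v 0 i)) -addrA.
  by rewrite (le_trans (ler_normD _ _))// distrC.
by move/filter_forall : H; apply: filterS => w.
Qed.

(** Rational centres and radii [k.+1%:R^-1] make the union countable, so that Borel measurability of
    a map into R^n can be tested on cubes. *)
Lemma open_cubesE n (O : set 'rV[R]_n) : open O ->
  O = \bigcup_(q in [set q : 'rV[rat]_n * nat | cube (map_mx ratr q.1) q.2.+1%:R^-1 `<=` O])
    cube (map_mx ratr q.1) q.2.+1%:R^-1.
Proof.
move=> oO; apply/seteqP; split=> [v Ov|v [q]]; last by move=> /= qO /qO.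
have /nbhs_ballP[e /= e0 eO] : nbhs v O by exact: open_nbhs_nbhs.
have [k ke] : exists k, k.+1%:R^-1 < e / 2.
  have := near_infty_natSinv_lt (PosNum (divr_gt0 e0 (ltr0n R 2))).
  by move=> /filter_ex[k ?]; exists k.
have /choice[q qP] : forall i, exists q : rat, `|v 0 i - ratr q| < k.+1%:R^-1.
  move=> i; have : v 0 i - k.+1%:R^-1 < v 0 i + k.+1%:R^-1 :> R.
    by rewrite ltrBlDr -addrA ltrDl addr_gt0.
  move=> /rat_in_itvoo[q]; rewrite in_itv/= => /andP[q1 q2]; exists q.
  by rewrite distrC ltr_distl q1 q2.
exists (\row_i q i, k); last by move=> i /=; rewrite !mxE.
move=> w /= wq; apply: eO; rewrite -ball_normE/=.
apply: le_lt_trans (_ : k.+1%:R^-1 + k.+1%:R^-1 < e); last by rewrite [ltRHS]splitr ltrD.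
apply: norm_coord => [|i]; first by rewrite addr_ge0.
rewrite !mxE -(subrK (ratr (q i)) (v 0 i)) -addrA (le_trans (ler_normD _ _))//.
by have := wq i; rewrite !mxE distrC => /ltW ?; rewrite lerD// ltW.
Qed.

Lemma measurable_cubes d (T : measurableType d) n (f : T -> brV R n) :
  (forall a r, measurable (f @^-1` (cube a r))) -> measurable_fun setT f.
Proof.
move=> mf; apply: (@measurability _ _ T (brV R n) setT f (@open 'rV[R]_n)) => //.
move=> _ [U oU <-]; rewrite setTI (open_cubesE oU) preimage_bigcup bigcup_mkcond.
apply: countable_bigcupT_measurable => [|q]; first exact: countableP.
by case: ifPn.
Qed.

Lemma measurable_open n (O : set 'rV[R]_n) : open O -> measurable (O : set (brV R n)).
Proof. by move=> oO; exact: sub_sigma_algebra. Qed.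

Lemma cube_consr n (a : 'rV[R]_n.+1) r y v : cube a r (consr y v) <->
  `|y - a 0 0| < r /\ cube (\row_i a 0 (lift ord0 i)) r v.
Proof.
split=> [H|[H0 H1] i].
  split; first by have := H 0; rewrite consr0.
  by move=> i; have := H (lift ord0 i); rewrite consrS mxE.
case: (unliftP ord0 i) => [j ->|->]; rewrite ?consr0 ?consrS//.
by have := H1 j; rewrite mxE.
Qed.

Lemma measurable_consr n :
  measurable_fun [set: measurableTypeR R * brV R n]
    (fun p => consr p.1 p.2 : brV R n.+1).
Proof.
apply: measurable_cubes => a r.
rewrite (_ : _ @^-1` _ = (`]a 0 0 - r, a 0 0 + r[%classic : set (measurableTypeR R)) `*`
    (cube (\row_i a 0 (lift ord0 i)) r : set (brV R n))).
  apply: measurableX; first exact: measurable_itv.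
  by apply: measurable_open; exact: open_cube.
apply/seteqP; split=> [[y v] /cube_consr[/= h1 h2]|[y v] [/= h1 h2]].
  by split=> //=; rewrite in_itv/= -ltr_distl.
by apply/cube_consr; split=> //; move: h1; rewrite in_itv/= -ltr_distl.
Qed.

Lemma measurable_consr_comp d (T : measurableType d) n
    (y : T -> measurableTypeR R) (v : T -> brV R n) :
  measurable_fun setT y -> measurable_fun setT v ->
  measurable_fun setT (fun t => consr (y t) (v t) : brV R n.+1).
Proof.
move=> my mv.
exact: (measurableT_comp (@measurable_consr n) (measurable_fun_pair my mv)).
Qed.
End consr.

Section lint.
Context {R : realType}.
Local Open Scope ereal_scope.
Notation lint := (@lebesgue_int R _).

Definition mnn d (T : measurableType d) (f : T -> \bar R) :=
  measurable_fun setT f /\ forall x, 0 <= f x.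

Lemma lintS n (f : 'rV[R]_n.+1 -> \bar R) :
  lint f = \int[lebesgue_measure]_(y in [set: R]) lint (fun v => f (consr y v)).
Proof. by []. Qed.

Lemma lint_ge0 n (f : 'rV[R]_n -> \bar R) : (forall x, 0 <= f x) -> 0 <= lint f.
Proof.
elim: n f => [|n IH] f f0; first exact: f0.
by apply: integral_ge0 => y _; exact: IH.
Qed.

(** Without measurability in a parameter the outer integrals could not be manipulated. The parameter
    space is arbitrary because the induction moves the first coordinate into it. *)
Lemma lint_measurable n d (T : measurableType d) (f : T * brV R n -> \bar R) :
  mnn f -> measurable_fun setT (fun t => lint (fun v => f (t, v))).
Proof.
elim: n d T f => [|n IH] d T f [mf f0] /=.
  by apply: (measurableT_comp mf); exact: pair2_measurable.
have mc : measurable_fun setT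
    (fun p : (T * measurableTypeR R) * brV R n => (p.1.1, consr p.1.2 p.2) : T * brV R n.+1).
  apply/measurable_fun_pairP; split.
    exact: measurableT_comp measurable_fst measurable_fst.
  apply: measurable_consr_comp; last exact: measurable_snd.
  exact: measurableT_comp measurable_snd measurable_fst.
have H := IH _ (T * measurableTypeR R)%type (fun p => f (p.1.1, consr p.1.2 p.2)).
have {}H := H (conj (measurableT_comp mf mc) (fun _ => f0 _)).
apply: (@measurable_fun_fubini_tonelli_F _ _ T (measurableTypeR R) R lebesgue_measure _ H).
by move=> [t y] /=; exact: lint_ge0.
Qed.

Lemma mnn_consr n (f : brV R n.+1 -> \bar R) y : mnn f -> mnn (fun v : brV R n => f (consr y v)).
Proof.
move=> [mf f0]; split=> //.
apply: (measurableT_comp mf).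
apply: measurable_consr_comp; first exact: measurable_cst.
exact: measurable_id.
Qed.

Lemma mnn_lint n (f : brV R n.+1 -> \bar R) : mnn f ->
  mnn (fun y : measurableTypeR R => lint (fun v => f (consr y v))).
Proof.
move=> [mf f0]; split=> [|y]; last exact: lint_ge0.
apply: (@lint_measurable n _ _ (fun p => f (consr p.1 p.2))); split=> //.
exact: (measurableT_comp mf (@measurable_consr R n)).
Qed.

Lemma lintD n (f g : brV R n -> \bar R) : mnn f -> mnn g ->
  lint (fun x => f x + g x) = lint f + lint g.
Proof.
elim: n f g => [|n IH] f g mf mg//.
rewrite !lintS -ge0_integralD//.
- by apply: eq_integral => y _; rewrite IH//; exact: mnn_consr.
- by move=> y _; have [_] := mnn_lint mf; apply.
- by have [] := mnn_lint mf.
- by move=> y _; have [_] := mnn_lint mg; apply.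
- by have [] := mnn_lint mg.
Qed.

Lemma lintZ n (k : R) (f : brV R n -> \bar R) : (0 <= k)%R -> mnn f ->
  lint (fun x => k%:E * f x) = k%:E * lint f.
Proof.
move=> k0; elim: n f => [|n IH] f mf//.
rewrite !lintS -ge0_integralZl//.
- by apply: eq_integral => y _; rewrite IH//; exact: mnn_consr.
- by have [] := mnn_lint mf.
- by move=> y _; have [_] := mnn_lint mf; apply.
Qed.

Lemma lint_le n (f g : brV R n -> \bar R) : mnn f -> mnn g ->
  (forall x, f x <= g x) -> lint f <= lint g.
Proof.
elim: n f g => [|n IH] f g mf mg fg; first exact: fg.
rewrite !lintS; apply: ge0_le_integral => //.
- by move=> y _; have [_] := mnn_lint mf; apply.
- by have [] := mnn_lint mf.
- by have [] := mnn_lint mg.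
- by move=> y _; apply: IH => //; exact: mnn_consr.
Qed.

Lemma lint_lim n (g : (brV R n -> \bar R)^nat) : (forall k, mnn (g k)) ->
  (forall x, nondecreasing_seq (g^~ x)) ->
  lint (fun x => limn (g^~ x)) = limn (fun k => lint (g k)).
Proof.
elim: n g => [|n IH] g mg ndg//.
rewrite lintS -[RHS](_ : \int[lebesgue_measure]_y limn (fun k => lint (fun v => g k (consr y v))) = _).
  by apply: eq_integral => y _; rewrite -IH// => k; exact: mnn_consr.
rewrite monotone_convergence//.
- by move=> k; have [] := mnn_lint (mg k).
- by move=> k y _; have [_] := mnn_lint (mg k); apply.
- move=> y _ k l kl; apply: lint_le; [exact: mnn_consr..|].
  by move=> x; exact: ndg.
Qed.

Import HBNNSimple.

(** Approximation from below by simple functions: linearity and monotone limits reduce everything to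
    indicators. Used twice, for the iterated integral on R^n and for the Riemannian measure read in
    a chart. *)
Lemma integral_rep d (T : measurableType d) (m : {measure set T -> \bar R})
    (D : set T) (L : (T -> \bar R) -> \bar R) : measurable D ->
  (forall A, measurable A -> L (fun x => (\1_A x)%:E) = m (A `&` D)) ->
  (forall f g, mnn f -> mnn g -> L (fun x => f x + g x) = L f + L g) ->
  (forall k f, (0 <= k)%R -> mnn f -> L (fun x => k%:E * f x) = k%:E * L f) ->
  (forall g : (T -> \bar R)^nat, (forall k, mnn (g k)) ->
    (forall x, nondecreasing_seq (g^~ x)) ->
    L (fun x => limn (g^~ x)) = limn (fun k => L (g k))) ->
  forall f, mnn f -> L f = \int[m]_(x in D) f x.
Proof.
move=> mD L1 LD LZ LL f [mf f0].
pose g := nnsfun_approx measurableT mf.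
have E : f = fun x => limn (fun k => (g k x)%:E).
  by apply/funext => x; apply/esym/cvg_lim => //; exact: cvg_nnsfun_approx.
have gn k : mnn (fun x => (g k x)%:E).
  by split=> [|x]; [exact/measurable_EFinP/measurable_funP|rewrite lee_fin].
have nd x : nondecreasing_seq (fun k => (g k x)%:E).
  by move=> k l kl; rewrite lee_fin; exact/lefP/nd_nnsfun_approx.
rewrite [in LHS]E LL// [in RHS]E monotone_convergence//; last first.
- by move=> k x _; have [_ h] := gn k; exact: h.
- by move=> k; apply: measurable_funTS; have [] := gn k.
congr (limn _); apply/funext => k.
have mi (A : set T) : measurable A -> mnn (fun x => (\1_A x)%:E : \bar R).
  by move=> mA; split=> [|x]; [exact/measurable_EFinP/measurable_indic|rewrite lee_fin].
have mp r : measurable (g k @^-1` [set r]) by [].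
have L0 : L (fun=> 0) = 0.
  transitivity (L (fun x => (\1_set0 x)%:E)); last by rewrite L1// set0I measure0.
  by congr L; apply/funext => x; rewrite indic0.
have mterm r : mnn (fun x => (r * \1_(g k @^-1` [set r]) x)%:E).
  split; last by move=> x; rewrite EFinM nnfun_muleindic_ge0.
  by apply/measurable_EFinP/measurable_funM => //; exact: measurable_indic.
have -> : (fun x => (g k x)%:E) =
    (fun x => \sum_(r <- fset_set (range (g k))) (r * \1_(g k @^-1` [set r]) x)%:E).
  by apply/funext => x; rewrite [in LHS]fimfunE fsbig_finite//= sumEFin.
rewrite ge0_integral_sum//; last 2 first.
- by move=> r; apply: measurable_funTS; have [] := mterm r.
- by move=> r x _; have [_ h] := mterm r; exact: h.
have -> : L (fun x => \sum_(r <- fset_set (range (g k))) (r * \1_(g k @^-1` [set r]) x)%:E)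
  = \sum_(r <- fset_set (range (g k))) L (fun x => (r * \1_(g k @^-1` [set r]) x)%:E).
  elim: (enum_fset _) => [|r s IH].
    by rewrite big_nil -[RHS]L0; congr L; apply/funext => x; rewrite big_nil.
  rewrite big_cons -IH -LD//; first by congr L; apply/funext => x; rewrite big_cons.
  split; last by move=> x; apply: sume_ge0 => r' _; have [_] := mterm r'; apply.
  by apply: emeasurable_sum => r'; have [] := mterm r'.
apply: eq_bigr => r _.
(* Homogeneity is available for nonnegative factors only; a negative [r] is not a value of [g k] and
   its level set is empty. *)
have [r0|r0] := leP 0%R r; last first.
  rewrite preimage_nnfun0//.
  have -> : (fun x : T => (r * \1_set0 x)%:E) = (fun=> 0) :> (T -> \bar R).
    by apply/funext => x; rewrite indic0 mulr0.
  by rewrite L0 integral0.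
have -> : (fun x => (r * \1_(g k @^-1` [set r]) x)%:E) =
  (fun x => r%:E * (\1_(g k @^-1` [set r]) x)%:E) by [].
rewrite LZ//; last exact: mi.
rewrite ge0_integralZl//; first by rewrite L1// integral_indic.
by apply: measurable_funTS; have [] := mi _ (mp r).
Qed.

(** Turning the iterated integral into a measure gives access to the general theory of integrals of
    signed functions. *)
Definition leb n (A : set (brV R n)) : \bar R := lint (fun x => (\1_A x)%:E).

Lemma mnn_indic d (T : measurableType d) (A : set T) : measurable A -> mnn (fun x => (\1_A x)%:E : \bar R).
Proof.
by move=> mA; split=> [|x]; [exact/measurable_EFinP/measurable_indic|rewrite lee_fin].
Qed.

Lemma lint0 n : lint (fun _ : brV R n => 0) = 0.
Proof.
elim: n => [//|n IH]; rewrite lintS.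
by under eq_integral do rewrite IH; rewrite integral0.
Qed.

Section leb_measure.
Variable n : nat.

Let leb0 : @leb n set0 = 0.
Proof. by rewrite -[RHS](lint0 n); congr lint; apply/funext => x; rewrite indic0. Qed.

Let leb_ge0 A : 0 <= @leb n A.
Proof. by apply: lint_ge0 => x; rewrite lee_fin. Qed.

Let leb_sigma_additive : semi_sigma_additive (@leb n).
Proof.
move=> F mF tF mUF.
have E : @leb n (\bigcup_k F k) = limn (fun k => \sum_(0 <= i < k) leb (F i)).
  have mS k : mnn (fun x => \sum_(0 <= i < k) (\1_(F i) x)%:E : \bar R).
    split; last by move=> x; apply: sume_ge0 => i _; rewrite lee_fin.
    by apply: emeasurable_sum => i; have [] := mnn_indic (mF i).
  rewrite /leb; under eq_fun do rewrite (indic_bigcup _ tF).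
  rewrite lint_lim//; last first.
    by move=> x k l kl; apply: lee_sum_nneg_natr => // i _ _; rewrite lee_fin.
  congr (limn _); apply/funext => k.
  elim: k => [|k IH].
    by rewrite big_geq// -[RHS](lint0 n); congr lint; apply/funext => x; rewrite big_geq.
  rewrite big_nat_recr//= -IH -lintD//; last exact: mnn_indic.
  by congr lint; apply/funext => x; rewrite big_nat_recr.
rewrite E; apply: ereal_nondecreasing_is_cvgn => k l kl.
by apply: lee_sum_nneg_natr => // i _ _.
Qed.

HB.instance Definition _ := isMeasure.Build _ _ _ (@leb n) leb0 leb_ge0 leb_sigma_additive.

End leb_measure.

Lemma lintE n (f : brV R n -> \bar R) : mnn f -> lint f = \int[@leb n]_x f x.
Proof.
apply: (@integral_rep _ (brV R n) (@leb n) setT (fun f => lint f)) => //.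
- by move=> A mA; rewrite setIT.
- exact: lintD.
- by move=> k g; exact: lintZ.
- exact: lint_lim.
Qed.

End lint.

Section continuity.
Context {R : realType}.

Lemma compact_le_bound (X : topologicalType) (f : X -> R) (K : set X) : compact K ->
  (forall x, K x -> {for x, continuous f}) ->
  exists2 C, 0 <= C & forall x, K x -> `|f x| <= C.
Proof.
move=> cK cf.
have cf' : {within K, continuous f}.
  by apply: continuous_in_subspaceT => x /set_mem Kx; exact: cf.
have [C [_ HC]] := compact_bounded (continuous_compact cf' cK).
exists (`|C| + 1); first by rewrite addr_ge0.
move=> x Kx; apply: (HC (`|C| + 1)); last by exists x.
by rewrite ltr_pwDr// ler_norm.
Qed.

Lemma measurable_continuous (X : ptopologicalType) (U : set X) (f : X -> R) :
  open U -> (forall x, U x -> {for x, continuous f}) ->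
  measurable_fun (U : set (borel X)) f.
Proof.
move=> oU cf.
apply: (measurability _ (RGenOInfty.measurableE R)) => _ [_ [x ->] <-].
apply: sub_sigma_algebra; rewrite openE => y [Uy] /=; rewrite in_itv/= andbT => xy.
have H : \forall z \near y, x < f z.
  have /cvgrPdist_lt/(_ (f y - x)) := cf _ Uy; rewrite subr_gt0 => /(_ xy).
  by apply: filterS => z; rewrite ltr_norml => /andP[_]; lra.
have /filterS2 := open_nbhs_nbhs (conj oU Uy); apply; last exact: H.
by move=> z Uz xz; split=> //=; rewrite in_itv/= andbT.
Qed.

End continuity.

(** * Translation invariance *)

Section shift.
Context {R : realType}.
Local Open Scope ereal_scope.
Notation lint := (@lebesgue_int R _).

(** Half-open intervals determine Lebesgue measure, and translation preserves their lengths. *)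
Lemma lebesgue_measure_shift (t : R) (A : set R) : measurable A ->
  pushforward lebesgue_measure (fun y : measurableTypeR R => (y + t)%R : measurableTypeR R) A
  = lebesgue_measure A.
Proof.
have mt : measurable_fun setT (fun y : measurableTypeR R => (y + t)%R : measurableTypeR R).
  by apply: measurable_funD; [exact: measurable_id|exact: measurable_cst].
move=> mA; apply/esym.
pose pt := isMeasurableFun.Build _ _ _ _ _ mt.
pose st : {mfun _ >-> _} := HB.pack (fun y : measurableTypeR R => (y + t)%R : measurableTypeR R) pt.
rewrite (_ : (fun y => (y + t)%R) = st)//.
apply: lebesgue_measure_unique => //= _ [[a b]] _ <-.
rewrite /pushforward/= (_ : _ @^-1` _ = `](a - t)%R, (b - t)%R]%classic).
  rewrite !lebesgue_measure_itv/= !lte_fin ltrD2r; congr (if _ then _ else _).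
  by rewrite -!EFinB; congr (_%:E); ring.
by apply/seteqP; split=> x /=; rewrite !in_itv/= ltrBlDr lerBrDr.
Qed.

Lemma integral_shift (t : R) (f : measurableTypeR R -> \bar R) : mnn f ->
  \int[lebesgue_measure]_y f (y + t)%R = \int[lebesgue_measure]_y f y.
Proof.
move=> [mf f0].
have mt : measurable_fun setT (fun y : measurableTypeR R => (y + t)%R : measurableTypeR R).
  by apply: measurable_funD; [exact: measurable_id|exact: measurable_cst].
have := @ge0_integral_pushforward _ _ _ _ R _ mt (@lebesgue_measure R) setT f.
rewrite preimage_setT => <- //.
by apply: eq_measure_integral => A mA _; exact: lebesgue_measure_shift.
Qed.

(** Recursion on the dimension reaches the coordinate [i], where this is invariance on the real
    line. Shifts along one axis are all that difference quotients of partial derivatives require. *)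
Lemma lint_shift n (i : 'I_n) (t : R) (f : brV R n -> \bar R) : mnn f ->
  lint (fun x => f (x + t *: delta_mx 0 i)%R) = lint f.
Proof.
elim: n i f => [[]//|n IH] i f mf.
rewrite !lintS; case: (unliftP ord0 i) => [j ->|->].
  apply: eq_integral => y _; rewrite -(IH j (fun v => f (consr y v))); last exact: mnn_consr.
  by congr lint; apply/funext => v; rewrite consr_deltaS.
rewrite -[RHS](@integral_shift t (fun y => lint (fun v => f (consr y v)))); last exact: mnn_lint.
apply: eq_integral => y _; congr lint.
by apply/funext => v; rewrite consr_delta0.
Qed.

End shift.

Section ccube.
Context {R : realType}.
Notation lint := (@lebesgue_int R _).

Definition ccube n (a : 'rV[R]_n) (r : R) : set 'rV[R]_n :=
  [set v | forall i, (`|v 0 i - a 0 i| <= r)].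

Lemma ccube_consr n (a : 'rV[R]_n.+1) r y v : ccube a r (consr y v) <->
  (`|y - a 0 0| <= r) /\ ccube (\row_i a 0 (lift ord0 i)) r v.
Proof.
split=> [H|[H0 H1] i].
  split; first by have := H 0; rewrite consr0.
  by move=> i; have := H (lift ord0 i); rewrite consrS mxE.
case: (unliftP ord0 i) => [j ->|->]; rewrite ?consr0 ?consrS//.
by have := H1 j; rewrite mxE.
Qed.

Lemma closed_ccube n (a : 'rV[R]_n) r : closed (ccube a r).
Proof.
rewrite (_ : ccube a r = \bigcap_(i : 'I_n) [set v : 'rV[R]_n | (`|v 0 i - a 0 i| <= r)]); last first.
  by apply/seteqP; split=> [v H i _|v H i]; [exact: H|exact: (H i)].
apply: closed_bigI => i _.
apply: (@closed_comp _ _ (fun v : 'rV[R]_n => `|v 0 i - a 0 i|) [set x | (x <= r)]); last exact: closed_le.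
move=> v _.
apply: (@continuous_comp _ _ _ (fun v : 'rV[R]_n => v 0 i - a 0 i) Num.norm).
  exact: (@continuousB _ _ _ (fun v : 'rV[R]_n => v 0 i) (cst (a 0 i)) v
    (@coord_continuous R 1 n 0 i v) (@cst_continuous _ _ _ _)).
exact: norm_continuous.
Qed.

Lemma compact_ccube n (a : 'rV[R]_n) r : compact (ccube a r).
Proof.
rewrite (_ : ccube a r = [set v : 'rV[R]_n | forall i, `[(a 0 i - r), (a 0 i + r)]%classic (v 0 i)]).
  by apply: (@rV_compact R n (fun i => `[(a 0 i - r), (a 0 i + r)]%classic)) => i; exact: segment_compact.
apply/seteqP; split=> v H i; have := H i.
  by rewrite /= in_itv/= ler_distl.
by rewrite /= in_itv/= ler_distl.
Qed.

Lemma measurable_ccube n (a : 'rV[R]_n) r : measurable (ccube a r : set (brV R n)).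
Proof.
rewrite -[X in measurable X]setCK; apply: measurableC.
by apply: measurable_open; apply: closed_openC; exact: closed_ccube.
Qed.

Lemma leb_ccube n (a : 'rV[R]_n) r : (0 <= r) -> leb (ccube a r) = ((r *+ 2) ^+ n)%:E.
Proof.
move=> r0; elim: n a => [|n IH] a.
  rewrite /leb/= indicE mem_set//; by move=> -[].
rewrite /leb lintS.
transitivity (\int[lebesgue_measure]_(y in [set: R])
    ((\1_(`[(a 0 0 - r), (a 0 0 + r)]%classic) y)%:E * ((r *+ 2) ^+ n)%:E))%E; last first.
  rewrite ge0_integralZr//=; last 2 first.
  - by apply/measurable_EFinP; exact: measurable_indic.
  - by rewrite lee_fin exprn_ge0// mulrn_wge0.
  have E := @lebesgue_measure_itv R `[a 0 0 - r, a 0 0 + r].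
  rewrite integral_indic// setIT [X in (X * _)%E]E/= lte_fin.
  case: ltP => h; rewrite -?EFinB -EFinM; congr (_%:E); rewrite exprS.
    by congr (_ * _); rewrite mulr2n; ring.
  (* An interval whose endpoints are not strictly ordered gets measure 0 from the other branch of
     the formula. *)
  have -> : r = 0 by move: h r0; lra.
  by rewrite mul0rn !mul0r.
apply: eq_integral => y _; rewrite -(IH (\row_i a 0 (lift ord0 i)))  /leb.
have [h|h] := boolP (`|y - a 0 0| <= r).
  rewrite [X in (X%:E * _)%E](_ : _ = 1) ?mul1e; last first.
    by rewrite indicE mem_set//= in_itv/= -ler_distl.
  congr lint; apply/funext => v; rewrite !indicE; congr (nat_of_bool _)%:R%:E.
  by apply/idP/idP => /set_mem H; apply/mem_set; [have [] := (ccube_consr a r y v).1 H|apply/ccube_consr].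
rewrite [X in (X%:E * _)%E](_ : _ = 0) ?mul0e; last first.
  rewrite indicE memNset// => H; move/negP : h; apply; move: H.
  by rewrite /= in_itv/= -ler_distl.
rewrite -[RHS](lint0 n); congr lint; apply/funext => v.
by rewrite indicE memNset// => /ccube_consr[H _]; move/negP : h; apply.
Qed.

End ccube.

(** * Integrals of compactly supported partial derivatives *)

Section divergence0.
Context {R : realType}.
Local Notation e_ i := (delta_mx 0 i).

Lemma continuous_measurable n (f : 'rV[R]_n -> R) : continuous f ->
  measurable_fun [set: brV R n] f.
Proof. by move=> cf; exact: (measurable_continuous openT (fun x _ => cf x)). Qed.

Lemma csupp_integrable n (h : 'rV[R]_n -> R) K : 0 <= K -> continuous h ->
  (forall x, ~ ccube 0 K x -> h x = 0) ->
  (@leb R n).-integrable setT (EFin \o h).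
Proof.
move=> K0 ch h0; have [C C0 HC] := compact_le_bound (@compact_ccube R n 0 K) (fun x _ => ch x).
rewrite (_ : EFin \o h = (EFin \o h) \_ (ccube 0 K)); last first.
  by apply/funext => x; rewrite patchE; case: ifPn => // /negP xK; rewrite /= h0// => H; apply: xK; exact/mem_set.
apply: (integrable_mkcond _ (@measurable_ccube R n 0 K)).1.
apply: measurable_bounded_integrable; first exact: measurable_ccube.
- by rewrite [X in (X < _)%E](leb_ccube (0 : 'rV[R]_n) K0) ltry.
- by apply: measurable_funTS; exact: continuous_measurable.
- exists C; split; first by rewrite ger0_real.
  by move=> y /ltW Cy x xK; apply: le_trans Cy; exact: HC.
Qed.

Lemma Rintegral_shift n (h : 'rV[R]_n -> R) i t : continuous h ->
  \int[@leb R n]_x h (x + t *: e_ i) = \int[@leb R n]_x h x.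
Proof.
move=> ch; rewrite /Rintegral; congr fine; rewrite [LHS]integralE [RHS]integralE.
have mh := continuous_measurable ch.
have mh' : measurable_fun [set: brV R n] (EFin \o h) by exact/measurable_EFinP.
have ms : measurable_fun [set: brV R n] (fun x => x + t *: e_ i : brV R n).
  apply: measurable_cubes => a r.
  rewrite (_ : _ @^-1` _ = cube (a - t *: e_ i) r).
    by apply: measurable_open; exact: open_cube.
  by apply/seteqP; split=> x H j; have := H j; rewrite !mxE opprB addrA.
have S (f : brV R n -> \bar R) : mnn f -> (\int[@leb R n]_x f (x + t *: e_ i)%R = \int[@leb R n]_x f x)%E.
  move=> mf; rewrite -!lintE//; first exact: lint_shift.
  by case: mf => mf f0; split=> //; exact: measurableT_comp mf ms.
have P : @mnn R _ (brV R n) ((EFin \o h)^\+)%E by split=> [|x]; [exact: measurable_funepos|exact: funepos_ge0].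
have N : @mnn R _ (brV R n) ((EFin \o h)^\-)%E by split=> [|x]; [exact: measurable_funeneg|exact: funeneg_ge0].
congr (_ - _)%E.
  by rewrite -[RHS](S _ P); apply: eq_integral => x _; rewrite !funeposE.
by rewrite -[RHS](S _ N); apply: eq_integral => x _; rewrite !funenegE.
Qed.

(* By translation invariance the difference quotients of W integrate to 0, and
   they converge uniformly to the partial derivative. *)
Lemma integral_partial0 n (W : 'rV[R]_n -> R) i K : 0 < K ->
  continuous W -> (forall x, derivable W x (e_ i)) ->
  continuous (partial i W) -> (forall x, ~ ccube 0 K x -> W x = 0) ->
  \int[@leb R n]_x partial i W x = 0.
Proof.
move=> K0 cW dW ch W0; set h := partial i W.
have h0 x : ~ ccube 0 K x -> h x = 0.
  move=> xK; rewrite /h (@partial_eq_on _ _ (~` ccube 0 K) _ (cst 0))//.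
  - by rewrite /partial derive_cst.
  - by apply: closed_openC; exact: closed_ccube.
(* Shifts will have length at most 1, so the shifted functions all vanish outside the cube of
   half-side [K + 1]. *)
have K1 : 0 <= K + 1 by lra.
have hK x : ~ ccube 0 (K + 1) x -> forall t, `|t| <= 1 -> ~ ccube 0 K (x + t *: e_ i).
  move=> xK t t1 H; apply: xK => j; have := H j; rewrite !mxE !subr0 eqxx/= => Hj.
  rewrite -[x 0 j](addrK (t * (j == i)%:R)) (le_trans (ler_normB _ _))// lerD//.
  by rewrite normrM; case: (j == i); rewrite ?normr1 ?mulr1// normr0 mulr0.
have hK0 (x : 'rV[R]_n) : ~ ccube 0 (K + 1) x -> ~ ccube 0 K x.
  have h01 : `|0 : R| <= 1 by rewrite normr0.
  by move=> xK; have := hK x xK 0 h01; rewrite scale0r addr0.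
have ih := csupp_integrable (ltW K0) ch h0.
apply/eqP; rewrite -normr_le0; apply/ler_addgt0Pr => e e0; rewrite add0r.
pose V' := ((K + 1) *+ 2) ^+ n.
have V'0 : 0 <= V' by rewrite exprn_ge0// mulrn_wge0.
pose eta := e / (V' + 1).
have eta0 : 0 < eta by rewrite divr_gt0// ltr_pwDr.
have [d [d0 d1 Hd]] : exists d : R, [/\ 0 < d, d <= 1 &
    forall c, `|c| <= d -> forall x, `|h x - h (x + c *: e_ i)| <= eta].
  (* Uniform continuity of [h] along the axis, from compactness of the cube; outside it both values
     are 0. *)
  have : \forall c \near (0 : R), ccube 0 (K + 1) `<=` (fun x => `|h x - h (x + c *: e_ i)| <= eta).
    have /compact_near_coveringP cK := @compact_ccube R n 0 (K + 1).
    apply: (cK R (nbhs (0 : R)) (fun c x => `|h x - h (x + c *: e_ i)| <= eta)) => x _.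
    have c1 : (fun p : 'rV[R]_n * R => h p.1 - h (p.1 + p.2 *: e_ i)) @ (x, 0 : R) --> h x - h (x + (0 : R) *: e_ i).
      have c2 : (fun p : 'rV[R]_n * R => h p.1) @ (x, 0 : R) --> h x.
        exact: (cvg_comp (@fst _ _) h (@cvg_fst _ _ (nbhs x) (nbhs (0 : R)) _) (ch x)).
      have c3 : (fun p : 'rV[R]_n * R => p.1 + p.2 *: e_ i : 'rV[R]_n) @ (x, 0 : R) --> x + (0 : R) *: e_ i.
        apply: cvgD; first exact: cvg_fst.
        by apply: cvgZr_tmp; exact: cvg_snd.
      exact: (cvgB c2 (cvg_comp _ h c3 (ch _))).
    rewrite scale0r addr0 subrr in c1.
    by move/cvgr0Pnorm_le : c1 => /(_ _ eta0).
  move=> /nbhs_ballP[d /= d0 Hd].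
  exists (Num.min (d / 2) 1); split; [by rewrite lt_min divr_gt0/=|by rewrite ge_min lexx orbT|].
  move=> c; rewrite le_min => /andP[cd c1] x.
  have [xK|xK] := pselect (ccube 0 (K + 1) x).
    apply: Hd => //; rewrite -ball_normE/= sub0r normrN.
    by apply: le_lt_trans cd _; rewrite ltr_pdivrMr// ltr_pMr// ltr1n.
  by rewrite !h0 ?subrr ?normr0 ?(ltW eta0)//; [exact: hK|exact: hK0].
have cWd : continuous (fun x : 'rV[R]_n => W (x + d *: e_ i)).
  move=> x; apply: (@continuous_comp _ _ _ (fun x : 'rV[R]_n => x + d *: e_ i) W); last exact: cW.
  apply: (@continuousD _ _ _ id (cst (d *: e_ i)) x); last exact: cst_continuous.
  exact: (@cvg_id _ (nbhs x)).
have WK (x : 'rV[R]_n) : ~ ccube 0 (K + 1) x -> W (x + d *: e_ i) = 0.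
  by move=> xK; apply: W0; apply: hK => //; rewrite ger0_norm// ltW.
have iWd := csupp_integrable K1 cWd WK.
have iW := csupp_integrable (ltW K0) cW W0.
have mT := @measurableT _ (brV R n).
have Q (x : 'rV[R]_n) : `|d * h x - (W (x + d *: e_ i) - W x)| <= d * eta * \1_(ccube 0 (K + 1)) x.
  have [xK|xK] := pselect (ccube 0 (K + 1) x).
    have [t _|c cd ->] := @MVT_line R _ W x (e_ i) d; first exact: dW.
    rewrite -mulrBr normrM gtr0_norm// indicE mem_set// mulr1 ler_wpM2l ?(ltW d0)//.
    apply: (Hd c _ x); by rewrite (le_trans cd)// gtr0_norm.
  rewrite h0 ?WK ?W0 ?subrr ?mulr0 ?subr0 ?normr0//; try exact: hK0.
  by rewrite mulr_ge0// mulr_ge0// ltW.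
have idh : (@leb R n).-integrable setT (EFin \o (fun x : 'rV[R]_n => d * h x)).
  exact: (integrableZl mT d ih).
have iB : (@leb R n).-integrable setT (EFin \o (fun x : 'rV[R]_n => W (x + d *: e_ i) - W x)).
  exact: (integrableB mT iWd iW).
have iD : (@leb R n).-integrable setT (EFin \o (fun x : 'rV[R]_n => d * h x - (W (x + d *: e_ i) - W x))).
  exact: (integrableB mT idh iB).
have iI : (@leb R n).-integrable setT (fun x : 'rV[R]_n => (\1_(ccube (0 : 'rV[R]_n) (K + 1)) x)%:E).
  have mC := @measurable_ccube R n 0 (K + 1).
  apply/integrableP; split; first by apply/measurable_EFinP; exact: measurable_indic.
  rewrite (eq_integral (fun x : brV R n => (\1_(ccube (0 : 'rV[R]_n) (K + 1)) (x : 'rV[R]_n))%:E)); last first.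
    by move=> t _; rewrite gee0_abs// lee_fin.
  rewrite integral_indic// setIT.
  by rewrite [X in (X < _)%E](leb_ccube (0 : 'rV[R]_n) K1) ltry.
have E : d * \int[@leb R n]_x h x = \int[@leb R n]_x (d * h x - (W (x + d *: e_ i) - W x)).
  by rewrite RintegralB// RintegralB// Rintegral_shift// subrr subr0 RintegralZl.
have iC : (@leb R n).-integrable setT (EFin \o (fun x : 'rV[R]_n => d * eta * \1_(ccube (0 : 'rV[R]_n) (K + 1)) x)).
  exact: (integrableZl mT (d * eta) iI).
have : d * `|\int[@leb R n]_x h x| <= d * eta * V'.
  rewrite -[X in X * `|_|]gtr0_norm// -normrM E.
  apply: le_trans (le_normr_Rintegral mT iD) _.
  apply: le_trans (le_Rintegral mT (integrable_norm iD) iC (fun x _ => Q x)) _.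
  rewrite (RintegralZl (d * eta) mT iI) ler_wpM2l ?(mulr_ge0 (ltW d0) (ltW eta0))//.
  rewrite /Rintegral.
  rewrite [X in fine X](_ : _ = V'%:E)//.
  have := @integral_indic _ (brV R n) R (@leb R n) setT mT _ (@measurable_ccube R n 0 (K + 1)).
  by rewrite setIT => H; apply: (etrans H); exact: leb_ccube.
rewrite -mulrA ler_pM2l// => H; apply: (le_trans H).
rewrite /eta mulrAC ler_pdivrMr ?ltr_pwDr// ler_wpM2l ?(ltW e0)//.
by rewrite lerDl.
Qed.
End divergence0.

(** * Bochner's formula in coordinates *)

Section schwarz.
Context {R : realType}.
Local Notation e_ i := (delta_mx 0 i).

Lemma derive_translate (V : normedModType R) (f : V -> R) a v w :
  (derivable (fun y => f (y + w)) a v <-> derivable f (a + w) v) /\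
  'D_v (fun y => f (y + w)) a = 'D_v f (a + w).
Proof.
have E : (fun h : R => h^-1 *: (((fun y => f (y + w)) \o shift a) (h *: v) - f (a + w))) =
         (fun h : R => h^-1 *: ((f \o shift (a + w)) (h *: v) - f (a + w))).
  by apply/funext => h /=; rewrite addrA.
by split; [rewrite /derivable E|rewrite /derive E].
Qed.

(** Mean values are taken twice: along [e_ i] for the difference of [f] and its translate by
    [s *: e_ j], then along [e_ j]. The second difference on the left is symmetric in [i] and [j],
    which is how mixed derivatives get compared. *)
Lemma double_difference n (U : set 'rV[R]_n) f i j x s : open U -> smooth_on U f ->
  (forall c c' : R, `|c| <= `|s| -> `|c'| <= `|s| -> U (x + c *: e_ i + c' *: e_ j)) ->
  exists c c' : R, [/\ `|c| <= `|s|, `|c'| <= `|s| &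
    f (x + s *: e_ i + s *: e_ j) - f (x + s *: e_ i) - (f (x + s *: e_ j) - f x)
    = s * (s * partial j (partial i f) (x + c *: e_ i + c' *: e_ j))].
Proof.
move=> oU sf HU.
have H0 (c : R) : `|c| <= `|s| -> U (x + c *: e_ i).
  by move=> cs; have := HU c 0 cs; rewrite scale0r addr0 normr0; apply.
have [t ts|c cs] := @MVT_line R _ (fun y => f (y + s *: e_ j) - f y) x (e_ i) s.
  apply: derivableB; last exact: smooth_on_derivable sf (H0 _ ts).
  apply/(derive_translate _ _ _ _).1; exact: smooth_on_derivable sf (HU _ _ ts (lexx _)).
move=> ->; exists c.
rewrite deriveB; last exact: smooth_on_derivable sf (H0 _ cs); last first.
  apply/(derive_translate _ _ _ _).1; exact: smooth_on_derivable sf (HU _ _ cs (lexx _)).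
rewrite (derive_translate _ _ _ _).2.
have sfi := smooth_on_partial i sf.
have [t ts|c' cs' E] := @MVT_line R _ (partial i f) (x + c *: e_ i) (e_ j) s.
  exact: smooth_on_derivable sfi (HU _ _ cs ts).
by exists c'; split=> //; congr (_ * _); exact: E.
Qed.

Lemma dist_half (a b z e : R) : `|a - z| <= e / 2 -> `|b - z| <= e / 2 -> `|a - b| <= e.
Proof.
move=> Ha Hb; rewrite [leRHS](splitr e) -(subrK z a) -addrA (le_trans (ler_normD _ _))// lerD//.
by rewrite distrC.
Qed.

Lemma schwarz n (U : set 'rV[R]_n) f i j x : open U -> smooth_on U f -> U x ->
  partial i (partial j f) x = partial j (partial i f) x.
Proof.
move=> oU sf Ux; apply/eqP; rewrite -subr_eq0 -normr_le0.
apply/ler_addgt0Pr => e e0; rewrite add0r.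
have e20 : 0 < e / 2 by rewrite divr_gt0.
have cont k l : \forall y \near x, `|partial k (partial l f) x - partial k (partial l f) y| <= e / 2.
  have := smooth_on_continuous (smooth_on_partial k (smooth_on_partial l sf)) Ux.
  by move/cvgrPdist_le; exact.
have : \forall y \near x, [/\ U y, `|partial i (partial j f) x - partial i (partial j f) y| <= e / 2 &
    `|partial j (partial i f) x - partial j (partial i f) y| <= e / 2].
  by move: (open_near oU Ux) (cont i j) (cont j i); apply: filterS3 => y; split.
move=> /nbhs_ballP[r /= r0 Hr].
(* Two moves of length at most [s] stay strictly inside the ball of radius [r]. *)
pose s := r / 3.
have s0 : 0 < s by rewrite divr_gt0.
have B k l (c c' : R) : `|c| <= `|s| -> `|c'| <= `|s| -> ball x r (x + c *: e_ k + c' *: e_ l).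
  move=> cs cs'; rewrite -ball_normE/= -addrA opprD addNKr normrN.
  apply: (@le_lt_trans _ _ (s + s)); last by rewrite /s; lra.
  rewrite (gtr0_norm s0) in cs cs'.
  apply: norm_coord => [|m]; first by lra.
  rewrite !mxE/= (le_trans (ler_normD _ _))// lerD// normrM.
    by case: (m == k); rewrite ?normr1 ?mulr1// normr0 mulr0 ltW.
  by case: (m == l); rewrite ?normr1 ?mulr1// normr0 mulr0 ltW.
have [c [c' [cs cs' E1]]] := @double_difference n U f i j x s oU sf
  (fun c c' h h' => let: And3 u _ _ := Hr _ (B i j c c' h h') in u).
have [d [d' [ds ds' E2]]] := @double_difference n U f j i x s oU sf
  (fun c c' h h' => let: And3 u _ _ := Hr _ (B j i c c' h h') in u).
have [_ _ Hb] := Hr _ (B i j c c' cs cs').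
have [_ Ha _] := Hr _ (B j i d d' ds ds').
have E : partial i (partial j f) (x + d *: e_ j + d' *: e_ i) =
         partial j (partial i f) (x + c *: e_ i + c' *: e_ j).
  apply: (@mulfI _ s); first by rewrite gt_eqF.
  apply: (@mulfI _ s); first by rewrite gt_eqF.
  have key (p q t z : R) : p - q - (t - z) = p - t - (q - z) by ring.
  apply: (etrans (esym E2)); apply: (etrans _ E1).
  have -> : x + s *: e_ j + s *: e_ i = x + s *: e_ i + s *: e_ j by rewrite addrAC.
  exact: key.
rewrite -E in Hb; move: Ha Hb.
set a := partial i _ x; set b := partial j _ x; set z := partial _ _ (_ + _).
exact: dist_half.
Qed.
End schwarz.

(** * Jacobi's formula for the derivative of a determinant *)

Section jacobi_det.
Context {R : realType}.
Local Notation e_ i := (delta_mx 0 i).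

Lemma cofactor_row m (A B : 'M[R]_m) i j : row' i A = row' i B -> cofactor A i j = cofactor B i j.
Proof.
move=> AB; congr (_ * \det _); apply/matrixP => a b.
by have := congr1 (fun M : 'M[R]_(m.-1, m) => M a (lift j b)) AB; rewrite !mxE.
Qed.

Lemma det_delta m (A : 'M[R]_m) i j t :
  \det (A + t *: delta_mx i j) = \det A + t * cofactor A i j.
Proof.
rewrite (expand_det_row _ i) (expand_det_row A i).
have E k : cofactor (A + t *: delta_mx i j) i k = cofactor A i k.
  apply: cofactor_row; apply/matrixP => a b; rewrite !mxE.
  by rewrite eq_sym (negbTE (neq_lift i a)) /= mulr0 addr0.
under eq_bigr do rewrite E !mxE mulrDl eqxx/=.
rewrite big_split/=; congr (_ + _); rewrite (bigD1 j)//= eqxx mulr1 big1 ?addr0// => k kj.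
by rewrite (negbTE kj) mulr0 mul0r.
Qed.

Lemma partial_det m (v : 'rV[R]_(m * m)) i j :
  is_derive v (e_ (mxvec_index i j)) (fun v => \det (vec_mx v : 'M[R]_m)) (cofactor (vec_mx v) i j).
Proof.
have E : (fun h : R => h^-1 *: (((fun v => \det (vec_mx v : 'M[R]_m)) \o shift v) (h *: e_ (mxvec_index i j))
   - \det (vec_mx v : 'M[R]_m))) = (fun h : R => (h^-1 * h) * cofactor (vec_mx v) i j).
  apply/funext => h /=; rewrite linearP/= vec_mx_delta addrC det_delta addrAC subrr add0r.
  by rewrite -mulrA.
have C : (fun h : R => (h^-1 * h) * cofactor (vec_mx v) i j) @ 0^' --> cofactor (vec_mx v) i j.
  apply: cvg_near_cst; near=> h.
  by rewrite mulVf ?mul1r//; near: h; exact: nbhs_dnbhs_neq.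
split; first by rewrite /derivable E; apply/cvg_ex; eexists; exact: C.
by rewrite /derive E; exact: cvg_lim C.
Unshelve. all: by end_near. Qed.

(** The determinant is viewed as a function of the m^2 entries listed by [mxvec]. It is affine in
    each entry with the cofactor as slope ([det_delta]), and the chain rule sums over the
    entries. *)
Lemma derive_det n m (g : 'rV[R]_n -> 'M[R]_m) x i :
  (forall k l, derivable (fun y => g y k l) x (e_ i)) ->
  is_derive x (e_ i) (fun y => \det (g y))
    (\sum_k \sum_l partial i (fun y => g y k l) x * cofactor (g x) k l).
Proof.
move=> dg.
pose G (j : 'I_(m * m)) y := mxvec (g y) 0 j.
have GE k l : G (mxvec_index k l) = fun y => g y k l.
  by apply/funext => y; rewrite /G mxvecE.
have dG j : derivable (G j) x (e_ i) by case/mxvec_indexP : j => k l; rewrite GE.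
have rowG y : \row_j G j y = mxvec (g y) by apply/rowP => j; rewrite mxE.
have sdet : smooth_on setT (fun v : 'rV[R]_(m * m) => \det (vec_mx v : 'M[R]_m)).
  apply: smooth_on_det => [|k l]; first exact: openT.
  rewrite (_ : (fun _ => _) = (fun v : 'rV[R]_(m * m) => v 0 (mxvec_index k l))); first by apply: smooth_on_coord; exact: openT.
  by apply/funext => v; rewrite mxE.
have D := partial_comp (smooth_on_differentiable openT sdet (I : setT (\row_j G j x))) dG.
have -> : (fun y => \det (g y)) = (fun y => \det (vec_mx (\row_j G j y) : 'M[R]_m)).
  by apply/funext => y; rewrite rowG mxvecK.
apply: (is_derive_eq D).
rewrite (reindex _ (curry_mxvec_bij _ _))/= pair_bigA/=; apply: eq_bigr => -[k l] _ /=.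
rewrite GE; congr (_ * _).
have [_] := partial_det (\row_j G j x) k l.
by rewrite /partial => ->; rewrite rowG mxvecK.
Qed.
End jacobi_det.

(** * Positive definite metrics and self-adjoint matrices *)

Section linear_algebra.
Context {R : realType}.

Definition posdef n (g : 'M[R]_n) := forall v : 'rV[R]_n, v != 0 -> 0 < (v *m g *m v^T) 0 0.

(** The rows of [E] come from one Gram-Schmidt step and induction: the first basis vector is
    normalised, and a frame of its orthogonal complement is lifted. *)
Lemma orthonormal_frame n (g : 'M[R]_n) : g^T = g -> posdef g ->
  exists2 E : 'M[R]_n, E \in unitmx & E *m g *m E^T = 1%:M.
Proof.
elim: n g => [|n IH] g gs gp.
  by exists 1%:M; [exact: unitmx1|apply/matrixP => -[]].
move: g gs gp; rewrite -[n.+1]/(1 + n)%N => g gs gp.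
pose a := g 0 0.
have e0 : (row_mx (1%:M : 'M[R]_1) 0 : 'rV[R]_(1 + n)) != 0.
  apply/eqP => /(congr1 (fun v : 'rV[R]_(1 + n) => v 0 (lshift n 0))).
  by rewrite row_mxEl !mxE eqxx => /eqP; rewrite oner_eq0.
have gE := submxK g.
have aE : ulsubmx g = a%:M.
  by apply/matrixP => i j; rewrite !ord1 !mxE eqxx mulr1n /a; congr (g _ _); exact: val_inj.
have bE : dlsubmx g = (ursubmx g)^T by rewrite trmx_ursub gs.
have cs : (drsubmx g)^T = drsubmx g by rewrite trmx_drsub gs.
set b := ursubmx g in gE bE. set c := drsubmx g in gE cs.
rewrite aE bE in gE.
have a0 : 0 < a.
  have := gp _ e0; rewrite -gE mul_row_block tr_row_mx mul_row_col !mul0mx !addr0 trmx0 mulmx0 addr0.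
  by rewrite trmx1 mulmx1 mul1mx mxE eqxx mulr1n.
(* The Schur complement of [a], that is the metric induced on the orthogonal complement of the first
   basis vector. *)
pose c' := c - a^-1 *: (b^T *m b).
have cs' : c'^T = c'.
  by rewrite /c' linearB/= linearZ/= trmx_mul trmxK cs.
have cp' : posdef c'.
  (* [V] is the vector orthogonal to the first basis vector that projects to [v]; [g] at [V] equals
     [c'] at [v]. *)
  move=> v v0; pose V : 'rV[R]_(1 + n) := row_mx (- a^-1 *: (v *m b^T)) v.
  have V0 : V != 0.
    apply: contra_neq v0 => /(congr1 (@rsubmx _ _ _ _)); rewrite row_mxKr => ->.
    by apply/matrixP => i j; rewrite !mxE.
  have := gp _ V0; rewrite -gE mul_row_block tr_row_mx mul_row_col.
  rewrite mul_mx_scalar scalerA mulrN mulfV ?gt_eqF// scaleN1r addNr mul0mx add0r.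
  by rewrite /c' mulmxBr -scalemxAr mulmxA -scalemxAl scaleNr addrC.
have [E uE EE] := IH _ cs' cp'.
pose r := (Num.sqrt a)^-1.
have r0 : 0 < r by rewrite invr_gt0 sqrtr_gt0.
have ra : r * a * r = 1.
  by rewrite /r -[X in _ * X * _](sqr_sqrtr (ltW a0)) expr2 mulrA mulVf ?mul1r ?mulfV// gt_eqF// sqrtr_gt0.
pose F : 'M[R]_(1 + n) := block_mx (r%:M) 0 (- a^-1 *: (E *m b^T)) E.
exists F.
  rewrite unitmxE det_lblock det_scalar1 unitrM -unitmxE uE andbT unitfE gt_eqF//.
rewrite -gE /F mulmx_block tr_block_mx mulmx_block.
rewrite !mul0mx !addr0 trmx0 tr_scalar_mx.
rewrite -scalar_mxM [RHS]scalar_mx_block.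
have X1 : - a^-1 *: (E *m b^T) *m a%:M + E *m b^T = 0.
  by rewrite mul_mx_scalar scalerA mulrN mulfV ?gt_eqF// scaleN1r addNr.
rewrite X1 !mulmx0 !mul0mx !add0r !addr0.
have X2 : - a^-1 *: (E *m b^T) *m b + E *m c = E *m c'.
  by rewrite /c' mulmxBr -scalemxAr mulmxA -scalemxAl scaleNr addrC.
rewrite X2 EE.
have X3 : (r * a)%:M *m (- a^-1 *: (E *m b^T))^T + (r%:M *m b) *m E^T = 0.
  rewrite mul_scalar_mx linearZ/= trmx_mul trmxK scalerA mul_scalar_mx -scalemxAl -scalerDl.
  by rewrite mulrN -mulrA mulfV ?gt_eqF// mulr1 addNr scale0r.
by rewrite X3 -scalar_mxM ra.
Qed.

(** Lagrange's identity: the difference of the two sides is half the double sum of the squares of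
    [a i - a j]. *)
Lemma sqr_sum_le n (a : 'I_n -> R) : (\sum_i a i) ^+ 2 <= n%:R * \sum_i a i ^+ 2.
Proof.
have H : 0 <= \sum_i \sum_j (a i - a j) ^+ 2.
  by apply: sumr_ge0 => i _; apply: sumr_ge0 => j _; exact: sqr_ge0.
have E : \sum_i \sum_j (a i - a j) ^+ 2 =
    (n%:R * \sum_i a i ^+ 2 - (\sum_i a i) ^+ 2) *+ 2.
  have E1 : \sum_(i < n) \sum_(j < n) a i ^+ 2 = n%:R * \sum_i a i ^+ 2.
    by under eq_bigr do rewrite sumr_const card_ord -mulr_natl; rewrite -mulr_sumr.
  have E2 : \sum_(i < n) \sum_(j < n) a j ^+ 2 = n%:R * \sum_i a i ^+ 2.
    by rewrite sumr_const card_ord [RHS]mulr_natl.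
  have E3 : \sum_(i < n) \sum_(j < n) a i * a j = (\sum_i a i) ^+ 2.
    by under eq_bigr do rewrite -mulr_sumr; rewrite -mulr_suml expr2.
  transitivity (\sum_(i < n) \sum_(j < n) a i ^+ 2 + \sum_(i < n) \sum_(j < n) a j ^+ 2
      - (\sum_(i < n) \sum_(j < n) a i * a j) *+ 2); last by rewrite E1 E2 E3; ring.
  rewrite -big_split/= -sumrMnl -sumrB; apply: eq_bigr => i _.
  rewrite -big_split/= -sumrMnl -sumrB; apply: eq_bigr => j _.
  by rewrite sqrrB; ring.
by move: H; rewrite E pmulrn_lge0// subr_ge0.
Qed.

Lemma trace_sqr_le n (K : 'M[R]_n) : (\tr K) ^+ 2 <= n%:R * \sum_i \sum_j K i j ^+ 2.
Proof.
apply: le_trans (sqr_sum_le _) _; rewrite ler_wpM2l//; apply: ler_sum => i _.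
by rewrite (bigD1 i)//= lerDl; apply: sumr_ge0 => j _; exact: sqr_ge0.
Qed.

(* K = |x|^2 A - (A x) x^T, whose squared norm is |x|^2 (|x|^2 |A|^2 - |A x|^2). *)
Lemma kato_euclid n (A : 'M[R]_n) (x : 'rV[R]_n) : A^T = A ->
  (\tr A * (x *m x^T) 0 0 - (x *m A *m x^T) 0 0) ^+ 2 <=
  n%:R * ((x *m x^T) 0 0 * (\tr (A *m A) * (x *m x^T) 0 0 - (x *m A *m (x *m A)^T) 0 0)).
Proof.
move=> As; set w := (x *m x^T) 0 0; pose y := x *m A.
pose K := w *: A - y^T *m x.
have wE : w = \sum_i x 0 i ^+ 2.
  by rewrite /w mxE; apply: eq_bigr => i _; rewrite mxE.
have trA : \tr (A *m A) = \sum_i \sum_j A i j ^+ 2.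
  apply: eq_bigr => i _; rewrite mxE; apply: eq_bigr => j _.
  by rewrite -[in X in _ * X]As mxE.
have trK : \tr K = \tr A * w - (x *m A *m x^T) 0 0.
  rewrite /K raddfB/= mxtraceZ mulrC mxtrace_mulC; congr (_ - _).
  by rewrite /mxtrace big_ord1 /y trmx_mul As mulmxA.
have yE j : y 0 j = \sum_i A j i * x 0 i.
  by rewrite /y mxE; apply: eq_bigr => i _; rewrite mulrC -[in LHS]As mxE.
have zE : (y *m y^T) 0 0 = \sum_i y 0 i ^+ 2.
  by rewrite mxE; apply: eq_bigr => i _; rewrite [X in _ * X]mxE -expr2.
have KE : \sum_i \sum_j K i j ^+ 2 = w * (\tr (A *m A) * w - (y *m y^T) 0 0).
  transitivity (\sum_i (w ^+ 2 * (\sum_j A i j ^+ 2) - w * y 0 i ^+ 2)).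
    apply: eq_bigr => i _.
    transitivity (\sum_j (w ^+ 2 * A i j ^+ 2 - 2 * w * y 0 i * (A i j * x 0 j) + y 0 i ^+ 2 * x 0 j ^+ 2)).
      apply: eq_bigr => j _; rewrite /K !mxE big_ord1 !mxE; ring.
    by rewrite !big_split/= sumrN -!mulr_sumr -yE -wE; ring.
  by rewrite sumrB -!mulr_sumr -trA -zE; ring.
by rewrite -trK -KE; exact: trace_sqr_le.
Qed.

(** All quantities are invariant under a change of basis. An orthonormal frame [E] turns [g] into
    the identity and [A], self-adjoint for [g], into the symmetric matrix [B], so that the Euclidean
    inequalities apply. *)
Lemma kato_metric n (g A : 'M[R]_n) (x : 'rV[R]_n) : g^T = g -> posdef g ->
  (A *m g)^T = A *m g ->
  (\tr A) ^+ 2 <= n%:R * \tr (A *m A) /\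
  (\tr A * (x *m g *m x^T) 0 0 - (x *m A *m g *m x^T) 0 0) ^+ 2 <=
  n%:R * ((x *m g *m x^T) 0 0 * (\tr (A *m A) * (x *m g *m x^T) 0 0
     - (x *m A *m g *m (x *m A)^T) 0 0)).
Proof.
move=> gs gp As; have [E uE EE] := orthonormal_frame gs gp.
have gE : g = invmx E *m (invmx E)^T.
  have := congr1 (fun M => invmx E *m M *m (invmx E)^T) EE.
  by rewrite /= !mulmxA mulVmx// mul1mx mulmx1 -!mulmxA -trmx_mul mulVmx// trmx1 mulmx1.
pose B := E *m A *m invmx E; pose y := x *m invmx E.
have AE : A = invmx E *m B *m E by rewrite /B !mulmxA mulVmx// mul1mx -mulmxA mulVmx// mulmx1.
have Bs : B^T = B.
  have -> : B = E *m (A *m g) *m E^T.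
    rewrite gE /B !mulmxA -!mulmxA; congr (_ *m (_ *m _)).
    by rewrite -trmx_mul mulmxV// trmx1 mulmx1.
  by rewrite trmx_mul trmxK trmx_mul As mulmxA.
have trB : \tr A = \tr B by rewrite /B mxtrace_mulC mulmxA mulVmx// mul1mx.
have trBB : \tr (A *m A) = \tr (B *m B).
  have -> : B *m B = E *m (A *m A) *m invmx E.
    by rewrite /B !mulmxA mulmxKV.
  by rewrite [RHS]mxtrace_mulC !mulmxA mulVmx// mul1mx.
have w1 : x *m g *m x^T = y *m y^T by rewrite gE /y trmx_mul !mulmxA.
have xA : x *m A *m invmx E = y *m B by rewrite /y /B !mulmxA mulmxKV.
have w2 : x *m A *m g *m x^T = y *m B *m y^T by rewrite gE !mulmxA xA /y trmx_mul !mulmxA.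
have w3 : x *m A *m g *m (x *m A)^T = y *m B *m (y *m B)^T.
  by rewrite -xA gE; set z := x *m A; rewrite [in RHS]trmx_mul !mulmxA.
rewrite trB trBB w1 w2 w3; split; last exact: kato_euclid.
apply: le_trans (trace_sqr_le _) _; rewrite ler_wpM2l// le_eqVlt; apply/orP; left; apply/eqP.
apply: eq_bigr => i _; rewrite mxE; apply: eq_bigr => j _.
have -> : B j i = B i j by move: Bs => /matrixP/(_ i j); rewrite [LHS]mxE.
by rewrite expr2.
Qed.

Lemma posdef_unit n (g : 'M[R]_n) : g^T = g -> posdef g -> g \in unitmx /\ 0 < \det g.
Proof.
move=> gs gp; have [E uE EE] := orthonormal_frame gs gp.
have D : \det E ^+ 2 * \det g = 1.
  by have := congr1 (@determinant _ _) EE; rewrite !det_mulmx det_tr det1 => <-; ring.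
have d0 : 0 < \det g.
  have E2 : 0 < \det E ^+ 2 by rewrite lt_def sqr_ge0 andbT sqrf_eq0 -unitfE -unitmxE.
  by rewrite -(pmulr_rgt0 _ E2) D.
by split=> //; rewrite unitmxE unitfE gt_eqF.
Qed.
End linear_algebra.

Opaque smooth_on.

(** * The algebra behind Bochner's formula *)

Section bochner_algebra.
Context {R : realType} {n : nat}.
Variables (X : 'I_n -> R) (A dX : 'I_n -> 'I_n -> R).
Variables (ddX G : 'I_n -> 'I_n -> 'I_n -> R) (dG : 'I_n -> 'I_n -> 'I_n -> 'I_n -> R).
Hypothesis hA : forall k m, A k m = dX k m + \sum_j G m k j * X j.
Hypothesis hs : forall k i j, G k i j = G k j i.
Hypothesis hd : forall k m j, ddX k m j = ddX m k j.
Let dA k m j := ddX k m j + \sum_l (dG k j m l * X l + G j m l * dX k l).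

(* A i k stands for the covariant derivative nabla_i X^k, G and dG for the
   Christoffel symbols and their derivatives, dA for the derivatives of A: the
   left-hand side is the divergence of nabla_X X, whose Ricci term comes from
   the derivatives and products of G. *)
Lemma bochner_algebra :
  \sum_k (\sum_m (dX k m * A m k + X m * dA k m k)) + \sum_k (\sum_m X m * A m k) * (\sum_l G l l k)
  = \sum_i \sum_k A i k * A k i + \sum_m X m * (\sum_k dA m k k)
    + \sum_j \sum_k X j * (\sum_i (dG i i j k - dG j i i k
        + \sum_m (G m j k * G i i m - G m i k * G i j m))) * X k.
Proof.
(* Every first derivative of [X] is traded for its covariant derivative. The correction terms either
   cancel by the symmetry of [G] ([Q1]) or form the products of two symbols in the curvature; the
   second derivatives cancel by [hd] ([D12]). *)
have dXE k m : dX k m = A k m - \sum_j G m k j * X j by rewrite hA addrK.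
have T1 : \sum_k \sum_m dX k m * A m k = \sum_k \sum_m A k m * A m k
    - \sum_k \sum_m \sum_j G m k j * X j * A m k.
  rewrite -sumrB; apply: eq_bigr => k _; rewrite -sumrB; apply: eq_bigr => m _.
  by rewrite -mulr_suml -mulrBl -dXE.
have E1 : \sum_k \sum_m \sum_l X m * (G k m l * dX k l) =
    \sum_k \sum_m \sum_l X m * (G k m l * A k l)
    - \sum_k \sum_m \sum_l \sum_j X m * (G k m l * (G l k j * X j)).
  rewrite -sumrB; apply: eq_bigr => k _; rewrite -sumrB; apply: eq_bigr => m _.
  rewrite -sumrB; apply: eq_bigr => l _.
  by rewrite -!mulr_sumr -!mulrBr -dXE.
have E2 : \sum_m \sum_k \sum_l X m * (G k k l * dX m l) =
    \sum_m \sum_k \sum_l X m * (G k k l * A m l)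
    - \sum_m \sum_k \sum_l \sum_j X m * (G k k l * (G l m j * X j)).
  rewrite -sumrB; apply: eq_bigr => k _; rewrite -sumrB; apply: eq_bigr => m _.
  rewrite -sumrB; apply: eq_bigr => l _.
  by rewrite -!mulr_sumr -!mulrBr -dXE.
have T2 : \sum_k \sum_m X m * dA k m k = \sum_k \sum_m X m * ddX k m k
   + \sum_k \sum_m \sum_l X m * (dG k k m l * X l) + \sum_k \sum_m \sum_l X m * (G k m l * dX k l).
  rewrite -!big_split/=; apply: eq_bigr => k _; rewrite -!big_split/=; apply: eq_bigr => m _.
  by rewrite -!mulr_sumr -!mulrDr /dA big_split/= addrA.
have T3 : \sum_m X m * (\sum_k dA m k k) = \sum_m \sum_k X m * ddX m k k
   + \sum_m \sum_k \sum_l X m * (dG m k k l * X l) + \sum_m \sum_k \sum_l X m * (G k k l * dX m l).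
  rewrite -!big_split/=; apply: eq_bigr => m _; rewrite mulr_sumr -!big_split/=; apply: eq_bigr => k _.
  by rewrite -!mulr_sumr -!mulrDr /dA big_split/= addrA.
have D12 : \sum_k \sum_m X m * ddX k m k = \sum_m \sum_k X m * ddX m k k.
  by rewrite exchange_big; apply: eq_bigr => m _; apply: eq_bigr => k _; rewrite hd.
have Q1 : \sum_k \sum_m \sum_l X m * (G k m l * A k l) = \sum_k \sum_m \sum_j G m k j * X j * A m k.
  rewrite [RHS]exchange_big; apply: eq_bigr => k _ /=.
  rewrite exchange_big; apply: eq_bigr => m _ /=; apply: eq_bigr => l _.
  by rewrite [in RHS]hs; ring.
have T4 : \sum_k (\sum_m X m * A m k) * (\sum_l G l l k) = \sum_m \sum_k \sum_l X m * (G k k l * A m l).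
  transitivity (\sum_k \sum_m \sum_l X m * (G l l k * A m k)).
    apply: eq_bigr => k _; rewrite mulr_suml; apply: eq_bigr => m _.
    by rewrite mulr_sumr; apply: eq_bigr => l _; ring.
  by rewrite exchange_big; apply: eq_bigr => m _ /=; rewrite exchange_big.
have Ric : \sum_j \sum_k X j * (\sum_i (dG i i j k - dG j i i k
        + \sum_m (G m j k * G i i m - G m i k * G i j m))) * X k =
    \sum_k \sum_m \sum_l X m * (dG k k m l * X l) - \sum_m \sum_k \sum_l X m * (dG m k k l * X l)
    + \sum_m \sum_k \sum_l \sum_j X m * (G k k l * (G l m j * X j))
    - \sum_k \sum_m \sum_l \sum_j X m * (G k m l * (G l k j * X j)).
  rewrite [in X in X - _ + _ - _]exchange_big/= [in X in _ - X]exchange_big/=.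
  rewrite -sumrB -big_split/= -sumrB; apply: eq_bigr => j _.
  transitivity (\sum_i \sum_k (X j * (dG i i j k * X k) - X j * (dG j i i k * X k)
     + \sum_m X j * (G i i m * (G m j k * X k)) - \sum_m X j * (G i j m * (G m i k * X k)))).
    rewrite exchange_big/=; apply: eq_bigr => k _; rewrite mulr_sumr mulr_suml.
    apply: eq_bigr => i _; rewrite sumrB mulrDr mulrDl -[RHS]addrA.
    congr (_ + _); first by ring.
    rewrite mulrBr mulrBl; congr (_ - _); rewrite mulr_sumr mulr_suml;
      by apply: eq_bigr => m _; ring.
  rewrite -sumrB -big_split/= -sumrB; apply: eq_bigr => i _.
  rewrite [X in _ - _ + X - _]exchange_big/= [X in _ - X]exchange_big/=.
  by rewrite -sumrB -big_split/= -sumrB.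
have -> : \sum_k (\sum_m (dX k m * A m k + X m * dA k m k)) =
    \sum_k \sum_m dX k m * A m k + \sum_k \sum_m X m * dA k m k.
  by rewrite -big_split/=; apply: eq_bigr => k _; rewrite big_split.
rewrite Ric T3 T4 T1 T2 E1 E2 D12 Q1; ring.
Qed.
End bochner_algebra.

Section local_rules.
Context {R : realType} {n : nat}.
Variable U : set 'rV[R]_n.
Hypothesis oU : open U.
Implicit Types (f h : 'rV[R]_n -> R) (x : 'rV[R]_n).

Lemma partialD f h i x : smooth_on U f -> smooth_on U h -> U x ->
  partial i (fun y => f y + h y) x = partial i f x + partial i h x.
Proof.
move=> sf sh Ux; rewrite /partial.
exact: (deriveD (@smooth_on_derivable R n U f x i sf Ux) (@smooth_on_derivable R n U h x i sh Ux)).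
Qed.

Lemma partialM f h i x : smooth_on U f -> smooth_on U h -> U x ->
  partial i (fun y => f y * h y) x = partial i f x * h x + f x * partial i h x.
Proof.
move=> sf sh Ux; rewrite /partial.
rewrite [LHS](deriveM (@smooth_on_derivable R n U f x i sf Ux) (@smooth_on_derivable R n U h x i sh Ux)).
by rewrite addrC [_ *: _]mulrC.
Qed.

Lemma partialZ a f i x : smooth_on U f -> U x ->
  partial i (fun y => a * f y) x = a * partial i f x.
Proof.
move=> sf Ux; rewrite (partialM _ (smooth_on_cst oU a) sf Ux).
by rewrite /partial derive_cst mul0r add0r.
Qed.

Lemma partial_sum m (F : 'I_m -> 'rV[R]_n -> R) i x : (forall j, smooth_on U (F j)) -> U x ->
  partial i (fun y => \sum_j F j y) x = \sum_j partial i (F j) x.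
Proof.
elim: m F => [|m IH] F sF Ux.
  rewrite big_ord0 (_ : (fun _ => _) = fun=> 0); last by apply/funext => y; rewrite big_ord0.
  by rewrite /partial derive_cst.
rewrite big_ord_recl (_ : (fun _ => _) = fun y => F ord0 y + \sum_j F (lift ord0 j) y); last first.
  by apply/funext => y; rewrite big_ord_recl.
rewrite partialD//; first by rewrite IH.
by apply: smooth_on_sum => // j _; exact: sF.
Qed.
End local_rules.

(** * Christoffel symbols, the Hessian and Bochner's formula in a patch *)

Section local_geometry.
Context {R : realType} {n : nat}.
Variables (U : set 'rV[R]_n) (g : 'rV[R]_n -> 'M[R]_n).
Implicit Types (f : 'rV[R]_n -> R) (Z : 'rV[R]_n -> 'rV[R]_n) (x : 'rV[R]_n).

Definition lgrad f x : 'rV[R]_n := (\row_i partial i f x) *m invmx (g x).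

Definition ldiv Z x : R := (Num.sqrt (\det (g x)))^-1 *
  \sum_i partial i (fun y => Num.sqrt (\det (g y)) * Z y 0 i) x.

Hypothesis oU : open U.
Hypothesis gsm : forall i j, smooth_on U (fun x => g x i j).
Hypothesis gsym : forall x, U x -> (g x)^T = g x.
Hypothesis gpos : forall x, U x -> posdef (g x).

Lemma gunit x : U x -> g x \in unitmx.
Proof. by move=> Ux; have [] := posdef_unit (gsym Ux) (gpos Ux). Qed.

Lemma gdet x : U x -> 0 < \det (g x).
Proof. by move=> Ux; have [] := posdef_unit (gsym Ux) (gpos Ux). Qed.

Lemma gisym x : U x -> (invmx (g x))^T = invmx (g x).
Proof. by move=> Ux; rewrite trmx_inv gsym. Qed.

Lemma gi_smooth i j : smooth_on U (fun x => invmx (g x) i j).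
Proof. by apply: smooth_on_invmx => //; exact: gunit. Qed.

Lemma sqrtdet_smooth : smooth_on U (fun x => Num.sqrt (\det (g x))).
Proof. by apply: smooth_on_sqrt => //; [exact: smooth_on_det|exact: gdet]. Qed.

Lemma sqrtdet_gt0 x : U x -> 0 < Num.sqrt (\det (g x)).
Proof. by move=> Ux; rewrite sqrtr_gt0 gdet. Qed.

Lemma lgradE f x k : lgrad f x 0 k = \sum_l partial l f x * invmx (g x) l k.
Proof. by rewrite /lgrad mxE; apply: eq_bigr => l _; rewrite mxE. Qed.

Lemma lgrad_smooth f k : smooth_on U f -> smooth_on U (fun x => lgrad f x 0 k).
Proof.
move=> sf; rewrite (_ : (fun _ => _) = fun x => \sum_l partial l f x * invmx (g x) l k).
  exact: (smooth_on_sum oU _ (fun l _ => smooth_onM oU (smooth_on_partial l sf) (gi_smooth l k))).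
by apply/funext => x; rewrite lgradE.
Qed.

Lemma lgrad_lower f x k : U x -> \sum_j lgrad f x 0 j * g x j k = partial k f x.
Proof.
move=> Ux; transitivity ((lgrad f x *m g x) 0 k); first by rewrite mxE.
by rewrite /lgrad -mulmxA mulVmx ?gunit// mulmx1 mxE.
Qed.

Lemma gsymE x i j : U x -> g x i j = g x j i.
Proof. by move=> Ux; move/matrixP : (gsym Ux) => /(_ j i); rewrite mxE. Qed.

Lemma gisymE x i j : U x -> invmx (g x) i j = invmx (g x) j i.
Proof. by move=> Ux; move/matrixP : (gisym Ux) => /(_ j i); rewrite mxE. Qed.

Lemma dgsym x i j k : U x ->
  partial i (fun y => g y j k) x = partial i (fun y => g y k j) x.
Proof. by move=> Ux; apply: partial_eq_on oU _ Ux => y Uy; exact: gsymE. Qed.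

Notation Gam := (christoffel g).

Lemma christoffel_smooth k i j : smooth_on U (Gam k i j).
Proof.
apply: smooth_onM => //; first exact: smooth_on_cst.
apply: smooth_on_sum => // l _; apply: smooth_onM => //; first exact: gi_smooth.
have D a b c : smooth_on U (partial a (fun y => g y b c)) by exact: smooth_on_partial.
apply: smooth_onD => //; last by apply: smooth_onN.
by apply: smooth_onD.
Qed.

Lemma christoffel_sym k i j x : U x -> Gam k i j x = Gam k j i x.
Proof.
move=> Ux; congr (_ * _); apply: eq_bigr => l _; congr (_ * _).
by rewrite (dgsym l i j Ux) [X in X - _]addrC.
Qed.

(** The right-hand side is the Christoffel symbol of the first kind; the sum over [k] meets the
    inverse metric in the definition and collapses. *)
Lemma christoffel_lower m i j x : U x -> \sum_k g x m k * Gam k i j x =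
  2^-1 * (partial i (fun y => g y j m) x + partial j (fun y => g y i m) x
          - partial m (fun y => g y i j) x).
Proof.
move=> Ux; pose T l := partial i (fun y => g y j l) x + partial j (fun y => g y i l) x
          - partial l (fun y => g y i j) x.
transitivity (2^-1 * \sum_l (\sum_k g x m k * invmx (g x) k l) * T l).
  rewrite mulr_sumr; under [RHS]eq_bigr do rewrite mulr_suml mulr_sumr.
  rewrite [RHS]exchange_big/=; apply: eq_bigr => k _.
  rewrite /christoffel mulrCA !mulr_sumr; apply: eq_bigr => l _; by rewrite !mulrA.
congr (_ * _); rewrite (bigD1 m)//= [X in _ + X]big1 ?addr0.
  have -> : \sum_k g x m k * invmx (g x) k m = (g x *m invmx (g x)) m m by rewrite mxE.
  by rewrite mulmxV ?gunit// mxE eqxx mul1r.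
move=> l lm; have -> : \sum_k g x m k * invmx (g x) k l = (g x *m invmx (g x)) m l by rewrite mxE.
by rewrite mulmxV ?gunit// mxE eq_sym (negbTE lm) mul0r.
Qed.

(** The metric is parallel: in the sum of two symbols of the first kind all derivatives but one
    cancel by symmetry. *)
Lemma metric_compat i j k x : U x -> partial i (fun y => g y j k) x =
  \sum_l Gam l i j x * g x l k + \sum_l Gam l i k x * g x l j.
Proof.
move=> Ux.
have E a b : \sum_l Gam l i a x * g x l b = \sum_l g x b l * Gam l i a x.
  by apply: eq_bigr => l _; rewrite mulrC (gsymE l b Ux).
rewrite !E !christoffel_lower// (dgsym i k j Ux) (dgsym j i k Ux) (dgsym k i j Ux).
by rewrite (dgsym j k i Ux) (dgsym k j i Ux); field.
Qed.

(** By Jacobi's formula the logarithmic derivative is half the trace of the inverse metric times the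
    derivative of the metric. The contracted symbol is the same trace, since its other two terms
    cancel after exchanging the indices of summation. *)
Lemma partial_sqrtdet i x : U x -> partial i (fun y => Num.sqrt (\det (g y))) x =
  Num.sqrt (\det (g x)) * \sum_l Gam l l i x.
Proof.
move=> Ux; have d0 := gdet Ux; have s0 := sqrtdet_gt0 Ux.
have [Dd DE] := derive_det (fun k l => @smooth_on_derivable R n U _ x i (gsm k l) Ux).
have [d' E'] := is_derive1_sqrt d0.
have [_] := derive1_comp_dir Dd d'; rewrite derive1E E' DE /partial => -> {E' DE d' Dd}.
have C : \sum_k \sum_l partial i (fun y => g y k l) x * cofactor (g x) k l =
   \det (g x) * \sum_l \sum_k invmx (g x) l k * partial i (fun y => g y l k) x.
  rewrite mulr_sumr; apply: eq_bigr => k _; rewrite mulr_sumr; apply: eq_bigr => l _.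
  have -> : invmx (g x) k l = (\det (g x))^-1 * cofactor (g x) k l.
    by rewrite (gisymE k l Ux) /invmx gunit// mxE mxE.
  by field; rewrite gt_eqF.
have S : \sum_l Gam l l i x = 2^-1 * \sum_l \sum_k invmx (g x) l k * partial i (fun y => g y l k) x.
  rewrite -mulr_sumr; congr (_ * _).
  transitivity (\sum_l \sum_k invmx (g x) l k * partial i (fun y => g y l k) x
    + (\sum_l \sum_k invmx (g x) l k * partial l (fun y => g y i k) x
      - \sum_l \sum_k invmx (g x) l k * partial k (fun y => g y l i) x)).
    rewrite -sumrB -big_split/=; apply: eq_bigr => l _.
    rewrite -sumrB -big_split/=; apply: eq_bigr => k _; ring.
  rewrite [X in _ + (_ - X)]exchange_big/= [X in _ + X](_ : _ = 0) ?addr0//.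
  apply/eqP; rewrite subr_eq0; apply/eqP; apply: eq_bigr => l _; apply: eq_bigr => k _.
  by rewrite (gisymE l k Ux) (dgsym l i k Ux).
have DD : \det (g x) = Num.sqrt (\det (g x)) ^+ 2 by rewrite sqr_sqrtr ?ltW.
rewrite C S; set Q := \sum_l _; rewrite [X in _ * (X * Q)]DD.
by field; rewrite gt_eqF.
Qed.

Lemma ldivE Z x : (forall i, smooth_on U (fun y => Z y 0 i)) -> U x ->
  ldiv Z x = \sum_i partial i (fun y => Z y 0 i) x + \sum_i Z x 0 i * \sum_l Gam l l i x.
Proof.
move=> sZ Ux; have s0 := sqrtdet_gt0 Ux; rewrite /ldiv.
have E i : partial i (fun y => Num.sqrt (\det (g y)) * Z y 0 i) x = Num.sqrt (\det (g x)) *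
   (partial i (fun y => Z y 0 i) x + Z x 0 i * \sum_l Gam l l i x).
  rewrite (partialM _ sqrtdet_smooth (sZ i) Ux) partial_sqrtdet//; ring.
under eq_bigr do rewrite E.
by rewrite -mulr_sumr mulrA mulVf ?gt_eqF// mul1r big_split.
Qed.

Section hessian.
Variable u : 'rV[R]_n -> R.
Hypothesis su : smooth_on U u.

Let X k y := lgrad u y 0 k.
Let sX k : smooth_on U (X k).
Proof. exact: lgrad_smooth. Qed.

(** The covariant derivative of grad u, that is the Hessian with one index raised. *)
Definition nablagrad i k x := partial i (fun y => lgrad u y 0 k) x
  + \sum_j Gam k i j x * lgrad u x 0 j.
Notation A := nablagrad.

Lemma nablagrad_smooth i k : smooth_on U (A i k).
Proof.
exact: (smooth_onD oU (smooth_on_partial i (sX k)) (smooth_on_sum oU _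
  (fun j _ => smooth_onM oU (christoffel_smooth k i j) (sX j)))).
Qed.

(** Differentiating [lgrad_lower] and replacing the derivatives of the metric by [metric_compat]
    leaves the classical Hessian. In this form the symmetry needed by [Amx_sym] follows from
    [schwarz]. *)
Lemma nablagrad_lower i k x : U x -> \sum_j A i j x * g x j k =
  partial i (partial k u) x - \sum_l Gam l i k x * partial l u x.
Proof.
move=> Ux.
have E : partial i (partial k u) x = \sum_j (partial i (X j) x * g x j k + X j x * partial i (fun y => g y j k) x).
  rewrite -(@partial_eq_on _ _ U (fun y => \sum_j X j y * g y j k) _ _ _ oU _ Ux); last first.
    by move=> y Uy; exact: lgrad_lower.
  rewrite (partial_sum oU _ (fun j => smooth_onM oU (sX j) (gsm j k)) Ux).
  by apply: eq_bigr => j _; rewrite (partialM _ (sX j) (gsm j k) Ux).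
rewrite E big_split/= /A; under eq_bigr do rewrite mulrDl.
rewrite big_split/= -addrA; congr (_ + _).
under [X in _ = X - _]eq_bigr do rewrite metric_compat// mulrDr.
rewrite big_split/= -addrA; rewrite [X in _ + (X - _)](_ : _ = \sum_l Gam l i k x * partial l u x).
  rewrite subrr addr0; under eq_bigr do rewrite mulr_suml.
  rewrite exchange_big/=; apply: eq_bigr => l _; rewrite mulr_sumr; apply: eq_bigr => j _.
  by rewrite /X; ring.
under eq_bigr do rewrite mulr_sumr.
rewrite exchange_big/=; apply: eq_bigr => l _; rewrite -(lgrad_lower u l Ux) mulr_sumr.
by apply: eq_bigr => j _; rewrite (gsymE l j Ux) /X; ring.
Qed.

Definition Amx x : 'M[R]_n := \matrix_(i, k) A i k x.

Lemma Amx_sym x : U x -> (Amx x *m g x)^T = Amx x *m g x.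
Proof.
move=> Ux; apply/matrixP => i k; rewrite [LHS]mxE [LHS]mxE [RHS]mxE.
under eq_bigr do rewrite mxE. under [RHS]eq_bigr do rewrite mxE.
rewrite !(nablagrad_lower _ _ Ux) (schwarz k i oU su Ux); congr (_ - _).
by apply: eq_bigr => l _; rewrite (christoffel_sym _ _ _ Ux).
Qed.

Definition gradsq x : R := \sum_k lgrad u x 0 k * partial k u x.

Lemma gradsq_smooth : smooth_on U gradsq.
Proof.
exact: (smooth_on_sum oU _ (fun k _ => smooth_onM oU (sX k) (smooth_on_partial k su))).
Qed.

Lemma partial_gradsq i x : U x ->
  partial i gradsq x = 2 * \sum_k lgrad u x 0 k * \sum_j A i j x * g x j k.
Proof.
move=> Ux; rewrite /gradsq.
rewrite (partial_sum oU _ (fun k => smooth_onM oU (sX k) (smooth_on_partial k su)) Ux).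
under eq_bigr do rewrite (partialM _ (sX _) (smooth_on_partial _ su) Ux).
(* The two halves of the product rule are not tensorial: each equals the covariant term up to [S],
   with opposite signs. *)
rewrite big_split/= mulr_natl mulr2n; pose S := \sum_k \sum_j Gam k i j x * X j x * partial k u x.
have E1 : \sum_k partial i (X k) x * partial k u x = \sum_k X k x * (\sum_j A i j x * g x j k) - S.
  transitivity (\sum_k A i k x * partial k u x - S).
    rewrite -sumrB; apply: eq_bigr => k _; rewrite -mulr_suml -mulrBl; congr (_ * _).
    by rewrite /A addrK.
  congr (_ - _); under eq_bigr do rewrite -(lgrad_lower u _ Ux) mulr_sumr.
  rewrite exchange_big/=; apply: eq_bigr => j _; rewrite mulr_sumr; apply: eq_bigr => k _.
  by rewrite (gsymE j k Ux) /X; ring.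
have E2 : \sum_k X k x * partial i (partial k u) x = \sum_k X k x * (\sum_j A i j x * g x j k) + S.
  transitivity (\sum_k X k x * (\sum_j A i j x * g x j k + \sum_l Gam l i k x * partial l u x)).
    by apply: eq_bigr => k _; rewrite nablagrad_lower// subrK.
  under eq_bigr do rewrite mulrDr; rewrite big_split/=; congr (_ + _).
  under eq_bigr do rewrite mulr_sumr.
  rewrite exchange_big/=; apply: eq_bigr => k _; apply: eq_bigr => j _; ring.
by rewrite E1 E2; ring.
Qed.

Lemma lgrad_gradsq x : U x -> lgrad gradsq x = 2 *: (lgrad u x *m Amx x).
Proof.
move=> Ux; rewrite {1}/lgrad.
have -> : \row_i partial i gradsq x = 2 *: (lgrad u x *m (Amx x *m g x)).
  apply/rowP => i; rewrite [LHS]mxE partial_gradsq// [RHS]mxE; congr (_ * _).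
  rewrite [RHS]mxE; apply: eq_bigr => k _; congr (_ * _).
  rewrite -(Amx_sym Ux) mxE [RHS]mxE; apply: eq_bigr => j _; by rewrite mxE.
by rewrite -scalemxAl -!mulmxA mulmxV ?gunit// mulmx1.
Qed.

Lemma ldiv_lgrad x : U x -> ldiv (lgrad u) x = \tr (Amx x).
Proof.
move=> Ux; rewrite (ldivE sX Ux) /mxtrace.
under [RHS]eq_bigr do rewrite mxE /A; rewrite big_split/=; congr (_ + _).
rewrite [RHS]exchange_big/=; apply: eq_bigr => j _.
by rewrite mulr_sumr; apply: eq_bigr => l _; rewrite mulrC.
Qed.

(** Bochner's formula. Half the gradient of |grad u|^2 is the covariant derivative of X = grad u
    along itself ([YE]), whose divergence is computed by [bochner_algebra]. *)
Lemma ldiv_half_gradsq x : U x ->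
  ldiv (fun y => 2^-1 *: lgrad gradsq y) x =
  \tr (Amx x *m Amx x) + \sum_m lgrad u x 0 m * partial m (ldiv (lgrad u)) x
  + (lgrad u x *m ricci g x *m (lgrad u x)^T) 0 0.
Proof.
move=> Ux.
have sA := nablagrad_smooth; have sG := christoffel_smooth.
have YE y k : U y -> (2^-1 *: lgrad gradsq y) 0 k = \sum_m X m y * A m k y.
  move=> Uy; rewrite lgrad_gradsq// scalerA mulVf ?pnatr_eq0// scale1r mxE.
  by apply: eq_bigr => m _; rewrite [X in _ * X]mxE.
have sY k : smooth_on U (fun y => (2^-1 *: lgrad gradsq y) 0 k).
  rewrite (_ : (fun _ => _) = fun y => 2^-1 * lgrad gradsq y 0 k); last first.
    by apply/funext => y; rewrite mxE.
  exact: (smooth_onM oU (smooth_on_cst oU _) (lgrad_smooth k gradsq_smooth)).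
rewrite (ldivE sY Ux).
have P1 k : partial k (fun y => (2^-1 *: lgrad gradsq y) 0 k) x =
    \sum_m (partial k (X m) x * A m k x + X m x * partial k (A m k) x).
  rewrite (@partial_eq_on _ _ U _ (fun y => \sum_m X m y * A m k y) k x oU (fun y => @YE y k) Ux).
  rewrite (partial_sum oU _ (fun m => smooth_onM oU (sX m) (sA m k)) Ux).
  by apply: eq_bigr => m _; rewrite (partialM _ (sX m) (sA m k) Ux).
have P2 k m j : partial k (A m j) x = partial k (partial m (X j)) x
   + \sum_l (partial k (Gam j m l) x * X l x + Gam j m l x * partial k (X l) x).
  have sGX l : smooth_on U (fun y => Gam j m l y * X l y) := smooth_onM oU (sG j m l) (sX l).
  rewrite /A (partialD _ (smooth_on_partial m (sX j)) (smooth_on_sum oU _ (fun l _ => sGX l)) Ux).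
  congr (_ + _); rewrite (partial_sum oU)//; apply: eq_bigr => l _.
  by rewrite (partialM _ (sG j m l) (sX l) Ux).
have P3 m : partial m (ldiv (lgrad u)) x = \sum_k partial m (A k k) x.
  rewrite (@partial_eq_on _ _ U _ (fun y => \sum_k A k k y) m x oU _ Ux); last first.
    by move=> y Uy; rewrite ldiv_lgrad//; apply: eq_bigr => k _; rewrite mxE.
  by rewrite (partial_sum oU _ (fun k => sA k k) Ux).
under eq_bigr do rewrite P1.
under [X in _ + X]eq_bigr do rewrite (YE _ _ Ux).
under [X in _ = _ + X + _]eq_bigr do rewrite P3.
under eq_bigr do under eq_bigr do rewrite P2.
under [X in _ = _ + X + _]eq_bigr do under eq_bigr do rewrite P2.
rewrite (@bochner_algebra R n (fun k => X k x) (fun k m => A k m x) (fun k m => partial k (X m) x)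
  (fun k m j => partial k (partial m (X j)) x) (fun k i j => Gam k i j x)
  (fun l k i j => partial l (Gam k i j) x)).
- congr (_ + _ + _).
    by apply: eq_bigr => i _; rewrite mxE; apply: eq_bigr => k _; rewrite !mxE.
  rewrite [RHS]mxE.
  transitivity (\sum_k (\sum_j X j x * ricci g x j k) * X k x); last first.
    by apply: eq_bigr => k _; rewrite [(_ *m _) 0 k]mxE [_^T k 0]mxE.
  rewrite exchange_big/=; apply: eq_bigr => k _; rewrite mulr_suml; apply: eq_bigr => j _.
  congr (_ * _ * _); rewrite mxE.
  by apply: eq_bigr => i _.
- by move=> k m.
- by move=> k i j; exact: christoffel_sym.
- by move=> k m j; exact: schwarz oU (sX j) Ux.
Qed.

(** As grad w = 2 Hess u (grad u), [q] and [z] are <Hess u (grad u), grad u> and |Hess u (grad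
    u)|^2. The sign of the Ricci term makes [B] dominate the trace of the squared Hessian, and
    [kato_metric] is applied to the Hessian and grad u. At a critical point [z] vanishes together
    with grad u. *)
Lemma bochner_kato x : U x -> 0 <= (lgrad u x *m ricci g x *m (lgrad u x)^T) 0 0 ->
  let w := gradsq x in let L := ldiv (lgrad u) x in
  let B := ldiv (fun y => 2^-1 *: lgrad gradsq y) x
           - \sum_m lgrad u x 0 m * partial m (ldiv (lgrad u)) x in
  let q := 2^-1 * \sum_k partial k gradsq x * lgrad u x 0 k in
  let z := 2^-1 ^+ 2 * \sum_k partial k gradsq x * lgrad gradsq x 0 k in
  [/\ 0 <= w, L ^+ 2 <= n%:R * B, (L * w - q) ^+ 2 <= n%:R * (w * (B * w - z)) &
      w = 0 -> z = 0].
Proof.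
move=> Ux Ric0 w L B q z.
have xg f y : U y -> lgrad f y *m g y = \row_i partial i f y.
  by move=> Uy; rewrite /lgrad -mulmxA mulVmx ?gunit// mulmx1.
have ip f (v : 'rV[R]_n) : \sum_k partial k f x * v 0 k = (lgrad f x *m g x *m v^T) 0 0.
  by rewrite xg// mxE; apply: eq_bigr => k _; rewrite !mxE.
have wE : w = (lgrad u x *m g x *m (lgrad u x)^T) 0 0.
  by rewrite -ip; apply: eq_bigr => k _; rewrite mulrC.
have w0 : 0 <= w.
  rewrite wE; have [->|v0] := eqVneq (lgrad u x) 0; first by rewrite !mul0mx mxE.
  by rewrite ltW// gpos.
have [K1 K2] := kato_metric (lgrad u x) (gsym Ux) (gpos Ux) (Amx_sym Ux).
have BE : \tr (Amx x *m Amx x) <= B by rewrite /B ldiv_half_gradsq// addrAC addrK lerDl.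
have qE : q = (lgrad u x *m Amx x *m g x *m (lgrad u x)^T) 0 0.
  rewrite /q ip lgrad_gradsq// -!scalemxAl [X in _ * X]mxE mulrA mulVf ?pnatr_eq0// mul1r.
  by [].
have zE : z = (lgrad u x *m Amx x *m g x *m (lgrad u x *m Amx x)^T) 0 0.
  rewrite /z ip lgrad_gradsq// -!scalemxAl linearZ/= -scalemxAr scalerA [X in _ * X]mxE mulrA.
  by rewrite -expr2 -exprMn mulVf ?pnatr_eq0// expr1n mul1r.
split=> //.
- by rewrite /L ldiv_lgrad// (le_trans K1)// ler_wpM2l.
- rewrite /L ldiv_lgrad// qE zE wE (le_trans K2)// ler_wpM2l// -wE ler_wpM2l// lerB// ler_wpM2r//.
- move=> wz; rewrite zE; have -> : lgrad u x = 0.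
    apply/eqP/negPn/negP => /(gpos Ux); rewrite -wE wz ltxx//.
  by rewrite !mul0mx mxE.
Qed.
End hessian.
End local_geometry.

(** * Charts, gradients and bump functions *)

Section diff_row.
Context {R : realType}.

Lemma differentiable_row n m (f : 'rV[R]_n -> 'rV[R]_m) x :
  (forall j, differentiable (fun y => f y 0 j) x) -> differentiable f x.
Proof.
move=> df.
have -> : f = \sum_j (fun y => f y 0 j *: (delta_mx 0 j : 'rV[R]_m)).
  by apply/funext => y; rewrite fct_sumE; exact: row_sum_delta.
by apply: differentiable_sum => j; exact: differentiableZl.
Qed.

Lemma jacobianE n m (f : 'rV[R]_n -> 'rV[R]_m) x i j :
  (forall j, differentiable (fun y => f y 0 j) x) ->
  ('J f x) i j = partial i (fun y => f y 0 j) x.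
Proof.
move=> df; have dfx := differentiable_row df.
have -> : partial i (fun y => f y 0 j) x = ('D_(delta_mx 0 i) f x) 0 j.
  have fE : f = (fun y => \row_k f y 0 k) by apply/funext => y; apply/rowP => k; rewrite mxE.
  have H := @derive_row R n m (fun k y => f y 0 k) x (delta_mx 0 i)
     (fun k => diff_derivable (df k)).
  by rewrite [in RHS]fE (@derive_val _ _ _ _ _ _ _ H) mxE.
by rewrite (deriveEjacobian (delta_mx 0 i) dfx) -rowE [in RHS]mxE.
Qed.

Lemma continuous_near (T T' : topologicalType) (f g : T -> T') x :
  (\forall y \near x, f y = g y) -> {for x, continuous g} -> {for x, continuous f}.
Proof.
move=> fg cg; rewrite /prop_for /continuous_at (nbhs_singleton fg).
by apply: cvg_trans cg; apply: near_eq_cvg; apply: filterS fg => y ->.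
Qed.

End diff_row.

Section charts.
Context {R : realType} {N : nat} {M : smoothManifold R N}.
Implicit Types (c : chart R N M) (p : M) (x : 'rV[R]_N) (f : M -> R).
Local Notation e_ i := (delta_mx 0 i).

Lemma cod_open c : open (cod c). Proof. exact: open_cod. Qed.
Arguments cod_open : clear implicits.

Lemma chart_continuous c p : dom c p -> {for p, continuous c}.
Proof.
move=> cp; have := @continuous_coord _ _ _ c.
rewrite (continuous_open_subspace _ (open_dom c)) => H.
by apply: H; exact: mem_set.
Qed.

Lemma icoord_continuous c x : cod c x -> {for x, continuous (icoord c)}.
Proof.
move=> cx; have := @continuous_icoord _ _ _ c.
rewrite (continuous_open_subspace _ (@open_cod _ _ _ c)) => H.
by apply: H; exact: mem_set.
Qed.

Lemma cod_coord c p : dom c p -> cod c (c p).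
Proof. by move=> cp; exists p. Qed.

Lemma dom_icoord c x : cod c x -> dom c (icoord c x).
Proof. by case=> p cp <-; rewrite coordK. Qed.

Lemma icoordK c x : cod c x -> c (icoord c x) = x.
Proof. by case=> p cp <-; rewrite coordK. Qed.

Lemma overlapE c c' x : (c @` (dom c `&` dom c')) x <-> cod c x /\ dom c' (icoord c x).
Proof.
split=> [[p [cp cp'] <-]|[cx cx']]; first by split; [exact: cod_coord|rewrite coordK].
by exists (icoord c x); [split=> //; exact: dom_icoord|exact: icoordK].
Qed.

Lemma preimage_icoord_open c (V : set M) : open V ->
  open [set x | cod c x /\ V (icoord c x)].
Proof.
move=> oV; rewrite openE => x [cx Vx].
have n1 : \forall y \near x, cod c y by apply: open_near => //; exact: cod_open.
have n2 : \forall y \near x, V (icoord c y).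
  by apply: (icoord_continuous cx); exact: open_nbhs_nbhs.
by apply: filterS2 n1 n2 => y; split.
Qed.

Lemma preimage_coord_open c (V : set 'rV[R]_N) : open V ->
  open [set p | dom c p /\ V (c p)].
Proof.
move=> oV; rewrite openE => p [cp Vp].
have n1 : \forall q \near p, dom c q.
  by apply: open_nbhs_nbhs; split => //; exact: open_dom.
have n2 : \forall q \near p, V (c q).
  by apply: (chart_continuous cp); exact: open_nbhs_nbhs.
by apply: filterS2 n1 n2 => y; split.
Qed.

Lemma overlap_open c c' : open (c @` (dom c `&` dom c')).
Proof.
rewrite (_ : _ @` _ = [set x | cod c x /\ dom c' (icoord c x)]).
  by apply: preimage_icoord_open; exact: open_dom.
by apply/seteqP; split => x /overlapE.
Qed.

Lemma transition_row c c' x : transition c c' x = \row_j transition c c' x 0 j.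
Proof. by apply/rowP => j; rewrite mxE. Qed.

Lemma transition_continuous c c' x : cod c x -> dom c' (icoord c x) ->
  {for x, continuous (transition c c')}.
Proof.
move=> cx cx'; apply: (@continuous_comp _ _ _ (icoord c) c'); first exact: icoord_continuous.
exact: chart_continuous.
Qed.

Lemma transition_differentiable c c' x j : atlas c -> atlas c' ->
  cod c x -> dom c' (icoord c x) -> differentiable (fun y => transition c c' y 0 j) x.
Proof.
move=> ac ac' cx cx'.
apply: (@smooth_on_differentiable R N (c @` (dom c `&` dom c'))).
- exact: overlap_open.
- exact: transition_smooth.
- by apply/overlapE; split.
Qed.

Lemma jac_transition c c' p i j : atlas c -> atlas c' -> dom c p -> dom c' p ->
  ('J (transition c c') (c p)) i j = partial i (fun y => transition c c' y 0 j) (c p).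
Proof.
move=> ac ac' cp cp'; apply: jacobianE => k.
apply: transition_differentiable => //; first exact: cod_coord.
by rewrite coordK.
Qed.

Lemma near_transition c c' f x : cod c x -> dom c' (icoord c x) ->
  \forall y \near x, f (icoord c y) = f (icoord c' (\row_j transition c c' y 0 j)).
Proof.
move=> cx cx'.
have : \forall y \near x, (c @` (dom c `&` dom c')) y.
  by apply: open_near; [exact: overlap_open|apply/overlapE; split].
apply: filterS => y /overlapE [cy cy'].
by rewrite -transition_row /transition /= coordK.
Qed.

Definition dform f c p : 'rV[R]_N := \row_i partial i (f \o icoord c) (c p).

Lemma dform_transition f c c' p : atlas c -> atlas c' -> dom c p -> dom c' p ->
  (exists V, [/\ open V, V (c' p) & smooth_on V (f \o icoord c')]) ->
  dform f c p = dform f c' p *m ('J (transition c c') (c p))^T.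
Proof.
move=> ac ac' cp cp' [V [oV Vp sf]]; apply/rowP => i; rewrite !mxE.
have tp : (\row_j transition c c' (c p) 0 j) = c' p.
  by rewrite -transition_row /transition /= coordK.
have cpd : cod c (c p) by exact: cod_coord.
have cpd' : dom c' (icoord c (c p)) by rewrite coordK.
have /partial_near -> := near_transition f cpd cpd'.
have dh : differentiable (f \o icoord c') (\row_j transition c c' (c p) 0 j).
  by rewrite tp; apply: (smooth_on_differentiable oV sf).
have dg j : derivable (fun y => transition c c' y 0 j) (c p) (e_ i).
  by apply: diff_derivable; exact: transition_differentiable.
rewrite /partial (@derive_val _ _ _ _ _ _ _ (partial_comp dh dg)).
apply: eq_bigr => j _; rewrite mxE mxE jac_transition// tp mulrC; congr (_ * _).
Qed.

Definition smooth_near f p := exists c, [/\ atlas c, dom c p &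
  exists V, [/\ open V, V (c p), V `<=` cod c & smooth_on V (f \o icoord c)]].

(** Changes of charts are smooth, so one chart around each point suffices. This serves for functions
    defined by cases, such as bumps, for which the convenient chart depends on the point. *)
Lemma smooth_fun_near f : (forall p, smooth_near f p) -> smooth_fun f.
Proof.
move=> fn c' ac'; apply: smooth_on_local => x c'x.
have [c [ac cp [V [oV Vp Vc sf]]]] := fn (icoord c' x).
pose U := [set y | (c' @` (dom c' `&` dom c)) y /\ V (transition c' c y)].
have oU : open U.
  rewrite openE => y [/overlapE [cy cy'] Vy].
  have n1 : \forall z \near y, (c' @` (dom c' `&` dom c)) z.
    by apply: open_near; [exact: overlap_open|apply/overlapE; split].
  have n2 : \forall z \near y, V (transition c' c z).
    by apply: (transition_continuous cy cy'); exact: open_nbhs_nbhs.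
  by apply: filterS2 n1 n2 => z; split.
exists U; split; first by split=> //; apply/overlapE.
have tU : U `<=` c' @` (dom c' `&` dom c) by move=> y [].
have H : smooth_on U (fun y => (f \o icoord c) (\row_j transition c' c y 0 j)).
  apply: (smooth_on_comp oU oV sf).
    by move=> j; apply: (smooth_on_sub tU); exact: transition_smooth.
  by move=> y [_]; rewrite -transition_row.
apply: (smooth_on_ext oU _ H) => y [/overlapE [cy cy'] _].
by rewrite -transition_row /transition /= coordK.
Qed.

Lemma smooth_fun_nearP f p : smooth_fun f -> smooth_near f p.
Proof.
move=> sf; exists (chart_at p); split; [exact: chart_at_atlas|exact: chart_at_dom|].
exists (cod (chart_at p)); split.
- exact: cod_open.
- by apply: cod_coord; exact: chart_at_dom.
- by [].
- by apply: sf; exact: chart_at_atlas.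
Qed.

Lemma smooth_near_continuous f p : smooth_near f p -> {for p, continuous f}.
Proof.
move=> [c [ac cp [V [oV Vp Vc sf]]]].
apply: (@continuous_near _ _ _ ((f \o icoord c) \o c)).
  have : \forall q \near p, dom c q by apply: open_nbhs_nbhs; split => //; exact: open_dom.
  by apply: filterS => q cq; rewrite /= coordK.
apply: continuous_comp; first exact: chart_continuous.
exact: (smooth_on_continuous sf Vp).
Qed.

Lemma smooth_fun_continuous f : smooth_fun f -> continuous f.
Proof. by move=> sf p; apply: smooth_near_continuous; exact: smooth_fun_nearP. Qed.

Lemma smooth_fun_cst (a : R) : smooth_fun (fun _ : M => a).
Proof. by move=> c ac; exact: (smooth_on_cst (cod_open c) a). Qed.

Lemma smooth_funD f g : smooth_fun f -> smooth_fun g -> smooth_fun (fun p => f p + g p).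
Proof. by move=> sf sg c ac; exact: (smooth_onD (cod_open c) (sf c ac) (sg c ac)). Qed.

Lemma smooth_funM f g : smooth_fun f -> smooth_fun g -> smooth_fun (fun p => f p * g p).
Proof. by move=> sf sg c ac; exact: (smooth_onM (cod_open c) (sf c ac) (sg c ac)). Qed.

Lemma smooth_funV f : smooth_fun f -> (forall p, f p != 0) -> smooth_fun (fun p => (f p)^-1).
Proof. by move=> sf f0 c ac; exact: (smooth_onV (cod_open c) (sf c ac) (fun x _ => f0 _)). Qed.

Lemma smooth_fun_sqrt f : smooth_fun f -> (forall p, 0 < f p) ->
  smooth_fun (fun p => Num.sqrt (f p)).
Proof. by move=> sf f0 c ac; exact: (smooth_on_sqrt (cod_open c) (sf c ac) (fun x _ => f0 _)). Qed.

(** In coordinates, the product of [flat 0] at the signed distances to the faces of a small closed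
    cube. The image of the cube is compact, hence closed as M is Hausdorff, so the extension by 0 is
    smooth across its boundary and beyond the chart. *)
Lemma bump_function c p (V : set M) : atlas c -> dom c p -> open V -> V p ->
  exists b : M -> R, exists S : set M, [/\ smooth_fun b, forall q, 0 <= b q, 0 < b p &
    [/\ compact S, S `<=` dom c `&` V & forall q, ~ S q -> b q = 0]].
Proof.
move=> ac cp oV Vp.
pose W := [set x | cod c x /\ V (icoord c x)].
have oW : open W by exact: preimage_icoord_open.
have Wp : W (c p) by split; [exact: cod_coord|rewrite coordK].
have /nbhs_ballP [r /= r0 rW] : nbhs (c p) W by exact: open_nbhs_nbhs.
pose s := r / 2; have s0 : 0 < s by rewrite divr_gt0.
have KW : ccube (c p) s `<=` W.
  move=> y yK; apply: rW; rewrite -ball_normE /=.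
  apply: (@le_lt_trans _ _ s); last by rewrite /s ltr_pdivrMr// ltr_pMr// ltr1n.
  by apply: norm_coord => [|i]; [exact: ltW|rewrite !mxE distrC].
pose S := icoord c @` ccube (c p) s.
have cS : compact S.
  apply: continuous_compact; last exact: compact_ccube.
  apply: continuous_in_subspaceT => x /set_mem /KW [cx _].
  exact: icoord_continuous.
have clS : closed S by apply: compact_closed cS; exact: hausdorff_carrier.
have SV : S `<=` dom c `&` V.
  by move=> q [x /KW [cx Vx] <-]; split=> //; exact: dom_icoord.
pose h x := \prod_(i < N) (flat 0 (s + (x 0 i - c p 0 i)) * flat 0 (s + - (x 0 i - c p 0 i))) : R.
have sh : smooth_on (cod c) h.
  have oc := cod_open c.
  have s1 i : smooth_on (cod c) (fun x => x 0 i - c p 0 i).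
    exact: (smooth_onD oc (smooth_on_coord oc i) (smooth_on_cst oc (- c p 0 i))).
  apply: (smooth_on_prod oc) => i _; apply: (smooth_onM oc); apply: (smooth_on_flat oc).
    exact: (smooth_onD oc (smooth_on_cst oc s) (s1 i)).
  exact: (smooth_onD oc (smooth_on_cst oc s) (smooth_onN oc (s1 i))).
have h0 x : ~ ccube (c p) s x -> h x = 0.
  move=> /existsNP [i /negP]; rewrite -ltNge => xi.
  rewrite /h (bigD1 i) //=.
  suff -> : flat 0 (s + (x 0 i - c p 0 i)) * flat 0 (s + - (x 0 i - c p 0 i)) = 0 by rewrite mul0r.
  move: xi; rewrite lter_normr => /orP[] xi.
    by rewrite [X in _ * X]flat0 ?mulr0// subr_le0 ltW.
  by rewrite flat0 ?mul0r//; move: xi; lra.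
(* Membership in [S] is tested because [c q] has no meaning for [q] outside [dom c], where it might
   fall into the cube. *)
pose b q := if `[< S q >] then h (c q) else 0.
have bout q : ~ S q -> b q = 0 by move=> Sq; rewrite /b asboolF.
have bin q : dom c q -> b q = h (c q).
  move=> cq; rewrite /b; case: asboolP => // nSq; apply/esym/h0 => Kq.
  by apply: nSq; exists (c q) => //; rewrite coordK.
exists b, S; split; last by split.
- apply: smooth_fun_near => q; have [cq|ncq] := pselect (dom c q).
    exists c; split=> //; exists (cod c); split; first exact: cod_open.
    - exact: cod_coord.
    - by [].
    apply: (smooth_on_ext (cod_open c) _ sh) => x cx.
    by rewrite /= bin ?icoordK//; exact: dom_icoord.
  pose c' := chart_at q; have ac' := chart_at_atlas q; have c'q := chart_at_dom q.
  pose V' := [set x | cod c' x /\ (~` S) (icoord c' x)].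
  have oV' : open V' by apply: preimage_icoord_open; exact: closed_openC.
  exists c'; split=> //; exists V'; split; first exact: oV'.
  + by split; [exact: cod_coord|rewrite coordK// => /SV []].
  + by move=> x [].
  + apply: (smooth_on_ext oV' _ (smooth_on_cst oV' 0)) => x [_ Sx].
    by rewrite /= bout.
- move=> q; rewrite /b; case: asboolP => // _.
  by apply: prodr_ge0 => i _; apply: mulr_ge0; exact: flat_ge0.
- rewrite bin//; apply: prodr_gt0 => i _.
  by rewrite subrr oppr0 addr0 mulr_gt0// flat_gt0.
Qed.

End charts.

Arguments cod_open {R N M} c.

(** * The metric and gradients on the manifold *)

Section riemannian.
Context {R : realType} {N : nat} {M : riemannianManifold R N}.
Implicit Types (c : chart R N M) (p : M) (x : 'rV[R]_N) (f : M -> R).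

Lemma metric_posdef c x : atlas c -> cod c x -> posdef (metric c x).
Proof. by move=> ac cx v v0; exact: metric_pos. Qed.

Lemma metric_unit c x : atlas c -> cod c x -> metric c x \in unitmx.
Proof.
move=> ac cx; have []// := posdef_unit (Defs.metric_sym ac cx) (metric_posdef ac cx).
Qed.

Lemma metric_transition_at c c' p : atlas c -> atlas c' -> dom c p -> dom c' p ->
  metric c (c p) = 'J (transition c c') (c p) *m metric c' (c' p)
                 *m ('J (transition c c') (c p))^T.
Proof.
move=> ac ac' cp cp'; rewrite {1}(@metric_transition _ _ _ c c')//; last by exists p.
by rewrite [in metric c' _]/transition /= coordK.
Qed.

Lemma jac_unit c c' p : atlas c -> atlas c' -> dom c p -> dom c' p ->
  'J (transition c c') (c p) \in unitmx.
Proof.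
move=> ac ac' cp cp'; have := metric_unit ac (cod_coord cp).
by rewrite (metric_transition_at ac ac' cp cp') -mulmxA unitmx_mul => /andP[].
Qed.

Definition innerc c (X Y : vfield M) p : R :=
  (X c p *m metric c (c p) *m (Y c p)^T) 0 0.

Lemma inner_chart (X Y : vfield M) c p : atlas c -> dom c p -> inner X Y p = innerc c X Y p.
Proof.
move=> ac cp; have ac' := chart_at_atlas p; have cp' := chart_at_dom p.
rewrite /inner /inner_at /innerc (metric_transition_at ac ac' cp cp').
rewrite (vcomp_transition X ac ac' cp cp') (vcomp_transition Y ac ac' cp cp').
by rewrite trmx_mul !mulmxA.
Qed.

Lemma inner_ge0 (X : vfield M) p : 0 <= inner X X p.
Proof.
rewrite /inner /inner_at; set v := X _ _; have [->|v0] := eqVneq v 0.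
  by rewrite mul0mx mul0mx mxE.
apply/ltW/metric_pos => //; first exact: chart_at_atlas.
by apply: cod_coord; exact: chart_at_dom.
Qed.

Lemma innerC (X Y : vfield M) p : inner X Y p = inner Y X p.
Proof.
rewrite /inner /inner_at; set v := X _ _; set w := Y _ _.
have -> (A : 'M[R]_1) : A 0 0 = A^T 0 0 by rewrite mxE.
rewrite !trmx_mul trmxK mulmxA Defs.metric_sym//; first exact: chart_at_atlas.
by apply: cod_coord; exact: chart_at_dom.
Qed.

Section gradient.
Variables (f : M -> R) (sf : smooth_fun f).

(** The metric transforms by the Jacobian on both sides; once the invertible metric and transposed
    Jacobian are cancelled, the claim is the chain rule for the differential of [f]. *)
Lemma grad_transition c c' p : atlas c -> atlas c' -> dom c p -> dom c' p ->
  lgrad (metric c') (f \o icoord c') (c' p) =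
  lgrad (metric c) (f \o icoord c) (c p) *m 'J (transition c c') (c p).
Proof.
move=> ac ac' cp cp'; have uJ := jac_unit ac ac' cp cp'.
have ug := metric_unit ac (cod_coord cp); have ug' := metric_unit ac' (cod_coord cp').
have gt := metric_transition_at ac ac' cp cp'.
have dt : dform f c p = dform f c' p *m ('J (transition c c') (c p))^T.
  apply: dform_transition => //; exists (cod c'); split; [exact: cod_open|exact: cod_coord|].
  exact: sf.
rewrite /lgrad -/(dform f c' p) -/(dform f c p).
have H : dform f c p *m invmx (metric c (c p)) *m metric c (c p) = dform f c p.
  by rewrite mulmxKV.
have uJT : ('J (transition c c') (c p))^T \in unitmx by rewrite unitmx_tr.
apply: (can_inj (mulmxK ug')); rewrite mulmxKV//.
apply: (can_inj (mulmxK uJT)); rewrite -dt -[LHS]H gt -!mulmxA.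
by rewrite !mulmxA.
Qed.

Definition gradf : vfield M :=
  @VField R N M (fun c p => lgrad (metric c) (f \o icoord c) (c p)) grad_transition.

Lemma inner_gradf (X : vfield M) c p : atlas c -> dom c p ->
  inner gradf X p = \sum_k partial k (f \o icoord c) (c p) * X c p 0 k.
Proof.
move=> ac cp; rewrite (inner_chart _ _ ac cp) /innerc /= /lgrad.
rewrite mulmxKV; last exact: metric_unit ac (cod_coord cp).
by rewrite mxE; apply: eq_bigr => k _; rewrite !mxE.
Qed.

Lemma gradf_smooth : smooth_vfield gradf.
Proof.
move=> c ac i.
have oc := cod_open c.
have H : smooth_on (cod c) (fun x => lgrad (metric c) (f \o icoord c) x 0 i).
  apply: (lgrad_smooth oc) => //.
  - by move=> k j; exact: metric_smooth.
  - by move=> x cx; exact: Defs.metric_sym.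
  - by move=> x cx; exact: metric_posdef.
  - exact: sf.
apply: (smooth_on_ext oc _ H) => x cx.
by rewrite /= icoordK.
Qed.

Lemma inner_gradf_smooth (X : vfield M) : smooth_vfield X -> smooth_fun (inner gradf X).
Proof.
move=> sX c ac; have oc := cod_open c.
have H : smooth_on (cod c) (fun x => \sum_k partial k (f \o icoord c) x * X c (icoord c x) 0 k).
  apply: (smooth_on_sum oc) => k _; apply: (smooth_onM oc); last exact: sX.
  by apply: smooth_on_partial; exact: sf.
apply: (smooth_on_ext oc _ H) => x cx.
by rewrite /= (inner_gradf X ac (dom_icoord cx)) icoordK.
Qed.

End gradient.

End riemannian.

(** * Integration on the manifold *)

(** A finite subcover is consumed one set at a time. This serves for the finiteness of the measure,
    for measurability, and in place of a partition of unity. *)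
Lemma compact_ind (X : ptopologicalType) (P : set X -> Prop) : compact [set: X] ->
  P set0 -> (forall A B, P A -> P B -> P (A `|` B)) ->
  (forall x, exists V, [/\ open V, V x & P V]) -> P setT.
Proof.
move=> cX P0 PU PV.
have /choice [V HV] := PV.
rewrite compact_cover in cX.
have [||D _ cov] := cX X setT V.
- by move=> x _; have [] := HV x.
- by move=> x _; exists x => //; have [] := HV x.
have -> : [set: X] = \big[setU/set0]_(i <- D) V i.
  by apply/seteqP; split=> // x /cov; rewrite coverE -bigcup_fset.
by elim/big_ind: _ => // x _; have [] := HV x.
Qed.

Lemma open_lt (R : realType) (T : topologicalType) (f : T -> R) (O : set T) a : open O ->
  (forall x, O x -> {for x, continuous f}) -> open [set x | O x /\ a < f x].
Proof.
move=> oO cf; rewrite openE => x [Ox afx].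
have n1 : \forall y \near x, O y by exact: open_nbhs_nbhs.
have n2 : \forall y \near x, a < f y.
  have /cvgrPdist_lt/(_ (f x - a)) := cf _ Ox; rewrite subr_gt0 => /(_ afx).
  by apply: filterS => z; rewrite ltr_norml => /andP[_]; lra.
by apply: filterS2 n1 n2.
Qed.

Lemma open_ltT (R : realType) (T : topologicalType) (f : T -> R) a : continuous f ->
  open [set x | a < f x].
Proof.
move=> cf; rewrite (_ : [set x | _] = [set x | setT x /\ a < f x]).
  by apply: open_lt => [|x _]; [exact: openT|exact: cf].
by apply/seteqP; split=> [x /= ?|x []].
Qed.

Section chart_integral.
Context {R : realType} {N : nat} {M : riemannianManifold R N}.
Variable mu : {measure set (borel M) -> \bar R}.
Hypothesis mu_riem : is_riemannian_measure mu.
Implicit Types (c : chart R N M) (p : M) (x : 'rV[R]_N).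
Notation lint := (@lebesgue_int R N).

(** The integrand in coordinates with the density of the measure, cut off where [icoord c] has no
    meaning. *)
Definition pullback c (f : M -> \bar R) (x : 'rV[R]_N) : \bar R :=
  if `[< cod c x >] then (f (icoord c x) * (sqrt_det c x)%:E)%E else 0%E.

Lemma measurable_openM (V : set M) : open V -> measurable (V : set (borel M)).
Proof. exact: sub_sigma_algebra. Qed.

Lemma continuous_measurableM (f : M -> R) : continuous f ->
  measurable_fun [set: borel M] (f : borel M -> R).
Proof. by move=> cf; apply: measurable_continuous; [exact: openT|move=> x _; exact: cf]. Qed.

Lemma measurable_icoord c : measurable_fun (cod c : set (brV R N)) (icoord c : brV R N -> borel M).
Proof.
apply: (@measurability _ _ (brV R N) (borel M) _ _ (@open M)) => // _ [V oV <-].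
exact: (measurable_open (@preimage_icoord_open _ _ _ c V oV)).
Qed.

Lemma sqrt_det_ge0 c x : 0 <= sqrt_det c x.
Proof. exact: sqrtr_ge0. Qed.

Lemma sqrt_det_smooth c : atlas c -> smooth_on (cod c) (sqrt_det c).
Proof.
move=> ac; apply: (sqrtdet_smooth (cod_open c)).
- by move=> i j; exact: metric_smooth.
- by move=> x cx; exact: Defs.metric_sym.
- by move=> x cx; exact: metric_posdef.
Qed.

Lemma sqrt_det_gt0 c x : atlas c -> cod c x -> 0 < sqrt_det c x.
Proof.
move=> ac cx; rewrite sqrtr_gt0.
by have [] := posdef_unit (Defs.metric_sym ac cx) (metric_posdef ac cx).
Qed.

Lemma pullback_mnn c (f : borel M -> \bar R) : atlas c -> mnn f -> mnn (pullback c f : brV R N -> \bar R).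
Proof.
move=> ac [mf f0]; split; last first.
  move=> x; rewrite /pullback; case: asboolP => // cx.
  by apply: mule_ge0 => //; rewrite lee_fin sqrt_det_ge0.
have mC : measurable (cod c : set (brV R N)) by apply: measurable_open; exact: cod_open.
rewrite (_ : pullback c f = (fun x => f (icoord c x) * (sqrt_det c x)%:E)%E \_ (cod c)); last first.
  apply/funext => x; rewrite /pullback patchE; case: asboolP => cx.
    by rewrite mem_set.
  by case: ifPn => // /set_mem.
apply/(measurable_restrictT _ mC); apply: emeasurable_funM.
  apply: (@measurable_comp _ _ _ (brV R N) (borel M) _ setT) => //.
  exact: measurable_icoord.
apply/measurable_EFinP; apply: (@measurable_continuous R 'rV[R]_N); first exact: cod_open.
by move=> x cx; apply: (smooth_on_continuous (sqrt_det_smooth ac) cx).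
Qed.

(** On indicators this is the defining property of [mu]; [integral_rep] extends it to nonnegative
    functions. *)
Lemma chart_integral c (f : borel M -> \bar R) : atlas c -> mnn f ->
  (forall p, ~ dom c p -> f p = 0%E) ->
  (\int[mu]_p f p = \int[@leb R N]_x pullback c f x)%E.
Proof.
move=> ac mf f0.
have mD : measurable (dom c : set (borel M)) by apply: measurable_openM; exact: open_dom.
rewrite -lintE; last exact: pullback_mnn.
rewrite (@integral_rep R _ (borel M) mu (dom c) (fun f => lint (pullback c f)) mD)//.
- rewrite [RHS]integral_mkcond; apply: eq_integral => p _.
  by rewrite patchE; case: ifPn => // /negP pc; apply: f0 => cp; apply: pc; exact: mem_set.
- move=> A mA; rewrite (mu_riem ac); [|exact: measurableI|by move=> p []].
  congr lint; apply/funext => x; rewrite /pullback; case: asboolP => cx.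
    rewrite EFinM; congr (_%:E * _)%E.
    rewrite !indicE; congr (_%:R); congr nat_of_bool; apply/idP/idP => /set_mem H; apply/mem_set.
      by exists (icoord c x); [split=> //; exact: dom_icoord|exact: icoordK].
    by case: H => p [Ap cp] <-; rewrite coordK.
  rewrite indicE memNset ?mul0r// => -[p [_ cp] px]; apply: cx.
  by rewrite -px; exact: cod_coord.
- move=> g h mg mh; rewrite -lintD; [|exact: pullback_mnn..].
  congr lint; apply/funext => x; rewrite /pullback; case: asboolP => cx; last by rewrite adde0.
  by rewrite ge0_muleDl//; [exact: mg.2|exact: mh.2].
- move=> k g k0 mg; rewrite -lintZ//; last exact: pullback_mnn.
  congr lint; apply/funext => x; rewrite /pullback; case: asboolP => cx; last by rewrite mule0.
  by rewrite muleA.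
- move=> g mg ndg.
  rewrite -(@lint_lim R N (fun k => pullback c (g k))).
  + congr lint; apply/funext => x; rewrite /pullback; case: asboolP => cx; last first.
      by apply/esym/cvg_lim => //; exact: cvg_cst.
    by rewrite limeMr//; exact: ereal_nondecreasing_is_cvgn.
  + by move=> k; exact: pullback_mnn.
  + move=> x k l kl; rewrite /pullback; case: asboolP => // cx.
    by apply: lee_wpmul2r; [rewrite lee_fin sqrt_det_ge0|exact: ndg].
Qed.

Lemma chart_Rintegral c (f : M -> R) : atlas c ->
  measurable_fun [set: borel M] (f : borel M -> R) ->
  (forall p, ~ dom c p -> f p = 0) ->
  \int[mu]_p f p =
  \int[@leb R N]_x (if `[< cod c x >] then f (icoord c x) * sqrt_det c x else 0).
Proof.
move=> ac mf f0; rewrite /Rintegral; congr fine.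
have mE : measurable_fun [set: borel M] (fun p : borel M => (f p)%:E).
  exact/measurable_EFinP.
rewrite integralE [RHS]integralE.
have mp : mnn ((fun p : borel M => (f p)%:E)^\+)%E.
  by split; [exact: measurable_funepos|move=> p; exact: funepos_ge0].
have mn : mnn ((fun p : borel M => (f p)%:E)^\-)%E.
  by split; [exact: measurable_funeneg|move=> p; exact: funeneg_ge0].
rewrite (chart_integral ac mp); last by move=> p cp; rewrite funeposE f0// maxxx.
rewrite (chart_integral ac mn); last by move=> p cp; rewrite funenegE f0// oppe0 maxxx.
congr (_ - _)%E; apply: eq_integral => x _; rewrite /pullback.
  rewrite !funeposE; case: asboolP => cx; last by rewrite maxxx.
  by rewrite maxeMl ?lee_fin ?sqrt_det_ge0// mul0e EFinM.
rewrite !funenegE; case: asboolP => cx; last by rewrite oppe0 maxxx.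
by rewrite maxeMl ?lee_fin ?sqrt_det_ge0// mul0e EFinM mulNe.
Qed.

(** The density is bounded above on a small cube, which gives finiteness, and stays above half its
    value at the centre on a smaller one, which gives positivity. The first is used for [mu_finite],
    the second for [Lam_eq0]. *)
Lemma small_open p (V : set M) : open V -> V p ->
  exists W : set M, [/\ open W, W p, W `<=` V, (mu W < +oo)%E & (0 < mu W)%E].
Proof.
move=> oV Vp; pose c := chart_at p; have ac := chart_at_atlas p; have cp := chart_at_dom p.
pose U := [set x | cod c x /\ V (icoord c x)].
have oU : open U by exact: preimage_icoord_open.
have Up : U (c p) by split; [exact: cod_coord|rewrite coordK].
have /nbhs_ballP [r /= r0 rU] : nbhs (c p) U by exact: open_nbhs_nbhs.
pose s := r / 2; have s0 : 0 < s by rewrite divr_gt0.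
have KU : ccube (c p) s `<=` U.
  move=> y yK; apply: rU; rewrite -ball_normE /=.
  apply: (@le_lt_trans _ _ s); last by rewrite /s ltr_pdivrMr// ltr_pMr// ltr1n.
  by apply: norm_coord => [|i]; [exact: ltW|rewrite !mxE distrC].
have sd := sqrt_det_smooth ac.
have [C C0 HC] : exists2 C, 0 <= C & forall x, ccube (c p) s x -> `|sqrt_det c x| <= C.
  apply: compact_le_bound; first exact: compact_ccube.
  by move=> x /KU [cx _]; exact: (smooth_on_continuous sd cx).
pose a := sqrt_det c (c p) / 2.
have a0 : 0 < a by rewrite divr_gt0// sqrt_det_gt0//; exact: cod_coord.
have : \forall x \near c p, a < sqrt_det c x.
  have /cvgrPdist_lt/(_ a a0) := smooth_on_continuous sd (cod_coord cp).
  by apply: filterS => z; rewrite ltr_norml /a => /andP[_]; lra.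
move=> /nbhs_ballP [d /= d0 dP].
(* Small enough both for the lower bound [a] of the density, valid within [d], and for the cube that
   defines [W]. *)
pose e := Num.min (d / 2) s.
have e0 : 0 < e by rewrite lt_min s0 divr_gt0.
pose W := [set q | dom c q /\ cube (c p) s (c q)].
have oW : open W by apply: preimage_coord_open; exact: open_cube.
have WE : c @` W = cube (c p) s.
  apply/seteqP; split=> [x [q [_ cq] <-]//|x cx].
  have /KU [cx' _] : ccube (c p) s x by move=> i; apply/ltW/cx.
  by exists (icoord c x); [split; [exact: dom_icoord|rewrite icoordK]|exact: icoordK].
have muW : mu W = lint (fun x => (\1_(cube (c p) s) x * sqrt_det c x)%:E).
  by rewrite (mu_riem ac) ?WE//; [exact: measurable_openM|move=> q []].
have mcube : measurable (cube (c p) s : set (brV R N)) by apply: measurable_open; exact: open_cube.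
have mW : mnn (fun x : brV R N => (\1_(cube (c p) s) x * sqrt_det c x)%:E).
  split; last by move=> x; rewrite lee_fin mulr_ge0// sqrt_det_ge0.
  apply/measurable_EFinP.
  rewrite (_ : (fun x => _) = (sqrt_det c) \_ (cube (c p) s)); last first.
    apply/funext => x; rewrite patchE indicE; case: ifPn => _; rewrite ?mul1r ?mul0r//.
  apply/(measurable_restrictT _ mcube).
  apply: (@measurable_continuous R 'rV[R]_N); first exact: open_cube.
  move=> x cx; apply: (smooth_on_continuous sd).
  by have /KU [] : ccube (c p) s x by move=> i; apply/ltW/cx.
have mI (b r' : R) : 0 <= b -> mnn (fun x : brV R N => b%:E * (\1_(ccube (c p) r') x)%:E)%E.
  move=> b0; split; last by move=> x; rewrite mule_ge0// lee_fin.
  apply: emeasurable_funM; first exact: measurable_cst.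
  by apply/measurable_EFinP; apply: measurable_indic; exact: measurable_ccube.
exists W; split=> //.
- by split=> // i; rewrite subrr normr0.
- move=> q [cq /= Wq]; have /KU [] : ccube (c p) s (c q) by move=> i; apply/ltW/Wq.
  by rewrite coordK.
- rewrite muW; apply: (@le_lt_trans _ _ (lint (fun x => C%:E * (\1_(ccube (c p) s) x)%:E)%E)).
    apply: lint_le => //; first exact: mI.
    move=> x; rewrite -EFinM lee_fin !indicE.
    case: (boolP (x \in cube (c p) s)) => [/set_mem xc|_].
      have xk : ccube (c p) s x by move=> i; apply/ltW/xc.
      by rewrite (mem_set xk) mul1r mulr1; apply: le_trans (HC _ xk); exact: ler_norm.
    by rewrite mul0r mulr_ge0.
  rewrite lintZ//; last by apply: mnn_indic; exact: measurable_ccube.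
  rewrite -/(leb (ccube (c p) s)) (leb_ccube (c p) (ltW s0)).
  by rewrite -EFinM ltry.
- rewrite muW; apply: (@lt_le_trans _ _ (lint (fun x => a%:E * (\1_(ccube (c p) (e / 2)) x)%:E)%E)).
    rewrite lintZ ?(ltW a0)//; last by apply: mnn_indic; exact: measurable_ccube.
    have e20 : 0 <= e / 2 by apply/ltW; rewrite divr_gt0.
    rewrite -/(leb (ccube (c p) (e / 2))) (leb_ccube (c p) e20).
    by rewrite -EFinM lte_fin mulr_gt0// exprn_gt0// mulrn_wgt0// divr_gt0.
  apply: lint_le => //; first by apply: mI; exact: ltW.
  move=> x; rewrite -EFinM lee_fin !indicE.
  case: (boolP (x \in ccube (c p) (e / 2))) => [/set_mem xc|_]; last first.
    by rewrite mulr0 mulr_ge0// sqrt_det_ge0.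
  have ee : e / 2 < e by rewrite ltr_pdivrMr// ltr_pMr// ltr1n.
  have xk : cube (c p) s x.
    move=> i; apply: (le_lt_trans (xc i)); apply: (lt_le_trans ee).
    by rewrite /e ge_min lexx orbT.
  rewrite (mem_set xk) mul1r mulr1; apply/ltW/dP; rewrite -ball_normE /=.
  apply: (@le_lt_trans _ _ (e / 2)).
    by apply: norm_coord => [|i]; [rewrite ltW// divr_gt0|rewrite !mxE distrC; exact: xc].
  apply: (lt_le_trans ee); rewrite ge_min; apply/orP; left.
  by rewrite ler_pdivrMr// ler_pMr// ler1n.
Qed.

Hypothesis M_compact : compact [set: M].

Lemma mu_finite : (mu setT < +oo)%E.
Proof.
pose P (A : set M) := measurable (A : set (borel M)) /\ (mu A < +oo)%E.
suff [] : P setT by [].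
apply: (compact_ind M_compact).
- by split; [exact: measurable0|rewrite measure0].
- move=> A B [mA fA] [mB fB]; split; first exact: measurableU.
  apply: le_lt_trans (measureU2 _ mA mB) _; exact: lte_add_pinfty.
- move=> p; have [W [oW Wp _ fW _]] := @small_open p setT openT I.
  by exists W; split=> //; split=> //; exact: measurable_openM.
Qed.

(** The vanishing argument treats the integral as a strictly positive linear functional on
    continuous functions; the next lemmas establish exactly this. *)
Definition Lam (f : M -> R) : R := \int[mu]_(p in [set: borel M]) f p.

Lemma continuous_integrable (f : M -> R) : continuous f ->
  mu.-integrable [set: borel M] (EFin \o f).
Proof.
move=> cf; have [C C0 HC] := compact_le_bound M_compact (fun (x : M) _ => cf x).
apply: measurable_bounded_integrable.
- exact: measurableT.
- exact: mu_finite.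
- exact: continuous_measurableM.
- exists C; split; first by rewrite ger0_real.
  by move=> y /ltW Cy x xK; apply: le_trans Cy; exact: HC.
Qed.

Lemma LamD (f g : M -> R) : continuous f -> continuous g ->
  Lam (fun p => f p + g p) = Lam f + Lam g.
Proof.
by move=> cf cg; apply: (RintegralD measurableT); exact: continuous_integrable.
Qed.

Lemma LamZ (a : R) (f : M -> R) : continuous f -> Lam (fun p => a * f p) = a * Lam f.
Proof. by move=> cf; apply: (RintegralZl _ measurableT); exact: continuous_integrable. Qed.

Lemma Lam_le (f g : M -> R) : continuous f -> continuous g -> (forall p, f p <= g p) ->
  Lam f <= Lam g.
Proof.
move=> cf cg fg; apply: (le_Rintegral measurableT) => //; exact: continuous_integrable.
Qed.

(** By continuity a positive value persists, up to a factor 2, on an open set, and this set contains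
    one of positive measure by [small_open]. *)
Lemma Lam_eq0 (f : M -> R) : continuous f -> (forall p, 0 <= f p) -> Lam f = 0 ->
  forall p, f p = 0.
Proof.
move=> cf f0 Lf p; apply/eqP; case: eqVneq => // fp; exfalso.
have {}fp : 0 < f p by rewrite lt_def fp f0.
pose a := f p / 2; have a0 : 0 < a by rewrite divr_gt0.
have oV : open [set q | a < f q] := open_ltT a cf.
have [|W [oW Wp WV fW pW]] := @small_open p _ oV.
  by rewrite /= /a ltr_pdivrMr// ltr_pMr// ltr1n.
have mW := measurable_openM oW.
have : a * fine (mu W) <= Lam f.
  have iI : mu.-integrable [set: borel M] (EFin \o (\1_W : borel M -> R)).
    apply/integrableP; split; first by apply/measurable_EFinP; exact: measurable_indic.
    rewrite (eq_integral (fun q : borel M => (\1_W (q : M))%:E)); last first.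
      by move=> q _; rewrite gee0_abs// lee_fin.
    by rewrite integral_indic// setIT.
  have iW : mu.-integrable [set: borel M] (EFin \o (fun q : borel M => a * \1_W q)).
    exact: (integrableZl measurableT a iI).
  have -> : a * fine (mu W) = \int[mu]_(q in [set: borel M]) (a * \1_W q).
    rewrite (RintegralZl _ measurableT)//.
    congr (_ * _); rewrite /Rintegral; congr fine.
    by rewrite (@integral_indic _ _ _ mu setT measurableT _ mW) setIT.
  apply: (le_Rintegral measurableT) => //; first exact: continuous_integrable.
  move=> q _; rewrite indicE; case: (boolP (q \in W)) => [/set_mem /WV /= /ltW|_].
    by rewrite mulr1.
  by rewrite mulr0.
rewrite Lf; apply/negP; rewrite -ltNge mulr_gt0// fine_gt0//; apply/andP; split => //.
Qed.

End chart_integral.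

(** * Chart independence of the divergence and the divergence theorem *)

Section divergence_theorem.
Context {R : realType} {N : nat} {M : riemannianManifold R N}.
Variable mu : {measure set (borel M) -> \bar R}.
Hypothesis mu_riem : is_riemannian_measure mu.
Hypothesis M_compact : compact [set: M].
Implicit Types (c : chart R N M) (p : M) (x : 'rV[R]_N) (f : M -> R) (X : vfield M).
Notation Lam := (Lam mu).

Let contI := continuous_integrable mu_riem M_compact.

Lemma LamB f g : continuous f -> continuous g -> Lam (fun p => f p - g p) = Lam f - Lam g.
Proof. by move=> cf cg; apply: (RintegralB measurableT); exact: contI. Qed.

(** The inner product of grad f with [X]. Unlike [gradf] it takes no proof of smoothness, so that
    [f] can be rewritten in it. *)
Definition dirder f X p : R :=
  \sum_k partial k (f \o icoord (chart_at p)) (chart_at p p) * X (chart_at p) p 0 k.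

Lemma dirderE f (sf : smooth_fun f) X p : inner (gradf sf) X p = dirder f X p.
Proof. by rewrite (inner_gradf sf X (chart_at_atlas p) (chart_at_dom p)). Qed.

Lemma dirder_chart f X c p : smooth_fun f -> atlas c -> dom c p ->
  dirder f X p = \sum_k partial k (f \o icoord c) (c p) * X c p 0 k.
Proof. by move=> sf ac cp; rewrite -(dirderE sf) (inner_gradf sf X ac cp). Qed.

Lemma dirder_smooth f X : smooth_fun f -> smooth_vfield X -> smooth_fun (dirder f X).
Proof.
move=> sf sX; rewrite (_ : dirder f X = inner (gradf sf) X).
  exact: inner_gradf_smooth.
by apply/funext => p; rewrite dirderE.
Qed.

Lemma dirderC f g (sf : smooth_fun f) (sg : smooth_fun g) p :
  dirder f (gradf sg) p = dirder g (gradf sf) p.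
Proof. by rewrite -!dirderE innerC. Qed.

Let at_chart p : cod (chart_at p) (chart_at p p).
Proof. by apply: cod_coord; exact: chart_at_dom. Qed.

Lemma dirderD f g X p : smooth_fun f -> smooth_fun g ->
  dirder (fun q => f q + g q) X p = dirder f X p + dirder g X p.
Proof.
move=> sf sg; rewrite /dirder -big_split /=; apply: eq_bigr => k _.
rewrite -mulrDl; congr (_ * _).
set c := chart_at p.
have H := partialD k (sf c (chart_at_atlas p)) (sg c (chart_at_atlas p)) (at_chart p).
exact: H.
Qed.

Lemma dirderM f g X p : smooth_fun f -> smooth_fun g ->
  dirder (fun q => f q * g q) X p = dirder f X p * g p + f p * dirder g X p.
Proof.
move=> sf sg; rewrite /dirder mulr_sumr mulr_suml -big_split /=; apply: eq_bigr => k _.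
set c := chart_at p.
have H := partialM k (sf c (chart_at_atlas p)) (sg c (chart_at_atlas p)) (at_chart p).
rewrite [X in X * _ = _](H : _ = _ :> R) /= coordK; last exact: chart_at_dom.
by ring.
Qed.

Lemma dirder_comp (h : R -> R) f X p : smooth_fun f -> derivable h (f p) 1 ->
  dirder (h \o f) X p = derive1 h (f p) * dirder f X p.
Proof.
move=> sf dh; rewrite /dirder mulr_sumr; apply: eq_bigr => k _.
have df := @smooth_on_derivable _ _ _ _ _ k (sf _ (chart_at_atlas p)) (at_chart p).
have fp : (f \o icoord (chart_at p)) (chart_at p p) = f p.
  by rewrite /= coordK//; exact: chart_at_dom.
rewrite -fp in dh.
rewrite mulrA; congr (_ * _); rewrite -fp.
exact: (@derive_val _ _ _ _ _ _ _ (derive1_comp_dir df dh)).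
Qed.

Lemma dirder_out f X (S : set M) p : closed S -> (forall q, ~ S q -> f q = 0) -> ~ S p ->
  dirder f X p = 0.
Proof.
move=> cS f0 Sp; rewrite /dirder big1// => k _.
rewrite (@partial_near _ _ _ (cst 0)).
  by rewrite /partial derive_cst mul0r.
pose V := [set x | cod (chart_at p) x /\ (~` S) (icoord (chart_at p) x)].
have oV : open V by apply: preimage_icoord_open; exact: closed_openC.
have : \forall y \near chart_at p p, V y.
  apply: open_near => //; split=> //; rewrite coordK//; exact: chart_at_dom.
by apply: filterS => y [_ Sy]; rewrite /= f0.
Qed.

(** [divergence] uses the distinguished chart at each point, which varies with the point without any
    regularity. With the chart fixed, smoothness can be read off. *)
Definition ldivc c X p : R := ldiv (metric c) (fun x => X c (icoord c x)) (c p).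

Lemma ldiv_smooth c (Z : 'rV[R]_N -> 'rV[R]_N) : atlas c ->
  (forall i, smooth_on (cod c) (fun x => Z x 0 i)) ->
  smooth_on (cod c) (ldiv (metric c) Z).
Proof.
move=> ac sZ; have oc := cod_open c; have sd := sqrt_det_smooth ac.
have H : smooth_on (cod c) (fun x => (sqrt_det c x)^-1 *
    \sum_i partial i (fun y => sqrt_det c y * Z y 0 i) x).
  apply: (smooth_onM oc).
    apply: (smooth_onV oc sd) => x cx; apply/lt0r_neq0; exact: sqrt_det_gt0.
  by apply: (smooth_on_sum oc) => i _; apply: smooth_on_partial; exact: (smooth_onM oc sd (sZ i)).
exact: H.
Qed.

Lemma ldivc_smooth c X : atlas c -> smooth_vfield X ->
  smooth_on (cod c) (ldivc c X \o icoord c).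
Proof.
move=> ac sX; apply: (smooth_on_ext (cod_open c) _ (ldiv_smooth ac (sX c ac))) => x cx.
by rewrite /ldivc /= icoordK.
Qed.

Lemma ldivc_continuous c X p : atlas c -> smooth_vfield X -> dom c p ->
  {for p, continuous (ldivc c X)}.
Proof.
move=> ac sX cp; apply: (@continuous_comp _ _ _ c (ldiv (metric c) (fun x => X c (icoord c x)))).
  exact: (chart_continuous cp).
exact: (smooth_on_continuous (ldiv_smooth ac (sX c ac)) (cod_coord cp)).
Qed.

Lemma supported_continuous f (S O : set M) : closed S -> S `<=` O ->
  (forall p, O p -> {for p, continuous f}) -> (forall p, ~ S p -> f p = 0) -> continuous f.
Proof.
move=> cS SO cf f0 p; have [/SO|Sp] := pselect (S p); first exact: cf.
apply: (@continuous_near _ _ _ (cst 0)); last exact: cst_continuous.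
have : \forall q \near p, (~` S) q by apply: open_nbhs_nbhs; split=> //; exact: closed_openC.
by apply: filterS => q Sq; rewrite f0.
Qed.

Lemma Rintegral_sum d (T : measurableType d) (m : {measure set T -> \bar R}) (I : Type) (r : seq I)
    (F : I -> T -> R) : (forall i, m.-integrable setT (EFin \o F i)) ->
  \int[m]_t (\sum_(i <- r) F i t) = \sum_(i <- r) \int[m]_t F i t.
Proof.
move=> iF.
suff [] : m.-integrable setT (EFin \o (fun t => \sum_(i <- r) F i t)) /\
  \int[m]_t (\sum_(i <- r) F i t) = \sum_(i <- r) \int[m]_t F i t by [].
elim: r => [|i r [IH1 IH2]].
  split.
    rewrite (_ : _ \o _ = cst 0%E); first exact: integrable0.
    by apply/funext => t; rewrite /= big_nil.
  rewrite big_nil /Rintegral [X in fine X](_ : _ = 0%E)//.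
  by apply: integral0_eq => t _; rewrite big_nil.
have E : (fun t => \sum_(j <- i :: r) F j t) = (fun t => F i t + \sum_(j <- r) F j t).
  by apply/funext => t; rewrite big_cons.
rewrite big_cons E; split; first exact: (integrableD measurableT (iF i) IH1).
by rewrite (RintegralD measurableT (iF i) IH1) IH2.
Qed.

(** In coordinates the integrand times the density is the sum of the partial derivatives of the
    compactly supported functions f X^k sqrt(det g), each of which integrates to 0. *)
Lemma chart_ibp c X f (S : set M) : atlas c -> smooth_vfield X -> smooth_fun f ->
  compact S -> S `<=` dom c -> (forall p, ~ S p -> f p = 0) ->
  continuous (fun p => f p * ldivc c X p) /\
  Lam (fun p => f p * ldivc c X p + dirder f X p) = 0.
Proof.
move=> ac sX sf cS Sc f0.
have clS : closed S by apply: compact_closed cS; exact: hausdorff_carrier.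
have c1 : continuous (fun p => f p * ldivc c X p).
  apply: (supported_continuous clS Sc) => p Sp; last by rewrite f0 ?mul0r.
  apply: (@continuousM _ _ f (ldivc c X)); first exact: smooth_fun_continuous.
  exact: ldivc_continuous.
split=> //.
have sG := dirder_smooth sf sX.
have cF : continuous (fun p => f p * ldivc c X p + dirder f X p).
  by move=> p; apply: (@continuousD _ _ _ (fun p => f p * ldivc c X p) (dirder f X));
    [exact: c1|exact: smooth_fun_continuous].
rewrite /Lam (chart_Rintegral mu_riem ac (continuous_measurableM cF)); last first.
  by move=> p cp; rewrite (dirder_out _ clS f0) ?f0 ?mul0r ?addr0// => /Sc.
have oc := cod_open c; have sd := sqrt_det_smooth ac.
pose V k x := sqrt_det c x * X c (icoord c x) 0 k.
have sV k : smooth_on (cod c) (V k) := smooth_onM oc sd (sX c ac k).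
have sfc : smooth_on (cod c) (f \o icoord c) := sf c ac.
(* The extension by 0 is smooth on all of R^n because the image of [S] in the chart is compact,
   hence closed, and lies in [cod c]. *)
pose W k x := if `[< cod c x >] then f (icoord c x) * V k x else 0.
have Win k x : cod c x -> W k x = f (icoord c x) * V k x by move=> cx; rewrite /W asboolT.
have S'c : c @` S `<=` cod c by move=> x [p /Sc cp <-]; exact: cod_coord.
have clS' : closed (c @` S).
  apply: compact_closed; first exact: norm_hausdorff.
  apply: continuous_compact cS; apply: continuous_in_subspaceT => p /set_mem /Sc cp.
  exact: (chart_continuous cp).
have Wout k x : ~ (c @` S) x -> W k x = 0.
  rewrite /W; case: asboolP => // cx Sx; rewrite f0 ?mul0r// => Sx'.
  by apply: Sx; exists (icoord c x) => //; exact: icoordK.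
have oV' := closed_openC clS'.
have sW k : smooth_on setT (W k).
  apply: smooth_on_local => x _; have [cx|cx] := pselect (cod c x).
    exists (cod c); split=> //.
    apply: (smooth_on_ext oc _ (smooth_onM oc sfc (sV k))) => y cy.
    by rewrite Win.
  exists (~` (c @` S)); split; first by move/S'c.
  by apply: (smooth_on_ext oV' _ (smooth_on_cst oV' 0)) => y Sy; rewrite Wout.
have [C C0 HC] : exists2 C, 0 <= C & forall p, S p -> `| `|c p| | <= C.
  apply: (@compact_le_bound _ _ (fun p => `|c p|) S cS) => p /Sc cp.
  apply: (@continuous_comp _ _ _ c (fun x : 'rV[R]_N => `|x|)); first exact: (chart_continuous cp).
  exact: norm_continuous.
have K0 : 0 < C + 1 by rewrite ltr_wpDl.
have WK k x : ~ ccube 0 (C + 1) x -> W k x = 0.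
  move=> xK; apply: Wout => -[p Sp px]; apply: xK => i; rewrite mxE subr0.
  apply: le_trans (coord_norm x i) _; rewrite -px.
  by apply: le_trans (ler_norm _) _; apply: le_trans (HC _ Sp) _; rewrite lerDl.
have pW k : smooth_on setT (partial k (W k)) := smooth_on_partial k (sW k).
have cpW k : continuous (partial k (W k)).
  by move=> x; exact: (smooth_on_continuous (pW k) (I : setT x)).
have E x : (if `[< cod c x >] then
    (f (icoord c x) * ldivc c X (icoord c x) + dirder f X (icoord c x)) * sqrt_det c x else 0)
    = \sum_k partial k (W k) x.
  case: asboolP => cx; last first.
    rewrite big1// => k _; rewrite (@partial_eq_on _ _ (~` (c @` S)) _ (cst 0))//.
    - by rewrite /partial derive_cst.
    - exact: Wout.
    - by move/S'c.
  have H k : partial k (W k) x = partial k (f \o icoord c) x * V k x + f (icoord c x) * partial k (V k) x.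
    have -> := partial_eq_on k oc (Win k) cx.
    exact: (partialM k sfc (sV k) cx).
  rewrite (eq_bigr _ (fun k _ => H k)) big_split /= -mulr_sumr.
  rewrite (dirder_chart X sf ac (dom_icoord cx)) icoordK//.
  rewrite [RHS]addrC mulrDl mulr_suml; congr (_ + _); last first.
    by apply: eq_bigr => k _; rewrite /V; ring.
  rewrite -mulrA; congr (_ * _); rewrite /ldivc icoordK// /ldiv -/(sqrt_det c x).
  rewrite mulrAC mulVf ?mul1r//; apply/lt0r_neq0; exact: sqrt_det_gt0.
rewrite [X in Rintegral _ _ X](_ : _ = (fun x : brV R N => \sum_k partial k (W k) x)); last first.
  by apply/funext => x; exact: E.
rewrite (@Rintegral_sum _ (brV R N) (@leb R N) _ _ (fun k x => partial k (W k) x)); last first.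
  move=> k; apply: (csupp_integrable (ltW K0) (cpW k)) => x xK.
  rewrite (@partial_eq_on _ _ (~` ccube 0 (C + 1)) _ (cst 0))//.
  - by rewrite /partial derive_cst.
  - by apply: closed_openC; exact: closed_ccube.
  - exact: WK.
rewrite big1// => k _; apply: (integral_partial0 K0) => //.
- by move=> x; exact: (smooth_on_continuous (sW k) (I : setT x)).
- by move=> x; exact: (@smooth_on_derivable _ _ _ _ _ k (sW k) (I : setT x)).
- exact: WK.
Qed.

(* Both expressions of the divergence integrate in the same way against bumps
   supported in the overlap. *)
Lemma ldivc_indep c c' X p : atlas c -> atlas c' -> dom c p -> dom c' p ->
  smooth_vfield X -> ldivc c X p = ldivc c' X p.
Proof.
move=> ac ac' cp cp' sX; pose D q := ldivc c X q - ldivc c' X q.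
apply/eqP; rewrite -subr_eq0 -/(D p); apply: contraT => Dp.
have cD q : dom c q -> dom c' q -> {for q, continuous D}.
  move=> cq cq'; apply: (@continuousB _ _ _ (ldivc c X) (ldivc c' X)); exact: ldivc_continuous.
have cDp q : dom c q -> dom c' q -> {for q, continuous (fun q => D q * D p)}.
  move=> cq cq'; apply: (@continuousM _ _ D (cst (D p))); first exact: cD.
  exact: cst_continuous.
(* The factor [D p] makes the difference positive near [p], whatever its sign there. *)
pose V := [set q | (dom c q /\ dom c' q) /\ 0 < D q * D p].
have oV : open V.
  apply: (open_lt 0 (f := fun q => D q * D p) (O := [set q | dom c q /\ dom c' q])).
    by apply: openI; exact: open_dom.
  by move=> q [cq cq']; exact: cDp.
have Vp : V p by split=> //; rewrite -expr2 exprn_even_gt0.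
have [b [S [sb b0 bp [cS SV bS]]]] := bump_function ac cp oV Vp.
have Sc : S `<=` dom c by move=> q /SV [].
have Sc' : S `<=` dom c' by move=> q /SV [_ [[_ cq'] _]].
have [k1 e1] := chart_ibp ac sX sb cS Sc bS.
have [k2 e2] := chart_ibp ac' sX sb cS Sc' bS.
have kG := smooth_fun_continuous (dirder_smooth sb sX).
rewrite (LamD mu_riem M_compact k1 kG) in e1; rewrite (LamD mu_riem M_compact k2 kG) in e2.
have e3 : Lam (fun q => b q * ldivc c X q - b q * ldivc c' X q) = 0.
  by rewrite (LamB k1 k2) (addIr _ (etrans e1 (esym e2))) subrr.
have k3 : continuous (fun q => b q * ldivc c X q - b q * ldivc c' X q).
  by move=> q; exact: (continuousB (k1 q) (k2 q)).
have k4 : continuous (fun q => D p * (b q * ldivc c X q - b q * ldivc c' X q)).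
  by move=> q; exact: (continuousM (@cst_continuous _ _ (D p) q) (k3 q)).
have e4 : Lam (fun q => D p * (b q * ldivc c X q - b q * ldivc c' X q)) = 0.
  by rewrite (LamZ mu_riem M_compact _ k3) e3 mulr0.
have EE q : D p * (b q * ldivc c X q - b q * ldivc c' X q) = b q * (D q * D p).
  by rewrite /D; ring.
have := Lam_eq0 mu_riem M_compact k4 _ e4 p.
move=> H; have : D p * (b p * ldivc c X p - b p * ldivc c' X p) = 0.
  apply: H => q; rewrite EE; have [/SV [_ [_ /ltW Dq]]|Sq] := pselect (S q).
    exact: mulr_ge0.
  by rewrite bS// mul0r.
rewrite EE => /eqP; rewrite !mulf_eq0 (negbTE Dp) !orbF => /eqP bp0.
by rewrite bp0 ltxx in bp.
Qed.

Lemma divergence_chart c X p : atlas c -> dom c p -> smooth_vfield X ->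
  divergence X p = ldivc c X p.
Proof.
move=> ac cp sX.
by rewrite -(ldivc_indep (chart_at_atlas p) ac (chart_at_dom p) cp sX).
Qed.

Lemma divergence_smooth X : smooth_vfield X -> smooth_fun (divergence X).
Proof.
move=> sX c ac; apply: (smooth_on_ext (cod_open c) _ (ldivc_smooth ac sX)) => x cx.
by rewrite /= (divergence_chart ac (dom_icoord cx) sX).
Qed.

(** In place of a partition of unity, a finite sum of bumps gives a smooth weight [b > 0] such that
    the identity, linear in the function, holds for every product [g * b]. Then [g = f / b] gives it
    for [f]. *)
Theorem divergence_theorem X f : smooth_vfield X -> smooth_fun f ->
  Lam (fun p => f p * divergence X p) = - Lam (dirder f X).
Proof.
move=> sX.
pose E f := Lam (fun p => f p * divergence X p + dirder f X p).
have k1 g : smooth_fun g -> continuous (fun p => g p * divergence X p).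
  by move=> sg; exact: (smooth_fun_continuous (smooth_funM sg (divergence_smooth sX))).
have k2 g : smooth_fun g -> continuous (dirder g X).
  by move=> sg; exact: (smooth_fun_continuous (dirder_smooth sg sX)).
have k3 g : smooth_fun g -> continuous (fun p => g p * divergence X p + dirder g X p).
  by move=> sg p; exact: (continuousD (k1 g sg p) (k2 g sg p)).
have ED g h : smooth_fun g -> smooth_fun h -> E (fun p => g p + h p) = E g + E h.
  move=> sg sh; rewrite /E -(LamD mu_riem M_compact (k3 _ sg) (k3 _ sh)).
  by congr Lam; apply/funext => p; rewrite dirderD//; ring.
pose P (A : set M) := exists2 b : M -> R,
  [/\ smooth_fun b, forall p, 0 <= b p & forall p, A p -> 0 < b p] &
  forall g, smooth_fun g -> E (fun p => g p * b p) = 0.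
suff [b [sb b0 bp] Eb] : P setT.
  move=> sf; apply/eqP; rewrite -addr_eq0.
  rewrite -(LamD mu_riem M_compact (k1 _ sf) (k2 _ sf)) -/(E f).
  have bn p : b p != 0 by apply/lt0r_neq0; exact: bp.
  have := Eb _ (smooth_funM sf (smooth_funV sb bn)).
  rewrite (_ : (fun p => f p * (b p)^-1 * b p) = f) => [->//|].
  by apply/funext => p; rewrite mulfVK.
apply: (compact_ind M_compact).
- exists (fun=> 0); first by split=> [|p|p []]; [exact: smooth_fun_cst|].
  move=> g sg; rewrite (_ : (fun p => g p * 0) = cst 0); last by apply/funext => p; rewrite mulr0.
  have s0 : smooth_fun (cst 0 : M -> R) := @smooth_fun_cst R N M 0.
  have := ED _ _ s0 s0; rewrite (_ : (fun p => _ + _) = cst 0); last by apply/funext => p; rewrite addr0.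
  by move=> H; apply: (addrI (E (cst 0))); rewrite -H addr0.
- move=> A B [b [sb b0 bp] Eb] [b' [sb' b0' bp'] Eb'].
  exists (fun p => b p + b' p).
    split=> [|p|p [/bp|/bp']]; first exact: smooth_funD.
    + exact: addr_ge0.
    + by move=> H; rewrite ltr_wpDr.
    + by move=> H; rewrite ltr_wpDl.
  move=> g sg; rewrite (_ : (fun p => _) = (fun p => g p * b p + g p * b' p)).
    by rewrite (ED _ _ (smooth_funM sg sb) (smooth_funM sg sb')) (Eb _ sg) (Eb' _ sg) addr0.
  by apply/funext => p; rewrite mulrDr.
- move=> p; have ac := chart_at_atlas p; have cp := chart_at_dom p.
  have [b [S [sb b0 bp [cS SV bS]]]] := bump_function ac cp openT (I : setT p).
  exists [set q | 0 < b q]; split=> //.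
    exact: (open_ltT 0 (smooth_fun_continuous sb)).
  exists b => // g sg.
  have Sc : S `<=` dom (chart_at p) by move=> q /SV [].
  have gS q : ~ S q -> g q * b q = 0 by move=> Sq; rewrite bS// mulr0.
  have [_ H] := chart_ibp ac sX (smooth_funM sg sb) cS Sc gS.
  rewrite /E -[RHS]H; congr Lam; apply/funext => q.
  have [/Sc cq|Sq] := pselect (S q); last by rewrite gS// !mul0r.
  by rewrite (divergence_chart ac cq sX).
Qed.

End divergence_theorem.

(** * First and second variations *)

Section continuity_rules.
Context {R : realType} {T : topologicalType}.
Implicit Types f g : T -> R.

Lemma contD f g : continuous f -> continuous g -> continuous (fun x => f x + g x).
Proof. by move=> cf cg x; exact: (@continuousD R _ T f g x (cf x) (cg x)). Qed.

Lemma contN f : continuous f -> continuous (fun x => - f x).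
Proof. by move=> cf x; exact: (@continuousN R _ T f x (cf x)). Qed.

Lemma contB f g : continuous f -> continuous g -> continuous (fun x => f x - g x).
Proof. by move=> cf cg; exact: (contD cf (contN cg)). Qed.

Lemma contM f g : continuous f -> continuous g -> continuous (fun x => f x * g x).
Proof. by move=> cf cg x; exact: (@continuousM R T f g x (cf x) (cg x)). Qed.

Lemma contZ a f : continuous f -> continuous (fun x => a * f x).
Proof. by move=> cf; apply: (@contM (cst a)) => // x; exact: cst_continuous. Qed.

Lemma cont_sqr f : continuous f -> continuous (fun x => f x ^+ 2).
Proof.
move=> cf; rewrite (_ : (fun x => _) = (fun x => f x * f x)); first exact: contM.
by apply/funext => x; rewrite expr2.
Qed.

Lemma cont_comp (h : R -> R) f : continuous h -> continuous f -> continuous (fun x => h (f x)).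
Proof. by move=> ch cf x; apply: (@continuous_comp _ _ _ f h); [exact: cf|exact: ch]. Qed.

End continuity_rules.
Arguments contZ {R T} a {f}.

(** * Second-order expansions and minima *)

Section taylor.
Context {R : realType}.

(** The mean value theorem is applied to the remainder [G], then to the derivative of [F]. The
    factor 1/2 lost against the sharp bound is harmless. *)
Lemma taylor2_le (F : R -> R) x h om : C2 F ->
  (forall s, `|s| <= `|h| -> `|derive1n 2 F (x + s) - derive1n 2 F x| <= om) ->
  `|F (x + h) - F x - h * derive1 F x - h ^+ 2 / 2 * derive1n 2 F x| <= om * h ^+ 2.
Proof.
move=> [dF dF' _] Hom; rewrite /= in Hom *.
pose G (s : R) := F (x + s) - F x - s * derive1 F x - s ^+ 2 / 2 * derive1 (derive1 F) x.
have dG (s : R) : is_derive s 1 G (derive1 F (x + s) - derive1 F x - s * derive1 (derive1 F) x).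
  have h1 : is_derive s 1 (fun s : R => F (x + s)) (derive1 F (x + s)).
    have := @is_derive_line R R F x 1 s; rewrite derive1E.
    have -> : (fun t : R => F (x + t *: 1)) = (fun s : R => F (x + s)).
      by apply/funext => t; rewrite [_ *: _]mulr1.
    by rewrite [s *: _]mulr1; apply; exact: dF.
  have h2 : is_derive s 1 (fun s : R => s * derive1 F x) (1 * derive1 F x).
    have := is_deriveM (is_derive_id s 1) (is_derive_cst (derive1 F x) s 1).
    by move=> H; apply: is_derive_eq H _; rewrite scaler0 add0r [_ *: _]mulrC.
  have h3 : is_derive s 1 (fun s : R => s ^+ 2 / 2 * derive1 (derive1 F) x) (s * derive1 (derive1 F) x).
    have H2 := is_deriveM (is_derive_id s 1) (is_deriveM (is_derive_id s 1)
      (is_derive_cst (2^-1 * derive1 (derive1 F) x) s 1)).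
    rewrite (_ : (fun s : R => _) = (fun s : R => s * (s * (2^-1 * derive1 (derive1 F) x)))); last first.
      by apply/funext => t; rewrite expr2 -!mulrA.
    apply: is_derive_eq H2 _; rewrite scaler0 add0r ![_ *: (1 : R)]mulr1.
    rewrite /GRing.scale /= /cst; set k := derive1 (derive1 F) x; set k' := _ * k.
    by rewrite -[X in _ + X]/(s * k') /k'; field.
  rewrite -[X in _ - X - _](mul1r).
  apply: is_deriveB; apply: is_deriveB => //.
  by apply: is_derive_eq (is_deriveB h1 (is_derive_cst (F x) s 1)) _; rewrite subr0.
have [t _|c ch] := @MVT_line R R G 0 1 h; first by have [] := dG (0 + t *: 1).
rewrite add0r [h *: _]mulr1 add0r [c *: _]mulr1.
have -> : G 0 = 0 by rewrite /G addr0 expr0n /=; ring.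
rewrite subr0 -/(G h) => ->; rewrite (@derive_val _ _ _ _ _ _ _ (dG c)).
have [t _|c' cc'] := @MVT_line R R (derive1 F) x 1 c; first exact: dF'.
rewrite [c *: _]mulr1 [c' *: _]mulr1 => ->; rewrite -derive1E -mulrBr !normrM.
have H := Hom c' (le_trans cc' ch).
have -> : om * h ^+ 2 = `|h| * (`|h| * om) by rewrite -(real_normK (num_real h)); ring.
by rewrite ler_wpM2l// ler_pM.
Qed.

Lemma le_of_remainder (k x y v : R) : - k <= v - x - y -> x + (y - k) <= v.
Proof. lra. Qed.

(** Here [s] is t^2, [x1] and [x2] are the gradient terms, [x3] is the increment of the integral of
    F, [x4] and [x5] are its Taylor coefficients and [y] the integrated remainder. *)
Lemma second_variation_arith (t s x1 x2 x3 x4 x5 y e : R) :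
  0 <= t * x1 + s / 2 * x2 - x3 -> t * x4 + (s / 2 * x5 - y) <= x3 -> y <= s * e ->
  0 <= t * (x1 - x4) + s * ((x2 - x5) / 2 + e).
Proof. lra. Qed.

(** For small t the linear term prevails and would change sign with t; once it is gone, [e] tends to
    0. The slack [e] leaves room for a Taylor remainder that is merely small compared with t^2. *)
Lemma quadratic_min (a b : R) :
  (forall e, 0 < e -> exists2 t0, 0 < t0 & forall t, `|t| <= t0 -> 0 <= t * a + t ^+ 2 * (b + e)) ->
  a = 0 /\ 0 <= b.
Proof.
move=> H; have a0 : a = 0.
  apply/eqP; case: eqVneq => // an; exfalso.
  have [t0 t00 Ht] := H 1 ltr01.
  have aa : 0 < `|a| by rewrite normr_gt0.
  pose D := `|b| + 1; have D0 : 0 < D by rewrite ltr_wpDl.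
  pose s := Num.min t0 (`|a| / (D * 2)).
  have s0 : 0 < s by rewrite lt_min t00 divr_gt0// mulr_gt0.
  have sD : s * D <= `|a| / 2.
    have : s <= `|a| / (D * 2) by rewrite /s ge_min lexx orbT.
    rewrite ler_pdivlMr ?mulr_gt0// => h.
    by rewrite ler_pdivlMr// -mulrA.
  have bD : b + 1 <= D by rewrite lerD2r ler_norm.
  have st : `|s| <= t0 by rewrite gtr0_norm// /s ge_min lexx.
  have st' : `|- s| <= t0 by rewrite normrN.
  have h1 := Ht _ st; have h2 := Ht _ st'.
  have h3 : s * `|a| <= s ^+ 2 * D.
    have e1 : s ^+ 2 * (b + 1) <= s ^+ 2 * D by rewrite ler_wpM2l// sqr_ge0.
    case: (lerP 0 a) => [/ger0_norm ->|/ltr0_norm ->]; move: h1 h2 e1; rewrite sqrrN; lra.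
  have : s * `|a| <= s * (`|a| / 2).
    by apply: le_trans h3 _; rewrite expr2 -mulrA ler_wpM2l// ltW.
  by rewrite ler_pM2l//; move: aa; lra.
split=> //; apply/ler_addgt0Pr => e e0.
have [t0 t00 Ht] := H e e0.
have := Ht t0; rewrite gtr0_norm// lexx a0 mulr0 add0r => /(_ isT).
by rewrite pmulr_rge0// exprn_gt0.
Qed.

End taylor.

Section variations.
Context {R : realType} {N : nat} {M : riemannianManifold R N}.
Variable mu : {measure set (borel M) -> \bar R}.
Hypothesis mu_riem : is_riemannian_measure mu.
Hypothesis M_compact : compact [set: M].
Implicit Types (c : chart R N M) (p : M) (x : 'rV[R]_N) (f : M -> R) (X Y Z : vfield M).
Notation Lam := (Lam mu).

Let lamD := @LamD R N M mu mu_riem M_compact.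
Let lamZ (a : R) (f : M -> R) := @LamZ R N M mu mu_riem M_compact a f.
Let lamB := @LamB R N M mu mu_riem M_compact.
Let divT := @divergence_theorem R N M mu mu_riem M_compact.
Let contI := continuous_integrable mu_riem M_compact.

Lemma vaddP (t : R) X Y c c' p : atlas c -> atlas c' -> dom c p -> dom c' p ->
  X c' p + t *: Y c' p = (X c p + t *: Y c p) *m 'J (transition c c') (c p).
Proof.
move=> ac ac' cp cp'; rewrite (vcomp_transition X ac ac' cp cp').
by rewrite (vcomp_transition Y ac ac' cp cp') mulmxDl scalemxAl.
Qed.

Definition vadd (t : R) X Y : vfield M :=
  @VField R N M (fun c p => X c p + t *: Y c p) (@vaddP t X Y).

Lemma inner_vaddl t X Y Z p : inner (vadd t X Y) Z p = inner X Z p + t * inner Y Z p.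
Proof. by rewrite /inner /inner_at /= !mulmxDl -!scalemxAl mxE [in X in _ + X]mxE. Qed.

Lemma inner_vaddr t X Y Z p : inner Z (vadd t X Y) p = inner Z X p + t * inner Z Y p.
Proof. by rewrite innerC inner_vaddl !(innerC Z). Qed.

Lemma inner_vadd_sq t X Y p : inner (vadd t X Y) (vadd t X Y) p =
  inner X X p + 2 * t * inner X Y p + t ^+ 2 * inner Y Y p.
Proof. by rewrite inner_vaddl !inner_vaddr (innerC Y X); ring. Qed.

Lemma inner_le X Y p : `|inner X Y p| <= inner X X p + inner Y Y p.
Proof.
have h1 := inner_ge0 (vadd 1 X Y) p; have h2 := inner_ge0 (vadd (-1) X Y) p.
have h3 := inner_ge0 X p; have h4 := inner_ge0 Y p.
rewrite !inner_vadd_sq in h1 h2.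
by rewrite ler_norml; apply/andP; split; lra.
Qed.

Lemma innercE c X Y p : innerc c X Y p = \sum_j (\sum_i X c p 0 i * metric c (c p) i j) * Y c p 0 j.
Proof.
by rewrite /innerc mxE; apply: eq_bigr => j _; rewrite mxE [in X in _ * X]mxE.
Qed.

Lemma inner_smooth X Y : smooth_vfield X -> smooth_vfield Y -> smooth_fun (inner X Y).
Proof.
move=> sX sY c ac; have oc := cod_open c.
have H : smooth_on (cod c) (fun x => \sum_j (\sum_i X c (icoord c x) 0 i * metric c x i j)
    * Y c (icoord c x) 0 j).
  apply: (smooth_on_sum oc) => j _; apply: (smooth_onM oc); last exact: sY.
  apply: (smooth_on_sum oc) => i _; apply: (smooth_onM oc); first exact: sX.
  exact: metric_smooth.
apply: (smooth_on_ext oc _ H) => x cx.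
by rewrite /= (inner_chart X Y ac (dom_icoord cx)) innercE icoordK.
Qed.

Lemma measurable_chart c (h : 'rV[R]_N -> R) : smooth_on (cod c) h ->
  measurable_fun (dom c : set (borel M)) (fun p : borel M => h (c p)).
Proof.
move=> sh; apply: measurable_continuous; first exact: open_dom.
move=> p cp; apply: (@continuous_comp _ _ _ c h); first exact: chart_continuous.
exact: (smooth_on_continuous sh (cod_coord cp)).
Qed.

Lemma smooth_vfield_measurable X : smooth_vfield X -> measurable_vfield X.
Proof.
move=> sX c ac i.
apply: (eq_measurable_fun (fun p : borel M => X c (icoord c (c p)) 0 i)).
  by move=> p /set_mem cp; rewrite coordK.
exact: (measurable_chart (sX c ac i)).
Qed.

(** [inner] is evaluated in a chart that depends on the point without any regularity. On the domain
    of a fixed chart it has the measurable expression [innercE], and finitely many domains cover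
    M. *)
Lemma inner_measurable X Y : measurable_vfield X -> measurable_vfield Y ->
  measurable_fun [set: borel M] (inner X Y : borel M -> R).
Proof.
move=> mX mY.
pose P (A : set M) := measurable (A : set (borel M)) /\
  measurable_fun (A : set (borel M)) (inner X Y : borel M -> R).
suff [] : P setT by [].
apply: (compact_ind M_compact).
- split; first exact: measurable0.
  exact: measurable_fun_set0.
- move=> A B [mA fA] [mB fB]; split; first exact: measurableU.
  by apply/measurable_funU.
- move=> p; have ac := chart_at_atlas p; pose c := chart_at p.
  have mc : measurable (dom c : set (borel M)) by apply: measurable_openM; exact: open_dom.
  exists (dom c); split; [exact: open_dom|exact: chart_at_dom|split=> //].
  apply: (eq_measurable_fun (fun q : borel M => \sum_j (\sum_i X c q 0 i * metric c (c q) i j) * Y c q 0 j)).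
    by move=> q /set_mem cq; rewrite (inner_chart X Y ac cq) innercE.
  apply: measurable_sum => j; apply: measurable_funM; last exact: mY.
  apply: measurable_sum => i; apply: measurable_funM; first exact: mX.
  exact: (measurable_chart (metric_smooth ac i j)).
Qed.

Definition sq_integrable X := measurable_vfield X /\
  mu.-integrable [set: borel M] (fun p => (inner X X p)%:E).

Lemma smooth_sq_integrable X : smooth_vfield X -> sq_integrable X.
Proof.
move=> sX; split; first exact: smooth_vfield_measurable.
exact: (contI (smooth_fun_continuous (inner_smooth sX sX))).
Qed.

Lemma inner_integrable X Y : sq_integrable X -> sq_integrable Y ->
  mu.-integrable [set: borel M] (EFin \o inner X Y).
Proof.
move=> [mX iX] [mY iY].
apply: (le_integrable measurableT _ _ (integrableD measurableT iX iY)).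
  by apply/measurable_EFinP; exact: inner_measurable.
move=> p _; rewrite /= lee_fin.
by apply: le_trans (inner_le X Y p) _; exact: ler_norm.
Qed.

Lemma vadd_sq_integrable t X Y : sq_integrable X -> sq_integrable Y -> sq_integrable (vadd t X Y).
Proof.
move=> sX sY; split.
  move=> c ac i; rewrite (_ : (fun p => _) = (fun p : borel M => X c p 0 i + t * Y c p 0 i)); last first.
    by apply/funext => p; rewrite !mxE.
  apply: measurable_funD; first exact: sX.1.
  by apply: measurable_funM; [exact: measurable_cst|exact: sY.1].
have iXY := integrableZl measurableT (2 * t) (inner_integrable sX sY).
have iYY := integrableZl measurableT (t ^+ 2) sY.2.
rewrite (_ : (fun p => _) = (fun p : borel M => ((inner X X p)%:E + (2 * t)%:E * (inner X Y p)%:E + (t ^+ 2)%:E * (inner Y Y p)%:E)%E)).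
  exact: (integrableD measurableT (integrableD measurableT sX.2 iXY) iYY).
by apply/funext => p; rewrite inner_vadd_sq.
Qed.

Section competitor.
Variables (u0 : H1 mu) (su : smooth_fun u0) (f : M -> R) (sf : smooth_fun f).

Let cf : continuous f := smooth_fun_continuous sf.
Let cu : continuous u0 := smooth_fun_continuous su.
Let sg : sq_integrable (gradf sf) := smooth_sq_integrable (gradf_smooth sf).
Let su0 : sq_integrable (grad u0) := conj (@grad_measurable _ _ _ _ u0) (grad_L2 u0).

Let cuf t : continuous (fun p => u0 p + t * f p).
Proof.
exact: (contD cu (contZ t cf)).
Qed.

Let mfun t : measurable_fun [set: borel M] (fun p : borel M => u0 p + t * f p).
Proof. exact: (continuous_measurableM (@cuf t)). Qed.

Let funL2 t : mu.-integrable [set: borel M] (fun p => ((u0 p + t * f p) ^+ 2)%:E).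
Proof.
exact: (contI (cont_sqr (@cuf t))).
Qed.

Let weak t X : smooth_vfield X ->
  \int[mu]_(p in [set: borel M]) ((u0 p + t * f p) * divergence X p)
  = - \int[mu]_(p in [set: borel M]) inner (vadd t (grad u0) (gradf sf)) X p.
Proof.
move=> sX; have sdiv := divergence_smooth mu_riem M_compact sX.
have k1 := smooth_fun_continuous (smooth_funM su sdiv).
have k2 := smooth_fun_continuous (smooth_funM sf sdiv).
have k3 : continuous (fun p => t * (f p * divergence X p)).
  exact: (contZ t k2).
rewrite (_ : (fun p => _ * _) = (fun p => u0 p * divergence X p + t * (f p * divergence X p))); last first.
  by apply/funext => p; ring.
rewrite -[LHS]/(Lam (fun p => u0 p * divergence X p + t * (f p * divergence X p))).
rewrite (lamD k1 k3) (lamZ t k2).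
rewrite (divT sX sf) /Lam (grad_weak u0 sX).
have sXi := smooth_sq_integrable sX.
have i1 := inner_integrable su0 sXi.
have i2 := inner_integrable sg sXi.
have i3 := integrableZl measurableT t i2.
rewrite [in RHS](_ : (fun p => _) = (fun p => inner (grad u0) X p + t * inner (gradf sf) X p)); last first.
  by apply/funext => p; rewrite inner_vaddl.
rewrite (RintegralD measurableT i1 i3) (RintegralZl t measurableT i2) opprD mulrN.
by congr (_ - _ * _); apply: eq_Rintegral => p _; rewrite dirderE.
Qed.

(** The weak gradient carried by [u0] is kept, and only the classical gradient of [f] is added to
    it; no comparison of [grad u0] with [gradf su] is made. *)
Definition competitor t : H1 mu := @MkH1 R N M mu (fun p => u0 p + t * f p)
  (vadd t (grad u0) (gradf sf)) (@mfun t) (@funL2 t)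
  (vadd_sq_integrable t su0 sg).1 (vadd_sq_integrable t su0 sg).2 (@weak t).

Lemma competitor_dist t :
  H1dist (competitor t) u0 = `|t| * Num.sqrt (Lam (fun p => f p ^+ 2 + inner (gradf sf) (gradf sf) p)).
Proof.
have k : continuous (fun p => f p ^+ 2 + inner (gradf sf) (gradf sf) p).
  exact: (contD (cont_sqr cf) (smooth_fun_continuous (inner_smooth (gradf_smooth sf) (gradf_smooth sf)))).
rewrite /H1dist -sqrtr_sqr -sqrtrM ?sqr_ge0// -(lamZ _ k).
congr Num.sqrt; apply: eq_Rintegral => p _ /=.
have addBK (V : zmodType) (x y : V) : x + y - x = y by rewrite addrC addKr.
rewrite !addBK /inner /inner_at linearZ /= -scalemxAr -!scalemxAl scalerA [in LHS]mxE.
by rewrite mulrDr exprMn expr2.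
Qed.

(** The square of the weak gradient of [u0] cancels. Its product with grad f is passed to [u0] by
    the weak formulation and back by the divergence theorem, which brings in the classical
    gradient. *)
Lemma competitor_energy (F : R -> R) t : continuous F -> @energy_well_defined R N M mu F ->
  energy F (competitor t) - energy F u0 = t * Lam (dirder f (gradf su))
    + t ^+ 2 / 2 * Lam (dirder f (gradf sf)) - Lam (fun p => F (u0 p + t * f p) - F (u0 p)).
Proof.
move=> cF Ew.
have cFt s : continuous (fun p => F (u0 p + s * f p)).
  exact: (cont_comp cF (@cuf s)).
have cFu : continuous (fun p => F (u0 p)).
  exact: (cont_comp cF cu).
have kd : continuous (fun p => F (u0 p + t * f p) - F (u0 p)).
  exact: (contB (cFt t) cFu).
rewrite /energy -(RintegralB measurableT (Ew _) (Ew _)).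
have iuf := inner_integrable su0 sg.
have i1 := integrableZl measurableT t iuf.
have i2 := integrableZl measurableT (t ^+ 2 / 2) sg.2.
have i12 := integrableD measurableT i1 i2.
rewrite [X in Rintegral _ _ X](_ : _ = (fun p : borel M => t * inner (grad u0) (gradf sf) p
   + t ^+ 2 / 2 * inner (gradf sf) (gradf sf) p - (F (u0 p + t * f p) - F (u0 p)))); last first.
  by apply/funext => p; rewrite /energy_density /= inner_vadd_sq; field.
rewrite (RintegralB measurableT i12 (contI kd)) (RintegralD measurableT i1 i2).
rewrite (RintegralZl _ measurableT iuf) (RintegralZl _ measurableT sg.2).
congr (_ * _ + _ * _ - _); last by apply: eq_Rintegral => p _; rewrite dirderE.
apply: oppr_inj; rewrite -(grad_weak u0 (gradf_smooth sf)).
apply: etrans (divT (gradf_smooth sf) su) _.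
by congr (- Lam _); apply/funext => p; rewrite (dirderC su sf).
Qed.

(** Uniformity in [p] is the point: F'' is only continuous, but its oscillation near the values of
    [u0] is uniformly small because M is compact, and [f] is bounded by [C]. The choice of [om]
    gives [om * C ^+ 2 <= e]. *)
Lemma competitor_taylor (F : R -> R) e : C2 F -> 0 < e -> exists2 t0, 0 < t0 &
  forall t, `|t| <= t0 -> forall p,
   `|F (u0 p + t * f p) - F (u0 p) - t * f p * derive1 F (u0 p)
     - (t * f p) ^+ 2 / 2 * derive1n 2 F (u0 p)| <= e * t ^+ 2.
Proof.
move=> F2 e0; have [_ _ cF2] := F2.
have [C C0 HC] := compact_le_bound M_compact (fun (p : M) _ => @cf p).
pose om := e / (C ^+ 2 + 1).
have C10 : 0 < C ^+ 2 + 1 by rewrite ltr_wpDl// sqr_ge0.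
have om0 : 0 < om by rewrite divr_gt0.
pose F2' := derive1n 2 F.
have : \forall s \near (0 : R), [set: M] `<=` (fun p => `|F2' (u0 p) - F2' (u0 p + s)| <= om).
  have /compact_near_coveringP cK := M_compact.
  apply: (cK R (nbhs (0 : R)) (fun s p => `|F2' (u0 p) - F2' (u0 p + s)| <= om)) => p _.
  have c1 : (fun q : M * R => F2' (u0 q.1) - F2' (u0 q.1 + q.2)) @ (p, 0 : R) --> F2' (u0 p) - F2' (u0 p + 0).
    have c0 : (fun q : M * R => u0 q.1) @ (p, 0 : R) --> u0 p.
      exact: (cvg_comp (@fst _ _) u0 (@cvg_fst _ _ (nbhs p) (nbhs (0 : R)) _) (@cu p)).
    have c2 : (fun q : M * R => u0 q.1 + q.2) @ (p, 0 : R) --> u0 p + 0.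
      by apply: cvgD c0 _; exact: cvg_snd.
    exact: (cvgB (cvg_comp _ F2' c0 (cF2 _)) (cvg_comp _ F2' c2 (cF2 _))).
  have d0 : F2' (u0 p) - F2' (u0 p + 0) = 0 by rewrite addr0 subrr.
  have c3 : (fun q : M * R => F2' (u0 q.1) - F2' (u0 q.1 + q.2)) @ (p, 0 : R) --> (0 : R).
    by apply: (cvg_trans c1); rewrite d0.
  by move/cvgr0Pnorm_le : c3 => /(_ _ om0).
move=> /nbhs_ballP [d /= d0 Hd].
(* For such [t] the increment [t * f p] is at most [d / 2] in absolute value. *)
exists (d / 2 / (C + 1)); first by rewrite !divr_gt0// ltr_wpDl.
move=> t tt p.
have fC : `|f p| <= C by exact: HC.
have tf : `|t * f p| < d.
  rewrite normrM; apply: (@le_lt_trans _ _ (d / 2)); last by rewrite ltr_pdivrMr// ltr_pMr// ltr1n.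
  have C1 : 0 < C + 1 by rewrite ltr_wpDl.
  rewrite ler_pdivlMr// in tt; apply: le_trans tt.
  by rewrite ler_wpM2l// (le_trans fC)// lerDl.
have H := @taylor2_le R F (u0 p) (t * f p) om F2.
apply: le_trans (H _) _.
  move=> s sh; rewrite distrC; apply: (Hd s) => //.
  by rewrite -ball_normE /= sub0r normrN; exact: le_lt_trans sh tf.
rewrite exprMn mulrCA mulrC ler_wpM2r ?sqr_ge0//.
have h1 : f p ^+ 2 <= C ^+ 2 by rewrite -(real_normK (num_real (f p))) lerXn2r// nnegrE.
rewrite /om -mulrA ler_piMr ?(ltW e0)// mulrC ler_pdivrMr// mul1r.
by rewrite (le_trans h1)// lerDl.
Qed.

Lemma competitor_variations (F : R -> R) : C2 F -> @energy_well_defined R N M mu F ->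
  local_minimizer F u0 ->
  Lam (fun p => f p * (divergence (gradf su) p + derive1 F (u0 p))) = 0 /\
  0 <= Lam (fun p => dirder f (gradf sf) p - f p ^+ 2 * derive1n 2 F (u0 p)).
Proof.
move=> F2 Ew [_ [del del0 umin]]; have [dF dF' cF2] := F2.
have cF : continuous F by move=> x; apply: differentiable_continuous; exact/derivable1_diffP.
have cF' : continuous (derive1 F).
  by move=> x; apply: differentiable_continuous; exact/derivable1_diffP.
have cFu (G : R -> R) : continuous G -> continuous (fun p => G (u0 p)).
  by move=> cG; exact: (cont_comp cG cu).
have sdiv := divergence_smooth mu_riem M_compact (gradf_smooth su).
have k1 := smooth_fun_continuous (smooth_funM sf sdiv).
have k2 : continuous (fun p => f p * derive1 F (u0 p)).
  exact: (contM cf (cFu _ cF')).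
have cd : continuous (dirder f (gradf sf)) := smooth_fun_continuous (dirder_smooth sf (gradf_smooth sf)).
have k3 : continuous (fun p => f p ^+ 2 * derive1n 2 F (u0 p)).
  exact: (contM (cont_sqr cf) (cFu _ cF2)).
have k4 : continuous (cst 1 : M -> R) by exact: cst_continuous.
pose a := - Lam (fun p => f p * (divergence (gradf su) p + derive1 F (u0 p))).
pose b := Lam (fun p => dirder f (gradf sf) p - f p ^+ 2 * derive1n 2 F (u0 p)) / 2.
have aE : a = Lam (dirder f (gradf su)) - Lam (fun p => f p * derive1 F (u0 p)).
  rewrite /a (_ : (fun p => _ * _) = (fun p => f p * divergence (gradf su) p + f p * derive1 F (u0 p))).
    rewrite (lamD k1 k2) (divT (gradf_smooth su) sf).
    by rewrite opprD opprK.
  by apply/funext => p; rewrite mulrDr.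
have bE : b = (Lam (dirder f (gradf sf)) - Lam (fun p => f p ^+ 2 * derive1n 2 F (u0 p))) / 2.
  by rewrite /b (lamB cd k3).
suff [] : a = 0 /\ 0 <= b.
  move=> /eqP; rewrite oppr_eq0 => /eqP -> b0; split=> //.
  by move: b0; rewrite /b pmulr_lge0 ?invr_gt0.
(* For small t the nonnegative energy difference is at most t a + t^2 (b + e); the Taylor remainder,
   integrated over the total mass [m], accounts for [e], whence [e']. *)
apply: quadratic_min => e e0.
pose m := Lam (cst 1).
have m0 : 0 <= m by apply: Rintegral_ge0 => p _.
pose e' := e / (m + 1).
have m10 : 0 < m + 1 by rewrite ltr_wpDl.
have e'0 : 0 < e' by rewrite divr_gt0.
have [t1 t10 Ht1] := competitor_taylor F2 e'0.
pose S := Num.sqrt (Lam (fun p => f p ^+ 2 + inner (gradf sf) (gradf sf) p)).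
have S0 : 0 <= S by exact: sqrtr_ge0.
have S10 : 0 < S + 1 by rewrite ltr_wpDl.
(* The second bound keeps the competitor, at distance |t| S from [u0], within [del]. *)
exists (Num.min t1 (del / (S + 1))); first by rewrite lt_min t10 divr_gt0.
move=> t; rewrite le_min => /andP[tt1 tdel].
have : energy F u0 <= energy F (competitor t).
  apply: umin; rewrite competitor_dist -/S.
  rewrite ler_pdivlMr// in tdel; apply: le_trans tdel.
  by rewrite ler_wpM2l// lerDl.
rewrite -subr_ge0 competitor_energy// => En.
have kt : continuous (fun p => F (u0 p + t * f p) - F (u0 p)).
  exact: (contB (cont_comp cF (@cuf t)) (cFu _ cF)).
have LB : t * Lam (fun p => f p * derive1 F (u0 p)) + (t ^+ 2 / 2 * Lam (fun p => f p ^+ 2 * derive1n 2 F (u0 p))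
    + - (e' * t ^+ 2) * m) <= Lam (fun p => F (u0 p + t * f p) - F (u0 p)).
  have k2t : continuous (fun p => t * (f p * derive1 F (u0 p))).
    exact: (contZ t k2).
  have k3t : continuous (fun p => t ^+ 2 / 2 * (f p ^+ 2 * derive1n 2 F (u0 p))).
    exact: (contZ _ k3).
  have k4t : continuous (fun p : M => - (e' * t ^+ 2) * cst 1 p).
    exact: (contZ _ k4).
  have k34 : continuous (fun p => t ^+ 2 / 2 * (f p ^+ 2 * derive1n 2 F (u0 p)) + - (e' * t ^+ 2) * cst 1 p).
    exact: (contD k3t k4t).
  have E1 := LamZ mu_riem M_compact t k2.
  have E2 := LamZ mu_riem M_compact (t ^+ 2 / 2) k3.
  have E3 := LamZ mu_riem M_compact (- (e' * t ^+ 2)) k4.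
  have E4 := etrans (lamD k3t k4t) (congr2 +%R E2 E3).
  rewrite -[leLHS](etrans (lamD k2t k34) (congr2 +%R E1 E4)).
  apply: (Lam_le mu_riem M_compact (contD k2t k34) kt) => p.
  have := Ht1 _ tt1 p; rewrite ler_norml => /andP[H _]; rewrite /cst mulr1.
  have E : t ^+ 2 / 2 * (f p ^+ 2 * derive1n 2 F (u0 p)) = (t * f p) ^+ 2 / 2 * derive1n 2 F (u0 p).
    by rewrite exprMn; ring.
  by rewrite E mulrA; apply: le_of_remainder; exact: H.
have em : e' * t ^+ 2 * m <= t ^+ 2 * e.
  rewrite mulrC mulrA mulrC ler_wpM2l ?sqr_ge0// /e' mulrC -mulrA ler_piMr ?(ltW e0)//.
  by rewrite mulrC ler_pdivrMr// mul1r lerDl.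
rewrite aE bE.
by move: En LB em; rewrite mulNr; exact: second_variation_arith.
Qed.

End competitor.

(** Fundamental lemma of the calculus of variations: if [h p] were nonzero, a bump supported where
    [h] has the sign of [h p] would have a nonzero first variation. *)
Lemma euler_lagrange (u0 : H1 mu) (su : smooth_fun u0) (F : R -> R) p :
  C2 F -> @energy_well_defined R N M mu F -> local_minimizer F u0 ->
  divergence (gradf su) p = - derive1 F (u0 p).
Proof.
move=> F2 Ew umin; have [dF dF' cF2] := F2.
pose h q := divergence (gradf su) q + derive1 F (u0 q).
have cu : continuous u0 := smooth_fun_continuous su.
have cF' : continuous (derive1 F).
  by move=> x; apply: differentiable_continuous; exact/derivable1_diffP.
have ch : continuous h.
  have sdiv := divergence_smooth mu_riem M_compact (gradf_smooth su).
  exact: (contD (smooth_fun_continuous sdiv) (cont_comp cF' cu)).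
have chp : continuous (fun q => h p * h q).
  exact: (contZ _ ch).
apply/eqP; rewrite -addr_eq0 -/(h p); apply: contraT => hp.
pose V := [set q | 0 < h p * h q].
have oV : open V := open_ltT 0 chp.
have Vp : V p by rewrite /V /= -expr2 exprn_even_gt0.
have [b [S [sb b0 bp [cS SV bS]]]] := bump_function (chart_at_atlas p) (chart_at_dom p) oV Vp.
have [H _] := competitor_variations su sb F2 Ew umin.
have cb : continuous b := smooth_fun_continuous sb.
have k1 : continuous (fun q => b q * h q) by exact: (contM cb ch).
have k2 : continuous (fun q => h p * (b q * h q)).
  exact: (contZ _ k1).
have L0 : Lam (fun q => h p * (b q * h q)) = 0.
  by rewrite (lamZ _ k1) H mulr0.
have pos q : 0 <= h p * (b q * h q).
  rewrite mulrCA; have [/SV [_ /ltW Vq]|Sq] := pselect (S q); first exact: mulr_ge0.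
  by rewrite bS// mul0r.
have := Lam_eq0 mu_riem M_compact k2 pos L0 p.
move/eqP; rewrite !mulf_eq0 (negbTE hp) orbF /= => /eqP bp0.
by rewrite bp0 ltxx in bp.
Qed.

End variations.

(** * The vanishing argument *)

Lemma am_gm (R : realType) (y b eta : R) : y ^+ 2 <= b -> y * (2 * eta) <= eta ^+ 2 + b.
Proof. by have := sqr_ge0 (y - eta); nra. Qed.

Section endgame.
Context {R : realType} {T : topologicalType}.
Variable Lam : (T -> R) -> R.
Hypothesis LamD : forall f g : T -> R, continuous f -> continuous g ->
  Lam (fun x => f x + g x) = Lam f + Lam g.
Hypothesis LamZ : forall (a : R) (f : T -> R), continuous f -> Lam (fun x => a * f x) = a * Lam f.
Hypothesis Lam_le : forall f g : T -> R, continuous f -> continuous g -> (forall x, f x <= g x) ->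
  Lam f <= Lam g.
Hypothesis Lam_eq0 : forall f : T -> R, continuous f -> (forall x, 0 <= f x) -> Lam f = 0 ->
  forall x, f x = 0.

Lemma contV (f : T -> R) : continuous f -> (forall x, f x != 0) -> continuous (fun x => (f x)^-1).
Proof. by move=> cf f0 x; exact: (cvgV (f0 x) (cf x)). Qed.

(** At the points 2^-(k+1) the increments telescope. Were all of them larger than [eta], [G] would
    exceed [C] after about C / eta halvings. *)
Lemma small_increment (G : R -> R) C : (forall e, 0 < e -> 0 <= G e <= C) ->
  forall eta, 0 < eta -> exists2 e, 0 < e <= 1 & G e - G (2 * e) <= eta.
Proof.
move=> GC eta eta0; apply: contrapT => nex.
pose e k : R := 2^-1 ^+ k.+1.
have e0 k : 0 < e k by rewrite exprn_gt0.
have e1 k : e k <= 1 by rewrite exprn_ile1// invf_le1// ler1n.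
have step k : eta < G (e k) - G (2 * e k).
  by rewrite ltNge; apply/negP => H; apply: nex; exists (e k); rewrite ?e0 ?e1.
have eS k : 2 * e k.+1 = e k by rewrite /e [in LHS]exprS mulrA mulfV ?mul1r.
have Gk k : eta *+ k <= G (e k).
  elim: k => [|k IH]; first by rewrite mulr0n; have /andP[] := GC _ (e0 0%N).
  have := step k.+1; rewrite eS mulrS; lra.
pose k := Num.Def.archi_bound (C / eta).
have C0 : 0 <= C by have /andP[] := GC 1 ltr01; exact: le_trans.
have := archi_boundP (divr_ge0 C0 (ltW eta0)).
rewrite -/k ltr_pdivrMr// mulrC mulr_natr => kC.
have /andP[_ GCk] := GC _ (e0 k).
by have := lt_le_trans kC (le_trans (Gk k) GCk); rewrite ltxx.
Qed.

(** The geometry enters through these pointwise inequalities and integral relations alone. [q] is to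
    be <grad w, grad u> / 2 and [n] the dimension. *)
Variables (u w L B q z : T -> R) (n C : R).
Hypotheses (cu : continuous u) (cw : continuous w) (cL : continuous L).
Hypotheses (cB : continuous B) (cz : continuous z).
Hypothesis n0 : 0 < n.
Hypothesis w0 : forall x, 0 <= w x.
Hypothesis LB : forall x, L x ^+ 2 <= n * B x.
Hypothesis kato : forall x, (L x * w x - q x) ^+ 2 <= n * (w x * (B x * w x - z x)).
Hypothesis wz : forall x, w x = 0 -> z x = 0.
Hypothesis stable : forall e, 0 < e -> Lam (fun x => B x - z x / (w x + e)) <= e * C.
Hypothesis weighted : forall e, 0 < e -> Lam (fun x => w x / Num.sqrt (w x + e)) =
  - Lam (fun x => u x * (L x * (w x + e) - q x) / Num.sqrt (w x + e) ^+ 3).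
Variables (K : R).
Hypothesis uK : forall x, `|u x| <= K.

Let we0 e x : 0 < e -> 0 < w x + e.
Proof. by move=> e0; rewrite ltr_wpDl. Qed.

Let cwe e : continuous (fun x => w x + e).
Proof. by apply: contD => // x; exact: cst_continuous. Qed.

Let cr e : 0 < e -> continuous (fun x => (w x + e)^-1).
Proof. by move=> e0; apply: (contV (@cwe e)) => x; apply/lt0r_neq0/we0. Qed.

Let cs e : continuous (fun x => Num.sqrt (w x + e)).
Proof. exact: (cont_comp (@sqrt_continuous R) (@cwe e)). Qed.

Let se0 e x : 0 < e -> 0 < Num.sqrt (w x + e).
Proof. by move=> e0; rewrite sqrtr_gt0 we0. Qed.

Let crs e : 0 < e -> continuous (fun x => (Num.sqrt (w x + e))^-1).
Proof. by move=> e0; apply: (contV (@cs e)) => x; apply/lt0r_neq0/se0. Qed.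

Let B0 x : 0 <= B x.
Proof. by have := le_trans (sqr_ge0 _) (LB x); rewrite pmulr_rge0. Qed.

Let D x := B x * w x - z x.

Let cD : continuous D.
Proof. exact: (contB (contM cB cw) cz). Qed.

(** Where [w] vanishes, [kato] says nothing about [D]; there [wz] is used. *)
Let D0 x : 0 <= D x.
Proof.
have := w0 x; rewrite le_eqVlt => /orP[/eqP wx|wx].
  by rewrite /D -wx mulr0 wz// subrr.
have := le_trans (sqr_ge0 _) (kato x).
by rewrite pmulr_rge0// pmulr_rge0.
Qed.

(** B - z / (w + e) equals (D + e B) / (w + e), a sum of two nonnegative terms. One inequality thus
    yields both the smallness of the integral of D / (w + e) and, after division by [e], a bound on
    that of B / (w + e). *)
Let split_stable e : 0 < e ->
  Lam (fun x => D x / (w x + e)) + e * Lam (fun x => B x / (w x + e)) <= e * C.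
Proof.
move=> e0; have c1 := contM cD (@cr e e0); have c2 := contM cB (@cr e e0).
rewrite -(LamZ e c2) -(LamD c1 (contZ e c2)); apply: le_trans (stable e0).
suff -> : (fun x => D x / (w x + e) + e * (B x / (w x + e))) = (fun x => B x - z x / (w x + e)) by [].
apply/funext => x; rewrite /D; have := lt0r_neq0 (we0 x e0) => ne.
by field.
Qed.

Let LamB0 e : 0 < e -> 0 <= Lam (fun x => B x / (w x + e)).
Proof.
move=> e0; have c2 := contM cB (@cr e e0).
have c0 : continuous (fun x : T => 0 * (B x / (w x + e))) := contZ 0 c2.
have := LamZ 0 c2; rewrite mul0r => <-; apply: Lam_le => // x.
by rewrite mul0r divr_ge0// ltW// we0.
Qed.

Let LamD0 e : 0 < e -> 0 <= Lam (fun x => D x / (w x + e)).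
Proof.
move=> e0; have c2 := contM cD (@cr e e0).
have c0 : continuous (fun x : T => 0 * (D x / (w x + e))) := contZ 0 c2.
have := LamZ 0 c2; rewrite mul0r => <-; apply: Lam_le => // x.
by rewrite mul0r divr_ge0// ltW// we0.
Qed.

Let LamBC e : 0 < e -> 0 <= Lam (fun x => B x / (w x + e)) <= C.
Proof.
move=> e0; rewrite LamB0 //= -(ler_pM2l e0); apply: le_trans (split_stable e0).
by rewrite lerDr LamD0.
Qed.

Let C0 : 0 <= C.
Proof. by have /andP[] := LamBC ltr01; exact: le_trans. Qed.

(** D / (w + e) grows as [e] decreases, yet its integral is at most e C; comparison with e = 1
    leaves only the value 0. *)
Let Dz x : D x = 0.
Proof.
have c1 := contM cD (@cr 1 ltr01).
have L1 : Lam (fun x => D x / (w x + 1)) = 0.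
  apply/eqP; rewrite eq_le LamD0// andbT; apply/ler_addgt0Pr => eta eta0; rewrite add0r.
  pose e := Num.min 1 (eta / (C + 1)).
  have C10 : 0 < C + 1 by rewrite ltr_wpDl.
  have e0 : 0 < e by rewrite lt_min ltr01 divr_gt0.
  apply: (@le_trans _ _ (Lam (fun x => D x / (w x + e)))).
    apply: (Lam_le c1 (contM cD (@cr e e0))) => y.
    apply: ler_wpM2l => //; rewrite lef_pV2 ?posrE ?we0// lerD2l.
    by rewrite /e ge_min lexx.
  apply: (@le_trans _ _ (e * C)).
    by apply: le_trans (split_stable e0); rewrite lerDl mulr_ge0 ?(ltW e0)// LamB0.
  have : e <= eta / (C + 1) by rewrite /e ge_min lexx orbT.
  rewrite ler_pdivlMr// => H; apply: le_trans H.
  by rewrite ler_wpM2l ?(ltW e0)// lerDl.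
have := Lam_eq0 c1 _ L1 x; move=> H.
have : D x / (w x + 1) = 0 by apply: H => y; rewrite divr_ge0// ltW// we0.
move/eqP; rewrite mulf_eq0 invr_eq0 (negbTE (lt0r_neq0 (we0 x ltr01))) orbF.
by move/eqP.
Qed.

Let qE x : q x = L x * w x.
Proof.
have := kato x; rewrite -/(D x) Dz !mulr0 => H.
by apply/esym/eqP; rewrite -subr_eq0 -sqrf_eq0 eq_le H sqr_ge0.
Qed.

(** Up to the factor [n], this bounds the square of e L / (w + e)^(3/2), the factor of [u] in
    [weighted] once q = L w. *)
Let h e x := e ^+ 2 * (B x / (w x + e) ^+ 3).

Let ch e : 0 < e -> continuous (h e).
Proof.
move=> e0; apply: contZ; rewrite (_ : (fun x => _) =
  (fun x => B x * ((w x + e)^-1 * ((w x + e)^-1 * (w x + e)^-1)))).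
  exact: (contM cB (contM (@cr e e0) (contM (@cr e e0) (@cr e e0)))).
by apply/funext => x; rewrite -exprVn !exprS expr0 mulr1.
Qed.

(** A difference between [e] and [2 * e] on the right is what [small_increment] can make small. The
    inequality reduces to e (w + 2 e) <= 2 (w + e)^2. *)
Let h_le e x : 0 < e -> h e x <= 2 * (B x / (w x + e) - B x / (w x + 2 * e)).
Proof.
move=> e0; have a0 := we0 x e0.
have e20 : 0 < 2 * e by rewrite mulr_gt0.
have b0 := we0 x e20.
have -> : 2 * (B x / (w x + e) - B x / (w x + 2 * e)) =
    B x * (2 * e / ((w x + e) * (w x + 2 * e))).
  have := lt0r_neq0 a0; have := lt0r_neq0 b0 => h1 h2.
  by field; rewrite h1 h2.
rewrite /h mulrCA; apply: ler_wpM2l => //.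
rewrite ler_pdivrMr ?exprn_gt0// mulrAC ler_pdivlMr ?mulr_gt0//.
have wx := w0 x.
rewrite -subr_ge0.
have -> : 2 * e * (w x + e) ^+ 3 - e ^+ 2 * ((w x + e) * (w x + 2 * e)) =
   e * (w x + e) * (2 * w x * (w x + e) + e * w x).
  by ring.
by rewrite mulr_ge0 ?mulr_ge0 ?addr_ge0 ?mulr_ge0 ?(ltW e0)// ltW.
Qed.

Let Lam_h eta : 0 < eta -> exists2 e, 0 < e <= 1 & Lam (h e) <= eta.
Proof.
move=> eta0; have e20 : 0 < eta / 2 by rewrite divr_gt0.
have [e /andP[e0 e1] He] := small_increment LamBC e20.
exists e; first by rewrite e0.
have e2 : 0 < 2 * e by rewrite mulr_gt0.
have c1 := contM cB (@cr e e0); have c2 := contM cB (@cr _ e2).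
apply: le_trans (Lam_le (@ch e e0) (contZ 2 (contD c1 (contZ (-1) c2))) _) _.
  by move=> x; rewrite mulN1r; exact: h_le.
by rewrite (LamZ 2 (contD c1 (contZ (-1) c2))) (LamD c1 (contZ (-1) c2)) (LamZ _ c2); lra.
Qed.

(** A point is required, since [uK] bounds [K] from below only at points of [T]. *)
Let K0 (x : T) : 0 <= K. Proof. exact: le_trans (uK x). Qed.

Let young (y b k eta : R) (x : T) : 0 < eta -> y ^+ 2 <= b -> `|k| <= K ->
  - (k * y) <= K / 2 * eta + K / (2 * eta) * b.
Proof.
move=> eta0 yb kK; have K00 := K0 x.
have h1 : - (k * y) <= K * `|y|.
  by rewrite (le_trans (ler_norm _))// normrN normrM ler_wpM2r.
apply: (le_trans h1).
have -> : K / 2 * eta + K / (2 * eta) * b = K * ((eta ^+ 2 + b) / (2 * eta)).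
  by field; exact: lt0r_neq0.
rewrite ler_wpM2l// ler_pdivlMr ?mulr_gt0//.
by apply: am_gm; rewrite real_normK// num_real.
Qed.

Lemma endgame x : w x = 0.
Proof.
have K00 := K0 x.
have c1 := contM cw (@crs 1 ltr01).
have cone : continuous (fun _ : T => 1 : R) by move=> y; exact: cst_continuous.
pose m := Lam (fun=> 1).
have m0 : 0 <= m.
  rewrite -[leLHS](etrans (LamZ 0 cone) (mul0r _)); apply: (Lam_le (contZ 0 cone) cone) => y.
  by rewrite mul0r.
have main eta : 0 < eta -> Lam (fun x => w x / Num.sqrt (w x + 1)) <= K / 2 * (m + 1) * eta.
  (* With the integral of [h e] at most [eta ^+ 2 / n], the second term of [young] integrates to at
     most K eta / 2, of the same order as the first. *)
  move=> eta0; have en0 : 0 < eta ^+ 2 / n by rewrite divr_gt0// exprn_gt0.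
  have [e /andP[e0 e1] He] := Lam_h en0.
  (* [e] depends on [eta], so the left-hand side is frozen at the value 1, which is allowed by
     [e <= 1]. *)
  apply: (@le_trans _ _ (Lam (fun x => w x / Num.sqrt (w x + e)))).
    apply: (Lam_le c1 (contM cw (@crs e e0))) => y.
    by apply: ler_wpM2l => //; rewrite lef_pV2 ?posrE ?se0// ler_sqrt ?lerD2l// ltW// we0.
  rewrite weighted//.
  pose g x := u x * (e * L x * (Num.sqrt (w x + e))^-1 ^+ 3).
  have -> : (fun x => u x * (L x * (w x + e) - q x) / Num.sqrt (w x + e) ^+ 3) = g.
    by apply/funext => y; rewrite /g qE exprVn; ring.
  have cg : continuous g.
    rewrite /g (_ : (fun x => _) = (fun x => u x * ((e * L x) * ((Num.sqrt (w x + e))^-1 *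
       ((Num.sqrt (w x + e))^-1 * (Num.sqrt (w x + e))^-1))))).
      exact: (contM cu (contM (contZ e cL) (contM (@crs e e0) (contM (@crs e e0) (@crs e e0))))).
    by apply/funext => y; rewrite !exprS expr0 mulr1.
  have -> : - Lam g = Lam (fun x => -1 * g x) by rewrite (LamZ _ cg) mulN1r.
  have ch' := @ch e e0.
  have cb := contD (contZ (K / 2 * eta) cone) (contZ (K / (2 * eta) * n) ch').
  apply: (@le_trans _ _ (Lam (fun x => K / 2 * eta * 1 + K / (2 * eta) * n * h e x))).
    apply: (Lam_le (contZ (-1) cg) cb) => y; rewrite mulN1r mulr1 -[_ * n * _]mulrA /g.
    apply: (young y) => //.
    have s2 : (Num.sqrt (w y + e))^-1 ^+ 3 ^+ 2 = ((w y + e) ^+ 3)^-1.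
      rewrite -exprM mulnC exprM exprVn sqr_sqrtr ?exprVn//.
      by rewrite ltW// we0.
    rewrite exprMn s2 exprMn /h.
    have -> : n * (e ^+ 2 * (B y / (w y + e) ^+ 3)) = e ^+ 2 * (n * B y) / (w y + e) ^+ 3 by ring.
    apply: ler_wpM2r; first by rewrite invr_ge0 exprn_ge0// ltW// we0.
    by apply: ler_wpM2l => //; exact: sqr_ge0.
  rewrite (LamD (contZ (K / 2 * eta) cone) (contZ (K / (2 * eta) * n) ch')).
  rewrite (LamZ _ cone) (LamZ _ ch') -/m.
  have -> : K / 2 * (m + 1) * eta = K / 2 * eta * m + K / (2 * eta) * n * (eta ^+ 2 / n).
    by field; rewrite !lt0r_neq0.
  rewrite lerD2l ler_wpM2l//.
  by rewrite mulr_ge0 ?(ltW n0)// divr_ge0// mulr_ge0// ltW.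
have pos y : 0 <= w y / Num.sqrt (w y + 1) by rewrite divr_ge0// ltW// se0.
have L0 : Lam (fun x => w x / Num.sqrt (w x + 1)) = 0.
  apply/eqP; rewrite eq_le; apply/andP; split; last first.
    have := LamZ 0 c1; rewrite mul0r => <-; apply: (Lam_le (contZ 0 c1) c1) => y.
    by rewrite mul0r.
  apply/ler_addgt0Pr => eta eta0; rewrite add0r.
  pose A := K / 2 * (m + 1) + 1.
  have A0 : 0 < A by rewrite ltr_wpDl// mulr_ge0 ?divr_ge0// addr_ge0.
  apply: le_trans (main (eta / A) _) _; first by rewrite divr_gt0.
  rewrite mulrA ler_pdivrMr// mulrC ler_wpM2l ?(ltW eta0)//.
  by rewrite /A lerDl.
have := Lam_eq0 c1 pos L0 x; move/eqP; rewrite mulf_eq0 invr_eq0.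
by rewrite (negbTE (lt0r_neq0 (se0 x ltr01))) orbF => /eqP.
Qed.

End endgame.

(** * Bochner's inequality on the manifold and constancy of minimizers *)

Section minimizers.
Context {R : realType} {N : nat} {M : riemannianManifold R N}.
Variable mu : {measure set (borel M) -> \bar R}.
Hypothesis mu_riem : is_riemannian_measure mu.
Hypothesis M_compact : compact [set: M].
Hypothesis M_connected : connected [set: M].
Hypothesis ric_ge0 : nonneg_ricci M.
Implicit Types (c : chart R N M) (p : M) (x : 'rV[R]_N) (f : M -> R) (X Y : vfield M).
Notation Lam := (Lam mu).

Let lamD := @LamD R N M mu mu_riem M_compact.
Let lamZ (a : R) (f : M -> R) := @LamZ R N M mu mu_riem M_compact a f.
Let lamB := @LamB R N M mu mu_riem M_compact.

Lemma dirder_cst (a : R) X p : dirder (fun=> a) X p = 0.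
Proof.
by rewrite /dirder big1// => k _; rewrite (_ : (_ \o _) = cst a)// /partial derive_cst mul0r.
Qed.

Lemma smooth_fun_addc f (a : R) : smooth_fun f -> smooth_fun (fun p => f p + a).
Proof. by move=> sf; apply: smooth_funD sf _; exact: smooth_fun_cst. Qed.

Lemma dirder_addc f (a : R) X p : smooth_fun f -> dirder (fun q => f q + a) X p = dirder f X p.
Proof.
move=> sf; rewrite (dirderD X p sf (@smooth_fun_cst R N M a)) dirder_cst.
by rewrite addr0.
Qed.

Lemma dirder_sqrt f X p : smooth_fun f -> (forall q, 0 < f q) ->
  dirder (fun q => Num.sqrt (f q)) X p = dirder f X p / (2 * Num.sqrt (f p)).
Proof.
move=> sf f0; have ss := smooth_fun_sqrt sf f0.
have E : f = (fun q => Num.sqrt (f q) * Num.sqrt (f q)).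
  by apply/funext => q; rewrite -expr2 sqr_sqrtr// ltW.
have := dirderM X p ss ss; rewrite -E => ->.
have s0 : Num.sqrt (f p) != 0 by apply/lt0r_neq0; rewrite sqrtr_gt0.
by field.
Qed.

Lemma dirder_inv f X p : smooth_fun f -> (forall q, f q != 0) ->
  dirder (fun q => (f q)^-1) X p = - dirder f X p / f p ^+ 2.
Proof.
move=> sf f0; have sv := smooth_funV sf f0.
have E : (fun q => f q * (f q)^-1) = (fun=> 1) by apply/funext => q; rewrite mulfV.
have := dirderM X p sf sv; rewrite E dirder_cst => H.
have fp := f0 p; apply: (mulfI fp).
have -> : f p * dirder (fun q => (f q)^-1) X p = - (dirder f X p * (f p)^-1).
  by apply/eqP; rewrite -addr_eq0 addrC -H.
by field.
Qed.

Lemma ldiv_eq_on c (Z Z' : 'rV[R]_N -> 'rV[R]_N) x : (forall y, cod c y -> Z y = Z' y) ->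
  cod c x -> ldiv (metric c) Z x = ldiv (metric c) Z' x.
Proof.
move=> ZZ cx; rewrite /ldiv; congr (_ * _); apply: eq_bigr => i _.
by apply: (partial_eq_on i (cod_open c) _ cx) => y cy; rewrite ZZ.
Qed.

Lemma divergence_gradf f (sf : smooth_fun f) c p : atlas c -> dom c p ->
  divergence (gradf sf) p = ldiv (metric c) (lgrad (metric c) (f \o icoord c)) (c p).
Proof.
move=> ac cp; rewrite (divergence_chart mu_riem M_compact ac cp (gradf_smooth sf)) /ldivc.
by apply: ldiv_eq_on; [move=> y cy; rewrite /= icoordK|exact: cod_coord].
Qed.

Lemma dirder_gradf f g (sg : smooth_fun g) c p : smooth_fun f -> atlas c -> dom c p ->
  dirder f (gradf sg) p =
  \sum_k partial k (f \o icoord c) (c p) * lgrad (metric c) (g \o icoord c) (c p) 0 k.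
Proof. by move=> sf ac cp; rewrite (dirder_chart _ sf ac cp). Qed.

Section bochner.
Variables (u : M -> R) (su : smooth_fun u).

Definition nsq p := dirder u (gradf su) p.
Definition lap p := divergence (gradf su) p.

Lemma nsq_smooth : smooth_fun nsq.
Proof. exact: (dirder_smooth su (gradf_smooth su)). Qed.

Lemma lap_smooth : smooth_fun lap.
Proof. exact: (divergence_smooth mu_riem M_compact (gradf_smooth su)). Qed.

(** Transfers [bochner_kato] through the distinguished chart at [p]. The local and global
    expressions are identified on all of [cod c], not just at [p], because they are differentiated
    again. *)
Lemma bochner_kato_manifold p :
  let w := nsq p in let L := lap p in
  let B := 2^-1 * divergence (gradf nsq_smooth) p - dirder lap (gradf su) p in
  let q := 2^-1 * dirder nsq (gradf su) p in
  let z := 2^-1 ^+ 2 * dirder nsq (gradf nsq_smooth) p in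
  [/\ 0 <= w, L ^+ 2 <= N%:R * B, (L * w - q) ^+ 2 <= N%:R * (w * (B * w - z)) &
      w = 0 -> z = 0].
Proof.
pose c := chart_at p; have ac : atlas c := chart_at_atlas p; have cp : dom c p := chart_at_dom p.
have cx := cod_coord cp; have oc := cod_open c.
have gsm i j : smooth_on (cod c) (fun x => metric c x i j) := metric_smooth ac i j.
have gsym x : cod c x -> (metric c x)^T = metric c x by move=> H; exact: (Defs.metric_sym ac H).
have gpos x : cod c x -> posdef (metric c x) by move=> H; exact: (metric_posdef ac H).
have sf : smooth_on (cod c) (u \o icoord c) := su ac.
have := bochner_kato oc gsm gsym gpos sf cx (ric_ge0 ac cx _).
have swc : smooth_on (cod c) (nsq \o icoord c) := nsq_smooth ac.
have Ew x : cod c x -> gradsq (metric c) (u \o icoord c) x = (nsq \o icoord c) x.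
  move=> H; rewrite /= /nsq (dirder_gradf su su ac (dom_icoord H)) icoordK// /gradsq.
  by apply: eq_bigr => k _; rewrite mulrC.
have pEw k x : cod c x -> partial k (gradsq (metric c) (u \o icoord c)) x = partial k (nsq \o icoord c) x.
  by move=> H; exact: (partial_eq_on k oc Ew H).
have EL x : cod c x -> ldiv (metric c) (lgrad (metric c) (u \o icoord c)) x = (lap \o icoord c) x.
  by move=> H; rewrite /= /lap (divergence_gradf su ac (dom_icoord H)) icoordK.
have Eg x : cod c x -> lgrad (metric c) (gradsq (metric c) (u \o icoord c)) x
    = lgrad (metric c) (nsq \o icoord c) x.
  move=> H; rewrite /lgrad; congr (_ *m _); apply/rowP => k.
  by rewrite [LHS]mxE [RHS]mxE pEw.
have EB : ldiv (metric c) (fun y => 2^-1 *: lgrad (metric c) (gradsq (metric c) (u \o icoord c)) y) (c p)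
   = 2^-1 * divergence (gradf nsq_smooth) p.
  rewrite (divergence_gradf nsq_smooth ac cp) /ldiv mulrCA; congr (_ * _).
  rewrite mulr_sumr; apply: eq_bigr => i _.
  have sdZ : smooth_on (cod c) (fun y => Num.sqrt (\det (metric c y)) * lgrad (metric c) (nsq \o icoord c) y 0 i).
    apply: (smooth_onM oc (sqrt_det_smooth ac)).
    exact: (lgrad_smooth oc gsm gsym gpos i swc).
  rewrite -(partialZ oc 2^-1 i sdZ cx).
  apply: (partial_eq_on i oc _ cx) => y cy.
  by rewrite [X in _ * X]mxE (Eg y cy) mulrCA.
have Ed : \sum_m lgrad (metric c) (u \o icoord c) (c p) 0 m *
    partial m (ldiv (metric c) (lgrad (metric c) (u \o icoord c))) (c p) = dirder lap (gradf su) p.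
  apply: etrans _ (esym (dirder_gradf su lap_smooth ac cp)); apply: eq_bigr => k _.
  apply: etrans (mulrC _ _) _.
  exact: (congr1 (fun t => t * lgrad (metric c) (u \o icoord c) (c p) 0 k) (partial_eq_on k oc EL cx)).
have Eq : \sum_k partial k (gradsq (metric c) (u \o icoord c)) (c p) *
    lgrad (metric c) (u \o icoord c) (c p) 0 k = dirder nsq (gradf su) p.
  by rewrite (dirder_gradf su nsq_smooth ac cp); apply: eq_bigr => k _; rewrite pEw.
have Ez : \sum_k partial k (gradsq (metric c) (u \o icoord c)) (c p) *
    lgrad (metric c) (gradsq (metric c) (u \o icoord c)) (c p) 0 k = dirder nsq (gradf nsq_smooth) p.
  by rewrite (dirder_gradf nsq_smooth nsq_smooth ac cp); apply: eq_bigr => k _; rewrite pEw// Eg.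
by rewrite /= EB Ed Eq Ez (Ew _ cx) (EL _ cx) /= coordK.
Qed.

Lemma nsq0_partial c p k : (forall q, nsq q = 0) -> atlas c -> dom c p ->
  partial k (u \o icoord c) (c p) = 0.
Proof.
move=> w0 ac cp; have cx := cod_coord cp.
have H : innerc c (gradf su) (gradf su) p = 0.
  by rewrite -(inner_chart _ _ ac cp) (dirderE su) -/(nsq p) w0.
have G0 : lgrad (metric c) (u \o icoord c) (c p) = 0.
  apply/eqP; apply: contraT => G0; have := metric_pos ac cx G0.
  by rewrite -[X in 0 < X]/(innerc c (gradf su) (gradf su) p) H ltxx.
have := congr1 (fun v => (v *m metric c (c p)) 0 k) G0.
by rewrite /lgrad mulmxKV ?metric_unit// mul0mx !mxE.
Qed.

(** The level set of [u] through a point is closed by continuity, and open because [u] is constant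
    along segments in a coordinate ball, which is convex; connectedness concludes. *)
Lemma nsq0_constant : (forall q, nsq q = 0) -> exists k : R, forall p, u p = k.
Proof.
move=> w0; have cu : continuous u := smooth_fun_continuous su.
exists (u point) => p.
suff H : [set q | u q = u point] = [set: M].
  by have : [set q | u q = u point] p by rewrite H.
pose A := [set q | u q = u point]; rewrite -/A.
apply: M_connected.
- by exists point.
- exists A; last by rewrite setTI.
  rewrite openE => q Aq; rewrite /interior.
  have ac := chart_at_atlas q; have cq := chart_at_dom q; set c := chart_at q in ac cq *.
  have /nbhs_ballP [r /= r0 rc] : nbhs (c q) (cod c).
    by apply: open_nbhs_nbhs; split; [exact: cod_open|exact: cod_coord].
  have n1 : \forall q' \near q, dom c q' by apply: open_nbhs_nbhs; split=> //; exact: open_dom.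
  have n2 : \forall q' \near q, ball (c q) r (c q').
    by apply: (chart_continuous cq); exact: nbhsx_ballx.
  apply: filterS2 n1 n2 => q' cq' bq'; rewrite /A /= -Aq.
  pose v := c q' - c q.
  have ball_line (t : R) : `|t| <= 1 -> cod c (c q + t *: v).
    move=> t1; apply: rc; rewrite -ball_normE /= opprD addNKr normrN normrZ.
    move: bq'; rewrite -ball_normE /= distrC -/v; apply: le_lt_trans.
    by rewrite ler_piMl.
  have df (t : R) : `|t| <= 1 -> differentiable (u \o icoord c) (c q + t *: v).
    by move=> t1; exact: (smooth_on_differentiable (cod_open c) (su ac) (ball_line t t1)).
  have [t t1|s] := @MVT_line R _ (u \o icoord c) (c q) v 1.
    by apply: diff_derivable; apply: df; rewrite normr1 in t1.
  rewrite normr1 => s1; rewrite mul1r scale1r.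
  rewrite deriveE; last exact: df.
  rewrite (diff_partial v (df s s1)) big1; last first.
    move=> j _; rewrite -(icoordK (ball_line s s1)) (nsq0_partial j w0 ac) ?mulr0//.
    exact: dom_icoord (ball_line s s1).
  have -> : c q + v = c q' by rewrite /v addrC subrK.
  by rewrite /= !coordK// => /eqP; rewrite subr_eq0 => /eqP.
- exists A; last by rewrite setTI.
  have -> : A = u @^-1` [set u point] by [].
  by apply: closed_comp => [q _|]; [exact: cu|exact: closed_eq].
Qed.

End bochner.

Section minimizer.
Variables (F : R -> R) (F_C2 : C2 F) (E_wd : @energy_well_defined R N M mu F).
Variables (u0 : H1 mu) (u0_min : local_minimizer F u0).

Let su : smooth_fun u0 := u0_min.1.
Let w := nsq su.
Let L := lap su.
Let sw : smooth_fun w := nsq_smooth su.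
Let sL : smooth_fun L := lap_smooth su.
Let B p := 2^-1 * divergence (gradf sw) p - dirder L (gradf su) p.
Let q p := 2^-1 * dirder w (gradf su) p.
Let z p := 2^-1 ^+ 2 * dirder w (gradf sw) p.

Let cu : continuous u0. Proof. exact: (smooth_fun_continuous su). Qed.
Let cw : continuous w. Proof. exact: (smooth_fun_continuous sw). Qed.
Let cL : continuous L. Proof. exact: (smooth_fun_continuous sL). Qed.
Let cdw : continuous (divergence (gradf sw)).
Proof. exact: (smooth_fun_continuous (divergence_smooth mu_riem M_compact (gradf_smooth sw))). Qed.
Let cB : continuous B.
Proof.
exact: (contB (contZ _ (@cdw)) (smooth_fun_continuous (dirder_smooth sL (gradf_smooth su)))).
Qed.
Let cq : continuous q.
Proof. exact: (contZ _ (smooth_fun_continuous (dirder_smooth sw (gradf_smooth su)))). Qed.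
Let cz : continuous z.
Proof. exact: (contZ _ (smooth_fun_continuous (dirder_smooth sw (gradf_smooth sw)))). Qed.

Let cF2 : continuous (fun p => derive1n 2 F (u0 p)).
Proof. by have [_ _ H] := F_C2; exact: (cont_comp H (@cu)). Qed.

Let w0 p : 0 <= w p.
Proof. by have [] := bochner_kato_manifold su p. Qed.

Let BE p : B p = 2^-1 * divergence (gradf sw) p + derive1n 2 F (u0 p) * w p.
Proof.
rewrite /B; congr (_ + _).
have LE : L = (fun y => - derive1 F y) \o u0.
  by apply/funext => r; rewrite /L /lap /= (euler_lagrange mu_riem M_compact su r F_C2 E_wd u0_min).
have [_ dF' _] := F_C2.
have dN : derivable (fun y => - derive1 F y) (u0 p) 1 by apply: derivableN; exact: dF'.
rewrite LE (dirder_comp _ su dN) derive1E deriveN; last exact: dF'.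
by rewrite mulNr opprK /= derive1E.
Qed.

(** The Laplacian of [w] integrates to 0, by the divergence theorem with the constant function 1. *)
Let LamB : Lam B = Lam (fun p => derive1n 2 F (u0 p) * w p).
Proof.
have -> : B = (fun p => 2^-1 * divergence (gradf sw) p + derive1n 2 F (u0 p) * w p).
  by apply/funext => p; exact: BE.
rewrite (lamD (contZ _ (@cdw)) (contM (@cF2) (@cw))) (lamZ _ (@cdw)).
have := divergence_theorem mu_riem M_compact (gradf_smooth sw) (@smooth_fun_cst R N M 1).
have -> : (fun p => 1 * divergence (gradf sw) p) = divergence (gradf sw).
  by apply/funext => p; rewrite mul1r.
have -> : dirder (fun=> 1) (gradf sw) = (fun p => 0 * divergence (gradf sw) p).
  by apply/funext => p; rewrite dirder_cst mul0r.
by rewrite (lamZ 0 (@cdw)) mul0r oppr0 => ->; rewrite mulr0 add0r.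
Qed.

Let we0 e p : 0 < e -> 0 < w p + e.
Proof. by move=> e0; rewrite ltr_wpDl. Qed.

Let cr e : 0 < e -> continuous (fun p => (w p + e)^-1).
Proof.
move=> e0; have sv := smooth_funV (smooth_fun_addc e sw) (fun p => lt0r_neq0 (we0 p e0)).
exact: (smooth_fun_continuous sv).
Qed.

(** For the test function sqrt (w + e) the squared gradient is z / (w + e), and the integral of
    F''(u) (w + e) is that of [B] plus e times that of F''(u). *)
Let stable e : 0 < e ->
  Lam (fun p => B p - z p / (w p + e)) <= e * `|Lam (fun p => derive1n 2 F (u0 p))|.
Proof.
move=> e0; have swe := smooth_fun_addc e sw.
have spos p : 0 < w p + e by exact: we0.
have sphi := smooth_fun_sqrt swe spos.
have [_ H] := competitor_variations mu_riem M_compact su sphi F_C2 E_wd u0_min.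
have dE p : dirder (fun p => Num.sqrt (w p + e)) (gradf sphi) p = z p / (w p + e).
  rewrite (dirder_sqrt _ p swe spos) (dirder_addc _ _ p sw) (dirderC sw sphi).
  rewrite (dirder_sqrt _ p swe spos) (dirder_addc _ _ p sw) /z.
  have s0 : Num.sqrt (w p + e) != 0 by apply/lt0r_neq0; rewrite sqrtr_gt0.
  by rewrite -[in RHS](sqr_sqrtr (ltW (spos p))); field.
have cze := contM (@cz) (@cr e e0).
have cFwe := contM (@cF2) (smooth_fun_continuous swe).
have E1 : 0 <= Lam (fun p => z p / (w p + e)) - Lam (fun p => derive1n 2 F (u0 p) * (w p + e)).
  rewrite -(lamB cze cFwe); move: H; congr (_ <= Lam _); apply/funext => p.
  by rewrite dE sqr_sqrtr ?(ltW (spos p))// [X in _ - X]mulrC.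
have E2 : Lam (fun p => derive1n 2 F (u0 p) * (w p + e)) =
    Lam B + e * Lam (fun p => derive1n 2 F (u0 p)).
  rewrite LamB -(lamZ e (@cF2)) -(lamD (contM (@cF2) (@cw)) (contZ e (@cF2))).
  by congr Lam; apply/funext => p; rewrite mulrDr [e * _]mulrC.
rewrite (lamB (@cB) cze); rewrite E2 in E1.
have h1 : - Lam (fun p => derive1n 2 F (u0 p)) <= `|Lam (fun p => derive1n 2 F (u0 p))|.
  by rewrite -normrN ler_norm.
have h2 := ler_wpM2l (ltW e0) h1.
apply: le_trans h2; rewrite mulrN lerBlDr addrC -lerBlDr opprK.
by rewrite subr_ge0 in E1.
Qed.

(* The divergence theorem for the field grad u0 and the function u0 / sqrt (w + e). *)
Let weighted e : 0 < e -> Lam (fun p => w p / Num.sqrt (w p + e)) =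
  - Lam (fun p => u0 p * (L p * (w p + e) - q p) / Num.sqrt (w p + e) ^+ 3).
Proof.
move=> e0; have swe := smooth_fun_addc e sw.
have spos p : 0 < w p + e by exact: we0.
have ss := smooth_fun_sqrt swe spos.
have s0 p : Num.sqrt (w p + e) != 0 by apply/lt0r_neq0; rewrite sqrtr_gt0.
have sr := smooth_funV ss s0.
have sphi := smooth_funM su sr.
have := divergence_theorem mu_riem M_compact (gradf_smooth su) sphi.
set phi := fun p => u0 p * (Num.sqrt (w p + e))^-1.
have dE p : dirder phi (gradf su) p = w p / Num.sqrt (w p + e) - u0 p * q p / Num.sqrt (w p + e) ^+ 3.
  rewrite /phi (dirderM _ p su sr) (dirder_inv _ p ss s0) (dirder_sqrt _ p swe spos).
  rewrite (dirder_addc _ _ p sw) /q -/(nsq su p) -/w.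
  by have := s0 p => sp; field.
have c1 := contM (@cw) (smooth_fun_continuous sr).
have c2 : continuous (fun p => u0 p * q p / Num.sqrt (w p + e) ^+ 3).
  pose r p := (Num.sqrt (w p + e))^-1; have cr' : continuous r := smooth_fun_continuous sr.
  rewrite (_ : (fun p => _) = (fun p => u0 p * q p * (r p * (r p * r p)))).
    exact: (contM (contM (@cu) (@cq)) (contM cr' (contM cr' cr'))).
  by apply/funext => p; rewrite /r -exprVn !exprS expr0 mulr1.
have c3 := contM (smooth_fun_continuous sphi) (@cL).
have -> : dirder phi (gradf su) = (fun p => w p / Num.sqrt (w p + e) - u0 p * q p / Num.sqrt (w p + e) ^+ 3).
  by apply/funext => p; exact: dE.
rewrite (lamB c1 c2) => H.
have -> : (fun p => u0 p * (L p * (w p + e) - q p) / Num.sqrt (w p + e) ^+ 3) =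
    (fun p => phi p * L p - u0 p * q p / Num.sqrt (w p + e) ^+ 3).
  apply/funext => p; rewrite /phi -[X in L p * X](sqr_sqrtr (ltW (spos p))).
  by have := s0 p => sp; field.
rewrite (lamB c3 c2).
have -> : Lam (fun p => phi p * L p) = _ := H.
by rewrite opprB opprK addrC subrK.
Qed.

Lemma minimizer_nsq0 p : nsq su p = 0.
Proof.
(* [endgame] divides by the dimension; in dimension 0 the squared gradient is an empty sum. *)
have [N0|N0] := eqVneq N 0%N.
  rewrite /nsq /dirder big1// => k _; exfalso.
  by case: k => k; rewrite N0.
have n0 : 0 < N%:R :> R by rewrite ltr0n lt0n.
have [K _ uK] := compact_le_bound M_compact (fun (p : M) _ => @cu p).
have lamle := @Lam_le R N M mu mu_riem M_compact.
have lameq0 := @Lam_eq0 R N M mu mu_riem M_compact.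
have H := @endgame R M Lam lamD lamZ lamle lameq0.
have H1 := H u0 w L B q z N%:R `|Lam (fun p => derive1n 2 F (u0 p))|.
have H2 := H1 (@cu) (@cw) (@cL).
have H3 := H2 (@cB) (@cz) n0 w0.
have H4 := H3 (fun r => let: And4 _ h _ _ := bochner_kato_manifold su r in h).
have H5 := H4 (fun r => let: And4 _ _ h _ := bochner_kato_manifold su r in h).
have H6 := H5 (fun r => let: And4 _ _ _ h := bochner_kato_manifold su r in h).
exact: (H6 stable weighted K (fun r => uK r I)).
Qed.

Lemma minimizer_constant : exists k : R, forall p, u0 p = k.
Proof. exact: (nsq0_constant (su := su) minimizer_nsq0). Qed.

End minimizer.

End minimizers.

Theorem theorem1 (R : realType) (N : nat) (M : riemannianManifold R N)
    (mu : {measure set (borel M) -> \bar R}) (F : R -> R)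
    (mu_riemannian : is_riemannian_measure mu)
    (M_compact : compact [set: M]) (M_connected : connected [set: M])
    (F_C2 : C2 F) (E_well_defined : @energy_well_defined R N M mu F)
    (ric_ge0 : nonneg_ricci M)
    (u0 : H1 mu) (u0_min : local_minimizer F u0) :
  exists k : R, forall p : M, u0 p = k.
Proof.
exact: (minimizer_constant mu_riemannian M_compact M_connected ric_ge0 F_C2 E_well_defined u0_min).
Qed.
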